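(* Let $\mu$ be Haar measure (normalized arc length) on the unit circle $\mathbb{T}$ and let $\alpha$ be a continuous normalized gauge norm on $L^{\infty}(\mu)$. Suppose that $c>0$ and that $\lambda$ is a probability measure on $\mathbb{T}$, mutually absolutely continuous with respect to $\mu$, such that $\alpha$ is $c\Vert\cdot\Vert_{1,\lambda}$-dominating and $\log|d\lambda/d\mu|\in L^{1}(\mu)$. Then a closed linear subspace $W$ of $L^{\alpha}(\mu)$ satisfies $zW\subset W$ if and only if either $W=\varphi H^{\alpha}(\mu)$ for some unimodular function $\varphi$, or $W=\chi_{E}L^{\alpha}(\mu)$ for some Borel subset $E$ of $\mathbb{T}$. Moreover, if $W$ is a closed linear subspace of $L^\alpha(\mu)$ with $zW\subset W$ and $0\neq W\subset H^{\alpha}(\mu)$, then $W=\varphi H^{\alpha}(\mu)$ for some inner function $\varphi$.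
   Context: A norm $\alpha$ on $L^{\infty}(\mu)=L^\infty(\mathbb{T},\mu)$ is a normalized gauge norm if $\alpha(1)=1$ and $\alpha(|f|)=\alpha(f)$ for all $f\in L^\infty(\mu)$; it is continuous if $\alpha(\chi_{E_n})\to0$ whenever $\mu(E_n)\to 0$. It is $c\Vert\cdot\Vert_{1,\lambda}$-dominating if $\alpha(f)\ge c\int_{\mathbb T}|f|\,d\lambda$ for all $f\in L^\infty(\mu)$. Extend $\alpha$ to all measurable $f$ by $\alpha(f)=\sup\{\alpha(s): s \text{ a simple function}, 0\le s\le |f|\}$; $\mathcal{L}^\alpha(\mu)$ is the set of measurable $f$ (modulo a.e. equality) with $\alpha(f)<\infty$, and $L^{\alpha}(\mu)$ is the $\alpha$-closure of $L^\infty(\mu)$ in $\mathcal{L}^\alpha(\mu)$. $H^\infty=H^\infty(\mu)$ is the classical Hardy space of bounded functions on $\mathbb T$ (the weak*-closure of the analytic polynomials in $L^\infty(\mu)$), and $H^{\alpha}(\mu)$ is the $\alpha$-closure of $H^\infty$ in $L^\alpha(\mu)$. Closed means $\alpha$-closed; $z$ is the coordinate function on $\mathbb{T}$. A function $\varphi$ is unimodular if $|\varphi|=1$ a.e.; an inner function is a unimodular function in $H^\infty$. *)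

(* Defs.v *)
From HB Require Import structures.
From mathcomp Require Import all_boot all_order all_algebra complex.
From mathcomp Require Import all_classical all_reals all_analysis.

Set Implicit Arguments.
Unset Strict Implicit.
Unset Printing Implicit Defensive.

Import Order.TTheory GRing.Theory Num.Theory numFieldNormedType.Exports.
Import HBNNSimple.

Local Open Scope classical_set_scope.
Local Open Scope complex_scope.
Local Open Scope ring_scope.

Definition circle (R : realType) : Type := {z : R[i] | `|z| == 1}.

Section circle_structure.
Variable R : realType.

HB.instance Definition _ := Choice.on (circle R).

Definition circle1 : circle R := exist _ 1 (introT eqP (normr1 R[i])).

HB.instance Definition _ := isPointed.Build (circle R) circle1.

Definition zcoord (x : circle R) : R[i] := sval x.

(* The alias R[i]^o is what carries the usual topology of the complex plane. *)
Definition circle_open : set (set (circle R)) :=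
  preimage_set_system setT zcoord (@open R[i]^o).

HB.instance Definition _ :=
  Measurable.copy (circle R) (g_sigma_algebraType circle_open).

Lemma expi_subproof (t : R) : `|cos t +i* sin t| == 1.
Proof. by rewrite normc_def /= cos2Dsin2 sqrtr1. Qed.

Definition expi (t : measurableTypeR R) : circle R :=
  exist _ (cos (t : R) +i* sin (t : R)) (expi_subproof t).

Lemma continuous_zcoord_expi : continuous (zcoord \o (expi : R -> circle R) : R -> R[i]^o).
Proof.
move=> t; apply/cvgrPdist_lt => e; rewrite ltcE /= => /andP[/eqP ei er].
have e2 : 0 < complex.Re e / 2 by rewrite divr_gt0.
near=> s.
have c : `|cos t - cos s| < complex.Re e / 2.
  by near: s; move/cvgrPdist_lt: (@continuous_cos R t); exact.
have d : `|sin t - sin s| < complex.Re e / 2.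
  by near: s; move/cvgrPdist_lt: (@continuous_sin R t); exact.
rewrite /zcoord /=; set a := cos t - cos s in c *; set b := sin t - sin s in d *.
have -> : (cos t +i* sin t) - (cos s +i* sin s) = a%:C + b%:C * 'i%C.
  by apply/eqP; rewrite eq_complex /= !(mul0r, mulr0, mulr1, subr0, addr0, add0r) !eqxx.
apply: (le_lt_trans (ler_normD _ _)).
rewrite normrM !normc_def /= !expr0n /= !expr1n !addr0 add0r sqrtr1 mulr1 !sqrtr_sqr.
rewrite ltcE /= addr0 -ei eqxx /=.
by rewrite (splitr (complex.Re e)) ltrD.
Unshelve. all: by end_near. Qed.

Lemma measurable_expi : measurable_fun [set: measurableTypeR R] expi.
Proof.
apply: (@measurability _ _ _ _ _ _ circle_open) => //.
move=> _ [_ [U oU <-] <-]; rewrite !setTI -comp_preimage.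
apply: (@measurable_realfun.open_measurable R).
move/continuousP: continuous_zcoord_expi; exact.
Qed.

HB.instance Definition _ := isMeasurableFun.Build _ _ (measurableTypeR R) (circle R)
  expi measurable_expi.

Lemma twopi_gt0 : 0 < 2 * pi :> R.
Proof. by rewrite mulr_gt0 ?pi_gt0. Qed.

End circle_structure.

(* Normalized arc length: the law of e^(it) for t uniform on [0, 2 pi]. *)
Definition arc_length (R : realType) : probability (circle R) R :=
  distribution (uniform_prob (twopi_gt0 R))
    (@expi R : {mfun measurableTypeR R >-> circle R}).

(* Elements of L^oo, L^alpha, H^alpha, ... are represented by functions; all
   these sets, as well as the subspaces considered below, consist of measurable
   functions and are stable under a.e. equality, so that equality of two of them
   is equality of the corresponding sets of a.e. classes. *)
Section function_spaces.
Variable R : realType.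
Local Notation T := (circle R).
Local Notation C := (R[i]).
Local Notation mu := (arc_length R).

Definition cmod (z : C) : R := complex.Re `|z|.

Definition cmeasurable (f : T -> C) : Prop :=
  measurable_fun setT (fun x => complex.Re (f x)) /\
  measurable_fun setT (fun x => complex.Im (f x)).

Definition cintegrable (f : T -> C) : Prop :=
  cmeasurable f /\ mu.-integrable setT (fun x => (cmod (f x))%:E).

Definition cintegral (f : T -> C) : C :=
  (\int[mu]_x complex.Re (f x)) +i* (\int[mu]_x complex.Im (f x)).

Definition cindic (E : set T) (x : T) : C := (\1_E x : R)%:C.

Definition Linfty : set (T -> C) :=
  [set f | cmeasurable f /\ exists M : R, {ae mu, forall x, cmod (f x) <= M}].

Definition analytic_polynomials : set (T -> C) :=
  [set (fun x => p.[zcoord x]) | p in [set: {poly C}]].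

(* Closure for the topology sigma(L^oo, L^1), written with basic
   neighbourhoods. *)
Definition weakstar_closure (S : set (T -> C)) : set (T -> C) :=
  [set f | Linfty f /\
    forall (n : nat) (g : 'I_n -> T -> C) (e : R),
      (forall i, cintegrable (g i)) -> 0 < e ->
      exists2 h, S h &
        forall i, cmod (cintegral (fun x => (f x - h x) * g i x)) < e].

Definition Hinfty : set (T -> C) := weakstar_closure analytic_polynomials.

Definition unimodular (phi : T -> C) : Prop :=
  cmeasurable phi /\ {ae mu, forall x, `|phi x| = 1}.

Definition inner (phi : T -> C) : Prop := unimodular phi /\ Hinfty phi.

(* Only the values of alpha on L^oo matter. *)
Record normalized_gauge_norm (alpha : (T -> C) -> R) : Prop := {
  gauge_ae_eq : forall f g, Linfty f -> Linfty g ->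
    {ae mu, forall x, f x = g x} -> alpha f = alpha g;
  gauge_ge0 : forall f, Linfty f -> 0 <= alpha f;
  gauge_eq0 : forall f, Linfty f -> alpha f = 0 -> {ae mu, forall x, f x = 0};
  gaugeZ : forall (a : C) f, Linfty f ->
    alpha (fun x => a * f x) = cmod a * alpha f;
  gaugeD : forall f g, Linfty f -> Linfty g ->
    alpha (fun x => f x + g x) <= alpha f + alpha g;
  gauge1 : alpha (fun=> 1) = 1;
  gauge_norm : forall f, Linfty f -> alpha (fun x => `|f x|) = alpha f }.

Definition continuous_gauge (alpha : (T -> C) -> R) : Prop :=
  forall E : nat -> set T, (forall n, measurable (E n)) ->
    mu (E n) @[n --> \oo] --> 0%E -> alpha (cindic (E n)) @[n --> \oo] --> 0.

Definition dominating (c : R) (lambda : probability T R)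
    (alpha : (T -> C) -> R) : Prop :=
  forall f, Linfty f ->
    (c%:E * \int[lambda]_x (cmod (f x))%:E <= (alpha f)%:E)%E.

Section alpha.
Variable alpha : (T -> C) -> R.

Definition gauge_ext (f : T -> C) : \bar R :=
  ereal_sup [set (alpha (fun x => (s x)%:C))%:E | s in
    [set s : {nnsfun T >-> R} | {ae mu, forall x, s x <= cmod (f x)}]].

Definition scriptL : set (T -> C) :=
  [set f | cmeasurable f /\ (gauge_ext f < +oo)%E].

Definition alpha_adherent (S : set (T -> C)) : set (T -> C) :=
  [set f | forall e : R, 0 < e ->
    exists2 g, S g & (gauge_ext (fun x => f x - g x)%R < e%:E)%E].

Definition Lalpha : set (T -> C) := scriptL `&` alpha_adherent Linfty.

Definition Halpha : set (T -> C) := Lalpha `&` alpha_adherent Hinfty.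

Record closed_subspace (W : set (T -> C)) : Prop := {
  subspace_sub : W `<=` Lalpha;
  subspace_ae : forall f g, W f -> cmeasurable g ->
    {ae mu, forall x, f x = g x} -> W g;
  subspace0 : W (fun=> 0);
  subspaceD : forall f g, W f -> W g -> W (fun x => f x + g x);
  subspaceZ : forall (a : C) f, W f -> W (fun x => a * f x);
  subspace_closed : Lalpha `&` alpha_adherent W `<=` W }.

End alpha.

Definition zero_subspace : set (T -> C) :=
  [set f | cmeasurable f /\ {ae mu, forall x, f x = 0}].

Definition mul_set (phi : T -> C) (S : set (T -> C)) : set (T -> C) :=
  [set g | cmeasurable g /\
    exists2 h, S h & {ae mu, forall x, g x = phi x * h x}].

End function_spaces.

(* Main.v *)
From HB Require Import structures.
From mathcomp Require Import all_boot all_order all_algebra complex.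
From mathcomp Require Import all_classical all_reals all_analysis.
From mathcomp Require Import measurable_realfun ring lra zify.
Require Import Defs.

Set Implicit Arguments.
Unset Strict Implicit.
Unset Printing Implicit Defensive.

Import Order.TTheory GRing.Theory Num.Theory numFieldNormedType.Exports.
Import HBNNSimple.

Local Open Scope classical_set_scope.
Local Open Scope complex_scope.
Local Open Scope ring_scope.

(* The L^2 theorem of Beurling and Helson is transferred to L^alpha through
   bounded functions.  Let w = d lambda / d mu.  Domination extends to
   c \int |f| w dmu <= alpha(f), and log w in L^1 then gives log^+ |f| in L^1 for
   every f in L^alpha.  By Szego's theorem there are outer functions h_n in
   H^infty with |h_n| = min(1, n/|f|) and h_n -> 1 in mean.  Continuity of alpha
   makes b |-> alpha(b f) small on uniformly bounded b that are small in mean.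
   An invariant W is therefore stable under H^infty, the bounded elements h_n f
   are dense in W, and W and the L^2 closure of its bounded part have the same
   bounded elements; that closure is phi H^2 or chi_E L^2, which determines W.
   When W lies in H^alpha, an outer function with modulus min(1, w) shows that
   the bounded elements of H^alpha are in H^infty. *)

(** Elements of L^alpha need not be mu-integrable, let alone square integrable, so they have no
    Fourier coefficients or orthogonal projections of their own; every Hilbert space argument is run
    on bounded functions. Hard truncation of f in W leaves W in general, whereas multiplication by a
    function of H^infty does not: this is why moduli are cut down by outer functions. No function
    theory in the disc is used. With k = e^u, u <= 0 integrable, an outer function of modulus k
    comes from the Beurling-Helson theorem itself, applied to the L^2 closure of k C[z]: Szego's
    inequality keeps k at distance at least exp(int u) from z k C[z], which excludes chi_E L^2, and
    if the closure is phi H^2 then phi^* k is the function sought, up to a constant. Its modulus is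
    at most 1 and its mean, once rotated, at least exp(int u), so its squared L^2 distance to 1 is
    at most -2 int u. Analyticity is tested by the moments against z^n, n >= 1. Fejer means link
    this test to weak* closures, being polynomials bounded by the sup norm, and give the uniqueness
    of moments. *)

Local Notation Re := complex.Re.
Local Notation Im := complex.Im.

(** * Complex-valued functions on the circle *)

Section complex_modulus.
Variable R : realType.
Local Notation C := (R[i]).
Implicit Types z w : C.

Lemma cRe0 : Re (0 : C) = 0. Proof. by []. Qed.
Lemma cIm0 : Im (0 : C) = 0. Proof. by []. Qed.
Lemma cRe1 : Re (1 : C) = 1. Proof. by []. Qed.
Lemma cIm1 : Im (1 : C) = 0. Proof. by []. Qed.
Lemma cReC (x : R) : Re x%:C = x. Proof. by []. Qed.
Lemma cImC (x : R) : Im x%:C = 0. Proof. by []. Qed.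
Lemma cReD z w : Re (z + w) = Re z + Re w.
Proof. by case: z w => [a b] [c d]. Qed.
Lemma cImD z w : Im (z + w) = Im z + Im w.
Proof. by case: z w => [a b] [c d]. Qed.
Lemma cReN z : Re (- z) = - Re z. Proof. by case: z. Qed.
Lemma cImN z : Im (- z) = - Im z. Proof. by case: z. Qed.
Lemma cReM z w : Re (z * w) = Re z * Re w - Im z * Im w.
Proof. by case: z w => [a b] [c d]. Qed.
Lemma cImM z w : Im (z * w) = Re z * Im w + Im z * Re w.
Proof. by case: z w => [a b] [c d]. Qed.
Lemma cReJ z : Re (z^*) = Re z. Proof. by case: z. Qed.
Lemma cImJ z : Im (z^*) = - Im z. Proof. by case: z. Qed.

Definition cpart := (cRe0, cIm0, cRe1, cIm1, cReC, cImC, cReD, cImD, cReN,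
  cImN, cReM, cImM, cReJ, cImJ).

Lemma eqC z w : Re z = Re w -> Im z = Im w -> z = w.
Proof. by case: z w => [a b] [c d] /= -> ->. Qed.

Lemma cmodE z : cmod z = Num.sqrt (Re z ^+ 2 + Im z ^+ 2).
Proof. by rewrite /cmod normc_def. Qed.

Lemma cmodN z : cmod (- z) = cmod z.
Proof. by rewrite /cmod normrN. Qed.

Lemma cmodC z : (cmod z)%:C = `|z|.
Proof. by apply: eqC; rewrite /cmod normc_def. Qed.

Lemma cmod_ge0 z : 0 <= cmod z.
Proof. by rewrite cmodE sqrtr_ge0. Qed.

Lemma cmodM z w : cmod (z * w) = cmod z * cmod w.
Proof.
by rewrite /cmod normrM cReM -!cmodC !cImC mulr0 subr0.
Qed.

Lemma cmodD z w : cmod (z + w) <= cmod z + cmod w.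
Proof. by have := ler_normD z w; rewrite -!cmodC -rmorphD /= lecR. Qed.

Lemma cmodB z w : cmod (z - w) <= cmod z + cmod w.
Proof. by rewrite -(cmodN w) cmodD. Qed.

Lemma cmod0 : cmod (0 : C) = 0.
Proof. by rewrite /cmod normr0. Qed.

Lemma cmod1 : cmod (1 : C) = 1.
Proof. by rewrite /cmod normr1. Qed.

Lemma cmod_eq0 z : cmod z = 0 -> z = 0.
Proof. by move=> z0; apply/normr0_eq0; rewrite -cmodC z0. Qed.

Lemma cmod_real (x : R) : cmod x%:C = `|x|.
Proof. by rewrite cmodE cReC cImC expr0n addr0 sqrtr_sqr. Qed.

Lemma cmodJ z : cmod (z^*) = cmod z.
Proof. by rewrite !cmodE cReJ cImJ sqrrN. Qed.

Lemma cmodX z n : cmod (z ^+ n) = cmod z ^+ n.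
Proof. by elim: n => [|n IH]; rewrite ?expr0 ?cmod1// !exprS cmodM IH. Qed.

Lemma sqr_cmod z : cmod z ^+ 2 = Re z ^+ 2 + Im z ^+ 2.
Proof. by rewrite cmodE sqr_sqrtr// addr_ge0// sqr_ge0. Qed.

Lemma mulJ z : z * z^* = (cmod z ^+ 2)%:C.
Proof. by apply: eqC; rewrite ?sqr_cmod !cpart; ring. Qed.

Lemma normRe_le z : `|Re z| <= cmod z.
Proof.
rewrite -(ler_pXn2r (_ : (0 < 2)%N)) ?nnegrE ?cmod_ge0//.
by rewrite sqr_cmod real_normK ?num_real// lerDl sqr_ge0.
Qed.

Lemma normIm_le z : `|Im z| <= cmod z.
Proof.
rewrite -(ler_pXn2r (_ : (0 < 2)%N)) ?nnegrE ?cmod_ge0//.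
by rewrite sqr_cmod real_normK ?num_real// lerDr sqr_ge0.
Qed.

Lemma Re_le z : Re z <= cmod z.
Proof. exact: le_trans (ler_norm _) (normRe_le z). Qed.

Lemma cmod_leD z : cmod z <= `|Re z| + `|Im z|.
Proof.
rewrite -(ler_pXn2r (_ : (0 < 2)%N)) ?nnegrE ?cmod_ge0 ?addr_ge0//.
rewrite sqr_cmod sqrrD !real_normK ?num_real// addrAC lerDl.
by rewrite mulrn_wge0// mulr_ge0.
Qed.

Lemma cmodV z : cmod z^-1 = (cmod z)^-1.
Proof.
have [->|z0] := eqVneq z 0; first by rewrite !(invr0, cmod0).
have m0 : cmod z != 0 by apply: contra_neq z0; exact: cmod_eq0.
by apply: (mulIf m0); rewrite -cmodM mulVf// mulVf// cmod1.
Qed.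

Lemma cmod_sqrD z w : cmod (z + w) ^+ 2 <= 2 * cmod z ^+ 2 + 2 * cmod w ^+ 2.
Proof.
rewrite !sqr_cmod !cpart; set a := Re z; set b := Re w; set c := Im z; set d := Im w.
have := sqr_ge0 (a - b); have := sqr_ge0 (c - d); lra.
Qed.

Lemma cmod_mul_le z w : cmod (z * w) <= (cmod z ^+ 2 + cmod w ^+ 2) / 2.
Proof. by rewrite cmodM; have := sqr_ge0 (cmod z - cmod w); lra. Qed.

Lemma cmod_norm1 z : `|z| = 1 <-> cmod z = 1.
Proof. by rewrite -cmodC; split => [/(congr1 (@complex.Re R))//|->]. Qed.

Lemma cmod1_invJ z : cmod z = 1 -> z^* * z = 1.
Proof. by rewrite mulrC mulJ => ->; rewrite expr1n. Qed.

End complex_modulus.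

Lemma ae_and d (T : measurableType d) (R : realType)
    (P : {measure set T -> \bar R}) (A B : T -> Prop) :
  {ae P, forall x, A x} -> {ae P, forall x, B x} ->
  {ae P, forall x, A x /\ B x}.
Proof. exact: (@filterI _ (almost_everywhere P)). Qed.

Lemma ae_imp d (T : measurableType d) (R : realType)
    (P : {measure set T -> \bar R}) (A B : T -> Prop) :
  (forall x, A x -> B x) -> {ae P, forall x, A x} -> {ae P, forall x, B x}.
Proof. exact: (@filterS _ (almost_everywhere P)). Qed.

(** * Real integrals against a probability measure *)

Section real_integral.
Context d (T : measurableType d) (R : realType) (P : probability T R).
Implicit Types f g : T -> R.
Local Notation rint f := (P.-integrable setT (fun x => (f x)%:E)).
Local Notation I f := (\int[P]_x f x).

Lemma rint_meas f : rint f -> measurable_fun setT f.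
Proof. by move=> /integrableP[/measurable_EFinP]. Qed.

Lemma rint_ae_le f g : measurable_fun setT f ->
  {ae P, forall x, `|f x| <= g x} -> rint g -> rint f.
Proof.
move=> mf fg rg; have mg := rint_meas rg.
apply/integrableP; split; first exact/measurable_EFinP.
have /integrableP[_] := rg; apply: le_lt_trans.
apply: ae_ge0_le_integral => //.
- exact/measurableT_comp/measurable_EFinP.
- exact/measurableT_comp/measurable_EFinP.
by apply: filterS fg => x fgx _; rewrite lee_fin (le_trans fgx)// ler_norm.
Qed.

Lemma rint_le f g : measurable_fun setT f -> (forall x, `|f x| <= g x) ->
  rint g -> rint f.
Proof. by move=> mf fg; apply: rint_ae_le => //; exact: aeW. Qed.

Lemma rint_cst (c : R) : rint (fun=> c).
Proof. exact: finite_measure_integrable_cst. Qed.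

Lemma rint_bnd f (M : R) : measurable_fun setT f ->
  {ae P, forall x, `|f x| <= M} -> rint f.
Proof. by move=> mf fM; apply: rint_ae_le fM _ => //; exact: rint_cst. Qed.

Lemma rintD f g : rint f -> rint g -> rint (fun x => f x + g x).
Proof. by move=> rf rg; exact: (integrableD measurableT rf rg). Qed.

Lemma rintZ (c : R) f : rint f -> rint (fun x => c * f x).
Proof. by move=> rf; exact: (integrableZl measurableT c rf). Qed.

Lemma rintN f : rint f -> rint (fun x => - f x).
Proof. by move=> rf; exact: (integrableN rf). Qed.

Lemma rintB f g : rint f -> rint g -> rint (fun x => f x - g x).
Proof. by move=> rf rg; exact: (integrableB measurableT rf rg). Qed.

Lemma rint_norm f : rint f -> rint (fun x => `|f x|).
Proof. by move=> rf; exact: (integrable_norm rf). Qed.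

Lemma rint_ae f g : measurable_fun setT g -> {ae P, forall x, f x = g x} ->
  rint f -> rint g.
Proof.
move=> mg fg /rint_norm; apply: rint_ae_le => //.
by apply: filterS fg => x ->.
Qed.

Lemma I_fin f : rint f -> (\int[P]_x (f x)%:E = (I f)%:E)%E.
Proof. by move=> rf; rewrite fineK// integrable_fin_num. Qed.

Lemma I_D f g : rint f -> rint g -> I (fun x => f x + g x) = I f + I g.
Proof. by move=> rf rg; rewrite RintegralD. Qed.

Lemma I_B f g : rint f -> rint g -> I (fun x => f x - g x) = I f - I g.
Proof. by move=> rf rg; rewrite RintegralB. Qed.

Lemma I_Z (c : R) f : rint f -> I (fun x => c * f x) = c * I f.
Proof. by move=> rf; rewrite RintegralZl. Qed.

Lemma I_N f : rint f -> I (fun x => - f x) = - I f.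
Proof.
by move=> rf; under eq_Rintegral do rewrite -mulN1r; rewrite I_Z// mulN1r.
Qed.

Lemma I_cst (c : R) : I (fun=> c) = c.
Proof.
by rewrite Rintegral_cst// [X in fine X]probability_setT mulr1.
Qed.

Lemma I_ae f g : measurable_fun setT f -> measurable_fun setT g ->
  {ae P, forall x, f x = g x} -> I f = I g.
Proof.
move=> mf mg fg; congr fine; apply: ae_eq_integral => //.
- exact/measurable_EFinP.
- exact/measurable_EFinP.
by apply: filterS fg => x -> _.
Qed.

(** f is replaced by min(f, g), which agrees with it a.e. and lies below g everywhere, so that
    pointwise monotonicity applies. *)
Lemma I_le_ae f g : rint f -> rint g -> {ae P, forall x, f x <= g x} ->
  I f <= I g.
Proof.
move=> rf rg fg; have mf := rint_meas rf; have mg := rint_meas rg.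
have rm : rint (fun x => Num.min (f x) (g x)).
  apply: (rint_le _ _ (rintD (rint_norm rf) (rint_norm rg))).
    exact: measurable_minr.
  move=> x; rewrite /Order.min; case: ifP => _; first by rewrite lerDl.
  by rewrite lerDr.
rewrite (I_ae (g := fun x => Num.min (f x) (g x)))//; last 2 first.
- exact: measurable_minr.
- by apply: filterS fg => x ?; rewrite min_l.
by apply: le_Rintegral => // x _; rewrite ge_min lexx orbT.
Qed.

Lemma I_le f g : rint f -> rint g -> (forall x, f x <= g x) -> I f <= I g.
Proof. by move=> rf rg fg; apply: I_le_ae => //; exact: aeW. Qed.

Lemma I_ge0 f : (forall x, 0 <= f x) -> 0 <= I f.
Proof. by move=> f0; apply: Rintegral_ge0. Qed.

Lemma I_eq0 f : rint f -> (forall x, 0 <= f x) -> I f <= 0 ->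
  {ae P, forall x, f x = 0}.
Proof.
move=> rf f0 If0.
have /integrableP[mf _] := rf.
have : (\int[P]_x `|(f x)%:E| = 0)%E.
  under eq_integral do rewrite gee0_abs ?lee_fin//.
  rewrite I_fin//; congr (_%:E); apply/eqP; rewrite eq_le If0/=.
  exact: I_ge0.
move/ae_eq_integral_abs => /(_ measurableT mf).
by apply: filterS => x /(_ Logic.I) [].
Qed.

Lemma markov_I f (e : R) : rint f -> (forall x, 0 <= f x) -> 0 < e ->
  (P [set x | (e <= f x)%R] <= (I f / e)%:E)%E.
Proof.
move=> rf f0 e0; have mf := rint_meas rf.
have := @le_integral_comp_abse _ T R P setT measurableT (EFin \o f) e id
  (@measurable_id _ _ _) (fun r h => h) (fun _ _ _ _ h => h).
move=> /(_ _ e0); have /measurable_EFinP mf' := mf => /(_ mf').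
rewrite setTI.
have -> : [set x | (e%:E <= `|(EFin \o f) x|)%E] = [set x | e <= f x].
  by apply/seteqP; split=> x /=; rewrite lee_fin ger0_norm.
under eq_integral do rewrite /= ger0_norm//.
by rewrite I_fin// => h; rewrite EFinM lee_pdivlMr// muleC.
Qed.

End real_integral.

(** * Measurability of complex functions *)

Section complex_measurable.
Variable R : realType.
Local Notation T := (circle R).
Local Notation C := (R[i]).
Implicit Types f g : T -> C.

Lemma cmeasurable_cst (a : C) : cmeasurable (fun _ : T => a).
Proof. by split; exact: measurable_cst. Qed.

Lemma cmeasurable_real (u : T -> R) :
  measurable_fun setT u -> cmeasurable (fun x => (u x)%:C).
Proof. by move=> mu_; split => //=; exact: measurable_cst. Qed.

Lemma cmeasurableD f g : cmeasurable f -> cmeasurable g ->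
  cmeasurable (fun x => f x + g x).
Proof.
move=> [f1 f2] [g1 g2]; split; under eq_fun do rewrite !cpart;
  exact: measurable_funD.
Qed.

Lemma cmeasurableM f g : cmeasurable f -> cmeasurable g ->
  cmeasurable (fun x => f x * g x).
Proof.
move=> [f1 f2] [g1 g2]; split; under eq_fun do rewrite !cpart.
  by apply: measurable_funB; apply: measurable_funM.
by apply: measurable_funD; apply: measurable_funM.
Qed.

Lemma cmeasurableN f : cmeasurable f -> cmeasurable (fun x => - f x).
Proof.
move=> [f1 f2]; split; under eq_fun do rewrite !cpart;
  exact: measurableT_comp.
Qed.

Lemma cmeasurableB f g : cmeasurable f -> cmeasurable g ->
  cmeasurable (fun x => f x - g x).
Proof. by move=> mf /cmeasurableN; exact: cmeasurableD. Qed.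

Lemma cmeasurableJ f : cmeasurable f -> cmeasurable (fun x => (f x)^*).
Proof.
move=> [f1 f2]; split; under eq_fun do rewrite !cpart.
  exact: f1.
exact: measurable_funN.
Qed.

Lemma cmeasurableX f n : cmeasurable f -> cmeasurable (fun x => f x ^+ n).
Proof.
move=> mf; elim: n => [|n IH]; first exact: cmeasurable_cst.
by under eq_fun do rewrite exprS; exact: cmeasurableM.
Qed.

Lemma measurable_sqr_cmod f : cmeasurable f ->
  measurable_fun setT (fun x => cmod (f x) ^+ 2).
Proof.
move=> [f1 f2]; under eq_fun do rewrite sqr_cmod.
by apply: measurable_funD; exact: measurable_funX.
Qed.

Lemma measurable_cmod f : cmeasurable f ->
  measurable_fun setT (fun x => cmod (f x)).
Proof.
move=> /measurable_sqr_cmod mf.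
under eq_fun do rewrite -[cmod _]ger0_norm ?cmod_ge0// -sqrtr_sqr.
apply: (measurableT_comp _ mf); apply: continuous_measurable_fun.
exact: sqrt_continuous.
Qed.

(** The sigma-algebra of the circle is generated by the traces of the open sets of the plane, so a
    continuous real function of z is measurable; Re and Im are continuous because they are
    1-Lipschitz for the modulus. *)
Lemma cmeasurable_zcoord : cmeasurable (@zcoord R).
Proof.
have mz (k : R[i]^o -> R) : continuous k -> measurable_fun setT (k \o @zcoord R).
  move=> cg; apply: (measurability _ (@RGenOpens.measurableE R)) => //.
  move=> _ [_ [a [b ->]] <-]; rewrite setTI; apply: sub_sigma_algebra.
  exists (k @^-1` `]a, b[%classic); last by rewrite setTI.
  by move/continuousP : cg; apply; exact: interval_open.
have lip (g : R[i]^o -> R) : (forall x y : R[i], `|g x - g y| <= cmod (x - y)) ->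
    continuous g.
  move=> gl x A /nbhs_ballP[e /= e0 eA]; apply/nbhs_ballP.
  exists e%:C => /=; first by rewrite ltcR.
  move=> y; rewrite /ball /= => xy; apply: eA => /=.
  by apply: le_lt_trans (gl _ _) _; rewrite -ltcR cmodC.
by split; apply: mz; apply: lip => x y; rewrite -?cReN -?cImN -?cReD -?cImD;
  [exact: normRe_le|exact: normIm_le].
Qed.


Lemma cmeasurable_indic (E : set T) : measurable E -> cmeasurable (cindic E).
Proof. by move=> mE; apply: cmeasurable_real; exact: measurable_indic. Qed.

Lemma measurable_inv_ge0 (u : T -> R) : measurable_fun setT u ->
  (forall x, 0 <= u x) -> measurable_fun setT (fun x => (u x)^-1).
Proof.
move=> mu_ u0; under eq_fun do rewrite -powR_inv1//.
exact: (measurableT_comp (measurable_powR (-1)) mu_).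
Qed.

Lemma cmeasurableV f : cmeasurable f -> cmeasurable (fun x => (f x)^-1).
Proof.
move=> mf.
(* This also holds at the zeros of f, because the inverse of 0 is 0. *)
have -> : (fun x => (f x)^-1) = (fun x => (f x)^* * ((cmod (f x) ^+ 2)^-1)%:C).
  apply/funext => x; have [->|f0] := eqVneq (f x) 0.
    by rewrite invr0 conjC0 mul0r.
  apply: (mulfI f0); rewrite divff// mulrA mulJ -rmorphM /= divff//.
  by rewrite sqrf_eq0; apply: contra_neq f0; exact: cmod_eq0.
apply: cmeasurableM; first exact: cmeasurableJ.
apply: cmeasurable_real; apply: measurable_inv_ge0.
  exact: measurable_sqr_cmod.
by move=> x; exact: sqr_ge0.
Qed.

End complex_measurable.

(** * Complex integrals *)

Section complex_integral.
Variable R : realType.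
Local Notation T := (circle R).
Local Notation C := (R[i]).
Local Notation mu := (arc_length R).
Implicit Types f g : T -> C.
Local Notation rint f := (mu.-integrable setT (fun x => (f x)%:E)).
Local Notation I f := (\int[mu]_x f x).

Lemma cint_le f (u : T -> R) : cmeasurable f ->
  (forall x, cmod (f x) <= u x) -> rint u -> cintegrable f.
Proof.
move=> mf fu ru; split => //; apply: rint_le ru.
  exact: measurable_cmod.
by move=> x; rewrite ger0_norm ?cmod_ge0.
Qed.

Lemma cint_ae_le f (u : T -> R) : cmeasurable f ->
  {ae mu, forall x, cmod (f x) <= u x} -> rint u -> cintegrable f.
Proof.
move=> mf fu ru; split => //; apply: rint_ae_le ru.
  exact: measurable_cmod.
by apply: filterS fu => x ?; rewrite ger0_norm ?cmod_ge0.
Qed.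

Lemma cint_bnd f (M : R) : cmeasurable f ->
  {ae mu, forall x, cmod (f x) <= M} -> cintegrable f.
Proof. by move=> mf fM; apply: (cint_ae_le mf fM); exact: rint_cst. Qed.

Lemma cint_Re f : cintegrable f -> rint (fun x => Re (f x)).
Proof.
by move=> [[mf _] rf]; apply: rint_le rf => // x; exact: normRe_le.
Qed.

Lemma cint_Im f : cintegrable f -> rint (fun x => Im (f x)).
Proof.
by move=> [[_ mf] rf]; apply: rint_le rf => // x; exact: normIm_le.
Qed.

Lemma cintP f : cintegrable f <->
  rint (fun x => Re (f x)) /\ rint (fun x => Im (f x)).
Proof.
split=> [h|[h1 h2]]; first by split; [exact: cint_Re|exact: cint_Im].
apply: (cint_le _ _ (rintD (rint_norm h1) (rint_norm h2))).
  by split; [exact: (rint_meas h1)|exact: (rint_meas h2)].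
by move=> x; exact: cmod_leD.
Qed.

Lemma cint_cst (a : C) : cintegrable (fun _ : T => a).
Proof. by apply/cintP; split; exact: rint_cst. Qed.

Lemma cintD f g : cintegrable f -> cintegrable g ->
  cintegrable (fun x => f x + g x).
Proof.
move=> [mf rf] [mg rg]; apply: (cint_le _ _ (rintD rf rg)).
  exact: cmeasurableD.
by move=> x; exact: cmodD.
Qed.

Lemma cintN f : cintegrable f -> cintegrable (fun x => - f x).
Proof.
move=> [mf rf]; apply: (cint_le _ _ rf); first exact: cmeasurableN.
by move=> x; rewrite cmodN.
Qed.

Lemma cintB f g : cintegrable f -> cintegrable g ->
  cintegrable (fun x => f x - g x).
Proof. by move=> cf /cintN; exact: cintD. Qed.

Lemma cintMb (M : R) f g : cintegrable f -> cmeasurable g ->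
  {ae mu, forall x, cmod (g x) <= M} -> cintegrable (fun x => g x * f x).
Proof.
move=> [mf rf] mg gM; apply: (cint_ae_le _ _ (rintZ M rf)).
  exact: cmeasurableM.
by apply: filterS gM => x gx; rewrite cmodM ler_wpM2r// cmod_ge0.
Qed.

Lemma cintZ (a : C) f : cintegrable f -> cintegrable (fun x => a * f x).
Proof.
move=> cf; apply: (@cintMb (cmod a) f (fun=> a)) => //.
exact: aeW.
Qed.

Lemma cintJ f : cintegrable f -> cintegrable (fun x => (f x)^*).
Proof.
move=> [mf rf]; apply: (cint_le _ _ rf); first exact: cmeasurableJ.
by move=> x; rewrite cmodJ.
Qed.

Lemma cint_sum (J : Type) (s : seq J) (F : J -> T -> C) :
  (forall i, cintegrable (F i)) -> cintegrable (fun x => \sum_(i <- s) F i x).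
Proof.
move=> mF; elim: s => [|i s IH].
  by under eq_fun do rewrite big_nil; exact: cint_cst.
by under eq_fun do rewrite big_cons; exact: cintD.
Qed.

Lemma cI_Re f : Re (cintegral f) = I (fun x => Re (f x)).
Proof. by []. Qed.

Lemma cI_Im f : Im (cintegral f) = I (fun x => Im (f x)).
Proof. by []. Qed.

Lemma cI_D f g : cintegrable f -> cintegrable g ->
  cintegral (fun x => f x + g x) = cintegral f + cintegral g.
Proof.
move=> /cintP[f1 f2] /cintP[g1 g2]; apply: eqC.
  rewrite cReD !cI_Re; under eq_Rintegral do rewrite cReD.
  by rewrite I_D.
rewrite cImD !cI_Im; under eq_Rintegral do rewrite cImD.
by rewrite I_D.
Qed.

Lemma cI_Z (a : C) f : cintegrable f ->
  cintegral (fun x => a * f x) = a * cintegral f.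
Proof.
move=> /cintP[f1 f2]; apply: eqC.
  rewrite cReM !(cI_Re, cI_Im); under eq_Rintegral do rewrite cReM.
  by rewrite I_B; [rewrite !I_Z|exact: rintZ|exact: rintZ].
rewrite cImM !(cI_Re, cI_Im); under eq_Rintegral do rewrite cImM.
by rewrite I_D; [rewrite !I_Z|exact: rintZ|exact: rintZ].
Qed.

Lemma cI_N f : cintegrable f ->
  cintegral (fun x => - f x) = - cintegral f.
Proof.
move=> cf; rewrite -mulN1r -cI_Z//; congr cintegral.
by apply/funext => x; rewrite mulN1r.
Qed.

Lemma cI_B f g : cintegrable f -> cintegrable g ->
  cintegral (fun x => f x - g x) = cintegral f - cintegral g.
Proof. by move=> cf cg; rewrite cI_D ?cI_N//; exact: cintN. Qed.

Lemma cI_J f : cintegrable f ->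
  cintegral (fun x => (f x)^*) = (cintegral f)^*.
Proof.
move=> /cintP[f1 f2]; apply: eqC.
  by rewrite cReJ !cI_Re; under eq_Rintegral do rewrite cReJ.
rewrite cImJ !cI_Im; under eq_Rintegral do rewrite cImJ.
by rewrite I_N.
Qed.

Lemma cI_cst (a : C) : cintegral (fun=> a) = a.
Proof. by apply: eqC; rewrite ?cI_Re ?cI_Im I_cst. Qed.

Lemma cI_real (u : T -> R) : cintegral (fun x => (u x)%:C) = (I u)%:C.
Proof. by apply: eqC; rewrite ?cI_Re ?cI_Im//= I_cst. Qed.

Lemma cI_ae f g : cmeasurable f -> cmeasurable g ->
  {ae mu, forall x, f x = g x} -> cintegral f = cintegral g.
Proof.
move=> [f1 f2] [g1 g2] fg; apply: eqC; rewrite ?cI_Re ?cI_Im; apply: I_ae => //;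
  by apply: filterS fg => x ->.
Qed.

Lemma cI_sum (J : Type) (s : seq J) (F : J -> T -> C) :
  (forall i, cintegrable (F i)) ->
  cintegral (fun x => \sum_(i <- s) F i x) = \sum_(i <- s) cintegral (F i).
Proof.
move=> mF; elim: s => [|i s IH].
  rewrite big_nil -[RHS]cI_cst; congr cintegral; apply/funext => x.
  by rewrite big_nil.
rewrite big_cons -IH -cI_D//; last exact: cint_sum.
by congr cintegral; apply/funext => x; rewrite big_cons.
Qed.

(** A unimodular constant a rotates the integral onto the positive axis; then |int f| = Re int a f,
    and Re (a f) <= |f| pointwise. *)
Lemma cmod_cI f : cintegrable f -> cmod (cintegral f) <= I (fun x => cmod (f x)).
Proof.
move=> cf; have [_ rf] := cf.
have [->|z0] := eqVneq (cintegral f) 0.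
  by rewrite cmod0; apply: I_ge0 => x; exact: cmod_ge0.
set z := cintegral f in z0 *.
have m0 : cmod z != 0 by apply: contra_neq z0; exact: cmod_eq0.
pose a := z^* * ((cmod z)^-1)%:C.
have ca : cmod a = 1.
  by rewrite cmodM cmodJ cmod_real ger0_norm ?invr_ge0 ?cmod_ge0// divff.
have -> : cmod z = Re (a * z).
  rewrite /a mulrAC [z^* * z]mulrC mulJ -rmorphM /=.
  by rewrite expr2 -mulrA divff// mulr1.
rewrite -cI_Z// cI_Re; apply: I_le => //; first exact/cint_Re/cintZ.
by move=> x; apply: le_trans (Re_le _) _; rewrite cmodM ca mul1r.
Qed.

End complex_integral.

(** The choice t = a / b is optimal; b = 0 is treated apart and forces a = 0. *)
Lemma le_mul_of_amgm (R : realType) (a b c : R) : 0 <= a -> 0 <= b -> 0 <= c ->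
  (forall t : R, 0 < t -> 2 * a <= t * b + t^-1 * c) -> a ^+ 2 <= b * c.
Proof.
move=> a0 b0 c0 h.
have [a00|an0] := eqVneq a 0; first by rewrite a00 expr0n mulr_ge0.
have ap : 0 < a by rewrite lt_neqAle eq_sym an0.
have [b00|bn0] := eqVneq b 0.
  (* For b = 0 the hypothesis reads 2 a t <= c, which t = (c + 1) / a refutes. *)
  have t0 : 0 < (c + 1) / a by rewrite divr_gt0// ltr_wpDl.
  have := h _ t0; rewrite b00 mulr0 add0r invf_div mulrAC.
  rewrite ler_pdivlMr ?ltr_wpDl// mulrC => h1.
  have : 0 < a * (c + 2) by rewrite mulr_gt0// ltr_wpDl.
  by lra.
have bp : 0 < b by rewrite lt_neqAle eq_sym bn0.
have := h (a / b) (divr_gt0 ap bp).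
rewrite mulrVK ?unitfE// invf_div => h1.
have : a <= b / a * c by lra.
rewrite mulrAC ler_pdivlMr//; by rewrite expr2 mulrC.
Qed.

(** * Square integrable functions *)

Section square_integrable.
Variable R : realType.
Local Notation T := (circle R).
Local Notation C := (R[i]).
Local Notation mu := (arc_length R).
Implicit Types f g : T -> C.
Local Notation rint f := (mu.-integrable setT (fun x => (f x)%:E)).
Local Notation I f := (\int[mu]_x f x).

Definition sqr_integrable f := cmeasurable f /\ rint (fun x => cmod (f x) ^+ 2).

(** The square of the L^2 norm. Estimates stay squared, so the triangle inequality takes the form of
    [N2D], with factors 2; this is the origin of most of the e / 4 below. *)
Definition N2 f : R := I (fun x => cmod (f x) ^+ 2).

Local Notation L2 := sqr_integrable.

Lemma N2_ge0 f : 0 <= N2 f.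
Proof. by apply: I_ge0 => x; exact: sqr_ge0. Qed.

Lemma L2_ae_le f (u : T -> R) : cmeasurable f ->
  {ae mu, forall x, cmod (f x) ^+ 2 <= u x} -> rint u -> L2 f.
Proof.
move=> mf fu ru; split => //; apply: rint_ae_le ru.
  exact: measurable_sqr_cmod.
by apply: filterS fu => x ?; rewrite ger0_norm ?sqr_ge0.
Qed.

Lemma L2_le f (u : T -> R) : cmeasurable f ->
  (forall x, cmod (f x) ^+ 2 <= u x) -> rint u -> L2 f.
Proof. by move=> mf fu; apply: L2_ae_le => //; exact: aeW. Qed.

Lemma Linfty_L2 f : Linfty f -> L2 f.
Proof.
move=> [mf [M fM]]; apply: (@L2_ae_le f (fun=> M ^+ 2)) => //.
  by apply: filterS fM => x h; rewrite lerXn2r// nnegrE ?(le_trans _ h) ?cmod_ge0.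
exact: rint_cst.
Qed.

Lemma Linfty_cint f : Linfty f -> cintegrable f.
Proof. by move=> [mf [M fM]]; apply: cint_bnd fM. Qed.

Lemma L2D f g : L2 f -> L2 g -> L2 (fun x => f x + g x).
Proof.
move=> [mf rf] [mg rg]; apply: (L2_le _ _ (rintD (rintZ 2 rf) (rintZ 2 rg))).
  exact: cmeasurableD.
by move=> x; exact: cmod_sqrD.
Qed.

Lemma L2Mb (M : R) f g : cmeasurable g -> {ae mu, forall x, cmod (g x) <= M} ->
  L2 f -> L2 (fun x => g x * f x).
Proof.
move=> mg gM [mf rf]; apply: (L2_ae_le _ _ (rintZ (M ^+ 2) rf)).
  exact: cmeasurableM.
apply: filterS gM => x gx; rewrite cmodM exprMn ler_wpM2r ?sqr_ge0//.
by rewrite lerXn2r// nnegrE ?(le_trans _ gx) ?cmod_ge0.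
Qed.

Lemma L2Z (a : C) f : L2 f -> L2 (fun x => a * f x).
Proof.
move=> lf; apply: (@L2Mb (cmod a) f (fun=> a)) => //; exact: aeW.
Qed.

Lemma L2N f : L2 f -> L2 (fun x => - f x).
Proof.
move=> /(L2Z (-1)); congr L2; by apply/funext => x; rewrite mulN1r.
Qed.

Lemma L2B f g : L2 f -> L2 g -> L2 (fun x => f x - g x).
Proof. by move=> lf /L2N; exact: L2D. Qed.

Lemma L2J f : L2 f -> L2 (fun x => (f x)^*).
Proof.
move=> [mf rf]; split; first exact: cmeasurableJ.
by under eq_fun do rewrite cmodJ.
Qed.

Lemma L2_ae f g : cmeasurable g -> {ae mu, forall x, f x = g x} -> L2 f -> L2 g.
Proof.
move=> mg fg [mf rf]; apply: (L2_ae_le _ _ rf) => //.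
by apply: filterS fg => x ->.
Qed.

Lemma L2_cst (a : C) : L2 (fun=> a).
Proof. by split; [exact: cmeasurable_cst|exact: rint_cst]. Qed.

Lemma L2M_cint f g : L2 f -> L2 g -> cintegrable (fun x => f x * g x).
Proof.
move=> [mf rf] [mg rg].
apply: (cint_le _ _ (rintZ 2^-1 (rintD rf rg))); first exact: cmeasurableM.
by move=> x; rewrite [2^-1 * _]mulrC; exact: cmod_mul_le.
Qed.

Lemma L2_cint f : L2 f -> cintegrable f.
Proof.
move=> lf; have := L2M_cint lf (L2_cst 1); congr cintegrable.
by apply/funext => x; rewrite mulr1.
Qed.

Lemma N2_ae f g : cmeasurable f -> cmeasurable g ->
  {ae mu, forall x, f x = g x} -> N2 f = N2 g.
Proof.
move=> mf mg fg; apply: I_ae; try exact: measurable_sqr_cmod.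
by apply: filterS fg => x ->.
Qed.

Lemma N2D f g : L2 f -> L2 g -> N2 (fun x => f x + g x) <= 2 * N2 f + 2 * N2 g.
Proof.
move=> lf lg; have [mf rf] := lf; have [mg rg] := lg.
rewrite -!I_Z// -I_D; [|exact: rintZ|exact: rintZ].
apply: I_le; [by have [] := L2D lf lg|by apply: rintD; exact: rintZ|].
by move=> x; exact: cmod_sqrD.
Qed.

Lemma N2N f : N2 (fun x => - f x) = N2 f.
Proof. by rewrite /N2; under eq_Rintegral do rewrite cmodN. Qed.

Lemma N2C f g : N2 (fun x => f x - g x) = N2 (fun x => g x - f x).
Proof. by rewrite -N2N; congr N2; apply/funext => x; rewrite opprB. Qed.

Lemma N2B3 f g h : L2 f -> L2 g -> L2 h ->
  N2 (fun x => f x - h x) <=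
  2 * N2 (fun x => f x - g x) + 2 * N2 (fun x => g x - h x).
Proof.
move=> lf lg lh; apply: le_trans (N2D (L2B lf lg) (L2B lg lh)).
rewrite le_eqVlt; apply/orP; left; apply/eqP; apply: eq_Rintegral => x _.
by congr (cmod _ ^+ 2); ring.
Qed.

Lemma N2Mb (M : R) f g : cmeasurable g -> {ae mu, forall x, cmod (g x) <= M} ->
  L2 f -> N2 (fun x => g x * f x) <= M ^+ 2 * N2 f.
Proof.
move=> mg gM lf; have [_ rf] := lf; rewrite -I_Z//; apply: I_le_ae.
- by have [] := L2Mb mg gM lf.
- exact: rintZ.
apply: filterS gM => x gx; rewrite cmodM exprMn ler_wpM2r ?sqr_ge0//.
by rewrite lerXn2r// nnegrE ?(le_trans _ gx) ?cmod_ge0.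
Qed.

Lemma N2Z (a : C) f : L2 f -> N2 (fun x => a * f x) = cmod a ^+ 2 * N2 f.
Proof.
move=> [_ rf]; rewrite -I_Z//; apply: eq_Rintegral => x _.
by rewrite cmodM exprMn.
Qed.

Lemma N2M1 f g : (forall x, cmod (g x) = 1) ->
  N2 (fun x => g x * f x) = N2 f.
Proof. by move=> g1; apply: eq_Rintegral => x _; rewrite cmodM g1 mul1r. Qed.

Lemma N2_eq0 f : L2 f -> N2 f <= 0 -> {ae mu, forall x, f x = 0}.
Proof.
move=> [mf rf] /(I_eq0 rf) h.
have {h} := h (fun x => sqr_ge0 _); apply: filterS => x /eqP.
by rewrite sqrf_eq0 => /eqP/cmod_eq0.
Qed.

(** The inequality 2 |f g| <= t |f|^2 + t^-1 |g|^2 is integrated and then optimised over t. *)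
Lemma CS_int f g : L2 f -> L2 g ->
  I (fun x => cmod (f x) * cmod (g x)) ^+ 2 <= N2 f * N2 g.
Proof.
move=> lf lg; have [mf rf] := lf; have [mg rg] := lg.
have rfg : rint (fun x => cmod (f x) * cmod (g x)).
  by have [_] := L2M_cint lf lg; under eq_fun do rewrite cmodM.
apply: le_mul_of_amgm; [|exact: N2_ge0|exact: N2_ge0|].
  by apply: I_ge0 => x; rewrite mulr_ge0// cmod_ge0.
move=> t t0; rewrite -!I_Z// -I_D; [|exact: rintZ|exact: rintZ].
apply: I_le; [exact: rintZ|by apply: rintD; exact: rintZ|].
move=> x; set a := cmod _; set b := cmod _.
rewrite -subr_ge0.
have -> : t * a ^+ 2 + t^-1 * b ^+ 2 - 2 * (a * b) = t^-1 * (t * a - b) ^+ 2.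
  transitivity ((t^-1 * t) * (t * a ^+ 2 - 2 * (a * b)) + t^-1 * b ^+ 2).
    by rewrite mulVf ?gt_eqF//; ring.
  by ring.
by rewrite mulr_ge0 ?invr_ge0 ?sqr_ge0// ltW.
Qed.

Lemma CS f g : L2 f -> L2 g ->
  cmod (cintegral (fun x => f x * g x)) ^+ 2 <= N2 f * N2 g.
Proof.
move=> lf lg; apply: le_trans (CS_int lf lg).
have h : cmod (cintegral (fun x => f x * g x)) <=
    I (fun x => cmod (f x) * cmod (g x)).
  apply: le_trans (cmod_cI (L2M_cint lf lg)) _.
  by under eq_Rintegral do rewrite cmodM.
by rewrite lerXn2r// nnegrE ?(le_trans _ h) ?cmod_ge0.
Qed.

Lemma I_cmod_N2 f : L2 f -> I (fun x => cmod (f x)) ^+ 2 <= N2 f.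
Proof.
move=> lf; have := CS_int lf (L2_cst 1).
rewrite /N2 [X in _ <= _ * X](_ : _ = 1).
  by rewrite mulr1; under eq_Rintegral do rewrite cmod1 mulr1.
by under eq_Rintegral do rewrite cmod1 expr1n; rewrite I_cst.
Qed.

Lemma N2_sub f g : L2 f -> L2 g -> N2 (fun x => f x - g x) =
  N2 f - 2 * Re (cintegral (fun x => f x * (g x)^*)) + N2 g.
Proof.
move=> lf lg; have [mf rf] := lf; have [mg rg] := lg.
have rfg := cint_Re (L2M_cint lf (L2J lg)).
rewrite cI_Re -I_Z// -I_B//; last exact: rintZ.
rewrite -I_D//; last by apply: rintB => //; exact: rintZ.
apply: eq_Rintegral => x _; rewrite !sqr_cmod !cpart; ring.
Qed.

(** Membership in L^2 is required separately because [N2] takes the default value 0 when its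
    integral is infinite. *)
Definition L2_adherent (S : set (T -> C)) : set (T -> C) :=
  [set f | L2 f /\
    forall e : R, 0 < e -> exists2 g, S g & N2 (fun x => f x - g x) < e].

Lemma L2_adherent_trans (S S' : set (T -> C)) : S' `<=` L2 ->
  S `<=` L2_adherent S' -> L2_adherent S `<=` L2_adherent S'.
Proof.
move=> SL SS' f [lf hf]; split => // e e0.
have e4 : 0 < e / 4 by rewrite divr_gt0.
have [g Sg fg] := hf _ e4; have [lg hg] := SS' _ Sg.
have [h Sh gh] := hg _ e4; exists h => //.
apply: le_lt_trans (N2B3 lf lg (SL _ Sh)) _; lra.
Qed.

Lemma sub_L2_adherent (S : set (T -> C)) : S `<=` L2 -> S `<=` L2_adherent S.
Proof.
move=> SL f Sf; split; [exact: SL|move=> e e0; exists f => //].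
rewrite /N2; under eq_Rintegral do rewrite subrr cmod0 expr0n.
by rewrite I_cst.
Qed.

Lemma L2_adherentD S f g : S `<=` L2 ->
  (forall f g, S f -> S g -> S (fun x => f x + g x)) ->
  L2_adherent S f -> L2_adherent S g -> L2_adherent S (fun x => f x + g x).
Proof.
move=> SL SD [lf hf] [lg hg]; split; first exact: L2D.
move=> e e0; have e4 : 0 < e / 4 by rewrite divr_gt0.
have [f' Sf ff] := hf _ e4; have [g' Sg gg] := hg _ e4.
exists (fun x => f' x + g' x); first exact: SD.
have := N2D (L2B lf (SL _ Sf)) (L2B lg (SL _ Sg)).
rewrite [X in N2 X <= _](_ : _ = (fun x => f x + g x - (f' x + g' x))); last first.
  by apply/funext => x; ring.
by lra.
Qed.

Lemma L2_adherentMb S (M : R) b f : S `<=` L2 -> cmeasurable b ->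
  {ae mu, forall x, cmod (b x) <= M} ->
  (forall f, S f -> S (fun x => b x * f x)) ->
  L2_adherent S f -> L2_adherent S (fun x => b x * f x).
Proof.
move=> SL mb bM Sb [lf hf]; split; first exact: (L2Mb mb bM lf).
move=> e e0.
have M0 : 0 < M ^+ 2 + 1 by rewrite ltr_wpDl ?sqr_ge0.
have [g Sg fg] := hf _ (divr_gt0 e0 M0).
exists (fun x => b x * g x); first exact: Sb.
have := N2Mb mb bM (L2B lf (SL _ Sg)).
rewrite [X in N2 X <= _](_ : _ = (fun x => b x * f x - b x * g x)); last first.
  by apply/funext => x; ring.
move: fg; rewrite ltr_pdivlMr//.
set u := N2 _; have : 0 <= u by exact: N2_ge0.
set v := N2 _; nra.
Qed.

Lemma L2_adherentZ S (a : C) f : S `<=` L2 ->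
  (forall f, S f -> S (fun x => a * f x)) ->
  L2_adherent S f -> L2_adherent S (fun x => a * f x).
Proof.
move=> SL Sa; apply: (@L2_adherentMb S (cmod a) (fun=> a)) => //.
exact: aeW.
Qed.

Lemma L2_adherent_ae S f g : S `<=` L2 -> cmeasurable g ->
  {ae mu, forall x, f x = g x} -> L2_adherent S f -> L2_adherent S g.
Proof.
move=> SL mg fg [lf hf]; split; first exact: L2_ae fg lf.
move=> e /hf[h Sh fh]; exists h => //; move: fh; congr (_ < _); apply: N2_ae.
- by have [] := L2B lf (SL _ Sh).
- by have [mh _] := SL _ Sh; exact: cmeasurableB.
by apply: filterS fg => x ->.
Qed.

End square_integrable.

(** * Trigonometric polynomials *)

Section circle_integral.
Variable R : realType.
Local Notation T := (circle R).
Local Notation C := (R[i]).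
Local Notation mu := (arc_length R).
Local Notation leb := (@lebesgue_measure R).
Local Notation I f := (\int[mu]_x f x).

Lemma ge0_int_circle (F : T -> R) : measurable_fun setT F ->
  (forall x, 0 <= F x) ->
  (\int[mu]_x (F x)%:E =
   ((2 * pi)^-1)%:E * \int[leb]_(t in `[0%R, (2 * pi)%R]) (F (expi t))%:E)%E.
Proof.
move=> mF F0; rewrite ge0_integral_distribution//=.
- rewrite integral_uniform//= ?subr0//.
    apply/measurable_EFinP; apply: (measurableT_comp mF); exact: measurable_expi.
  by move=> x; rewrite lee_fin.
exact/measurable_EFinP.
Qed.

Lemma zcoord_expiX (t : R) n :
  zcoord (expi t) ^+ n = cos (n%:R * t) +i* sin (n%:R * t).
Proof.
elim: n => [|n IH]; first by rewrite mul0r cos0 sin0.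
rewrite exprS IH -natr1 mulrDl mul1r cosD sinD /zcoord /=.
by apply: eqC => /=; ring.
Qed.

Lemma cmod_zcoord (x : T) : cmod (zcoord x) = 1.
Proof. by case: x => z /= /eqP; rewrite /zcoord /= => /cmod_norm1. Qed.

Lemma zcoord_neq0 (x : T) : zcoord x != 0.
Proof.
by apply/eqP => h; have := cmod_zcoord x; rewrite h cmod0 => /esym/eqP; rewrite oner_eq0.
Qed.

(** The summand 1 makes the integrand nonnegative, as the change of variables [ge0_int_circle]
    demands; [I_shift1] removes it. The periodic part of the primitive F cancels over [0, 2 pi]. *)
Lemma int_1Dcos n : (0 < n)%N ->
  (\int[leb]_(t in `[0%R, (2 * pi)%R]) (1 + cos (n%:R * t))%:E = (2 * pi)%:E)%E.
Proof.
move=> n0; have nr0 : n%:R != 0 :> R by rewrite pnatr_eq0 -lt0n.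
pose F (t : R) : R := t + n%:R^-1 * sin (n%:R * t).
have dF (t : R) : is_derive t 1 F (1 + cos (n%:R * t)).
  rewrite /F; apply: is_derive_eq.
  by rewrite /GRing.scale /= mulr1 !mulrA; field.
have cF : continuous F.
  move=> t; apply: differentiable_continuous; apply/derivable1_diffP.
  by have [] := dF t.
rewrite (@continuous_FTC2 _ _ F).
- rewrite /F mulr0 sin0 !mulr0 addr0 -EFinB subr0 -[n%:R * _]add0r.
  rewrite (_ : n%:R * (2 * pi) = (pi *+ 2) *+ n); last first.
    by rewrite -[RHS]mulr_natr -mulr_natr; ring.
  by rewrite (periodicn (@sinD2pi R)) sin0 mulr0 addr0.
- exact: twopi_gt0.
- apply: continuous_subspaceT => t; apply: continuousD; first exact: cvg_cst.
  apply: continuous_comp; last exact: continuous_cos.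
  by apply: continuousM; [exact: cvg_cst|exact: cvg_id].
- split.
  + by move=> t _; have [] := dF t.
  + exact/cvg_at_right_filter/cF.
  + exact/cvg_at_left_filter/cF.
by move=> t _; rewrite derive1E; have [_ ->] := dF t.
Qed.

Lemma int_1Dsin n : (0 < n)%N ->
  (\int[leb]_(t in `[0%R, (2 * pi)%R]) (1 + sin (n%:R * t))%:E = (2 * pi)%:E)%E.
Proof.
move=> n0; have nr0 : n%:R != 0 :> R by rewrite pnatr_eq0 -lt0n.
pose F (t : R) : R := t - n%:R^-1 * cos (n%:R * t).
have dF (t : R) : is_derive t 1 F (1 + sin (n%:R * t)).
  rewrite /F; apply: is_derive_eq.
  by rewrite /GRing.scale /= mulr1 !mulrA; field.
have cF : continuous F.
  move=> t; apply: differentiable_continuous; apply/derivable1_diffP.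
  by have [] := dF t.
rewrite (@continuous_FTC2 _ _ F).
- rewrite /F mulr0 cos0 -EFinB -[n%:R * _]add0r.
  rewrite (_ : n%:R * (2 * pi) = (pi *+ 2) *+ n); last first.
    by rewrite -[RHS]mulr_natr -mulr_natr; ring.
  by rewrite (periodicn (@cosD2pi R)) cos0; congr (_%:E); ring.
- exact: twopi_gt0.
- apply: continuous_subspaceT => t; apply: continuousD; first exact: cvg_cst.
  apply: continuous_comp; last exact: continuous_sin.
  by apply: continuousM; [exact: cvg_cst|exact: cvg_id].
- split.
  + by move=> t _; have [] := dF t.
  + exact/cvg_at_right_filter/cF.
  + exact/cvg_at_left_filter/cF.
by move=> t _; rewrite derive1E; have [_ ->] := dF t.
Qed.

Lemma I_shift1 (u : T -> R) : measurable_fun setT u -> (forall x, `|u x| <= 1) ->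
  (\int[leb]_(t in `[0%R, (2 * pi)%R]) (1 + u (expi t))%:E = (2 * pi)%:E)%E ->
  I u = 0.
Proof.
move=> mu_ u1 h.
have ru : mu.-integrable setT (fun x => (u x)%:E).
  by apply: (@rint_bnd _ _ _ _ _ 1) => //; exact: aeW.
have m1 : measurable_fun setT (fun x => 1 + u x).
  by apply: measurable_funD => //; exact: measurable_cst.
have := ge0_int_circle m1; rewrite h => /(_ _)/(congr1 fine) h1.
have {h1} : I (fun x => 1 + u x) = 1.
  rewrite /Rintegral h1 /= ?mulVf// ?gt_eqF// ?twopi_gt0// => x.
  by have := u1 x; rewrite ler_norml => /andP[]; lra.
rewrite I_D ?I_cst//; [by lra|exact: rint_cst].
Qed.

Definition zpow (m : int) (x : T) : C := zcoord x ^ m.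

Lemma zpowD m n x : zpow (m + n) x = zpow m x * zpow n x.
Proof. by rewrite /zpow expfzDr// zcoord_neq0. Qed.

Lemma zpow0 x : zpow 0 x = 1. Proof. by []. Qed.

Lemma zpow_nat (n : nat) x : zpow n x = zcoord x ^+ n. Proof. by []. Qed.

Lemma zpowN m x : zpow (- m) x = (zpow m x)^-1.
Proof. by rewrite /zpow invr_expz. Qed.

Lemma cmod_zpow m x : cmod (zpow m x) = 1.
Proof.
by case: m => n; rewrite /zpow /exprz ?cmodV cmodX cmod_zcoord expr1n ?invr1.
Qed.

Lemma zpowJ m x : (zpow m x)^* = zpow (- m) x.
Proof.
rewrite zpowN; have z0 : zpow m x != 0 by rewrite expfz_neq0// zcoord_neq0.
by apply: (mulfI z0); rewrite mulJ cmod_zpow expr1n divff.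
Qed.

Lemma cmeasurable_zpow m : cmeasurable (zpow m).
Proof.
have mz : cmeasurable (@zcoord R) by exact: cmeasurable_zcoord.
by case: m => n; [|apply: cmeasurableV]; exact: cmeasurableX.
Qed.

Lemma Linfty_zpow m : Linfty (zpow m).
Proof.
split; first exact: cmeasurable_zpow.
by exists 1; apply: aeW => x; rewrite cmod_zpow.
Qed.

Lemma cintegral_zpow m : cintegral (zpow m) = (m == 0)%:R.
Proof.
have key n : (0 < n)%N -> cintegral (zpow n) = 0.
  move=> n0; have [m1 m2] := cmeasurable_zpow n.
  apply: eqC; rewrite ?cI_Re ?cI_Im; apply: I_shift1 => //.
  - by move=> x; apply: le_trans (normRe_le _) _; rewrite cmod_zpow.
  - by under eq_integral do rewrite zpow_nat zcoord_expiX /=; exact: int_1Dcos.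
  - by move=> x; apply: le_trans (normIm_le _) _; rewrite cmod_zpow.
  - by under eq_integral do rewrite zpow_nat zcoord_expiX /=; exact: int_1Dsin.
case: (intP m) => [|n|n].
- by rewrite eqxx cI_cst.
- by rewrite key.
rewrite (_ : zpow _ = fun x => (zpow n.+1 x)^*); last first.
  by apply/funext => x; rewrite zpowJ.
rewrite cI_J; last exact/Linfty_cint/Linfty_zpow.
by rewrite key// conjC0 oppr_eq0.
Qed.

(** Built one monomial a z^m at a time, with m any integer, so that proofs go by induction without
    normalising coefficients. *)
Inductive trig : (T -> C) -> Prop :=
| trig0 : trig (fun=> 0)
| trigS a m f : trig f -> trig (fun x => a * zpow m x + f x).

Lemma trigD f g : trig f -> trig g -> trig (fun x => f x + g x).
Proof.
elim=> [|a m f0 tf IH] tg; first by under eq_fun do rewrite add0r.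
by under eq_fun do rewrite -addrA; apply: trigS; exact: IH.
Qed.

Lemma trig_zpow a m : trig (fun x => a * zpow m x).
Proof. by under eq_fun do rewrite -[_ * _]addr0; apply: trigS; exact: trig0. Qed.

Lemma trigMz a m f : trig f -> trig (fun x => a * zpow m x * f x).
Proof.
elim=> [|b n f0 tf IH]; first by under eq_fun do rewrite mulr0; exact: trig0.
under eq_fun do rewrite mulrDr mulrACA -zpowD; exact: trigS.
Qed.

Lemma trigM f g : trig f -> trig g -> trig (fun x => f x * g x).
Proof.
elim=> [|a m f0 tf IH] tg; first by under eq_fun do rewrite mul0r; exact: trig0.
by under eq_fun do rewrite mulrDl; apply: trigD; [exact: trigMz|exact: IH].
Qed.

Lemma trig_cst a : trig (fun=> a).
Proof. by have := trig_zpow a 0; under eq_fun do rewrite zpow0 mulr1. Qed.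

Lemma trigZ a f : trig f -> trig (fun x => a * f x).
Proof. by move=> tf; exact: trigM (trig_cst a) tf. Qed.

Lemma trigB f g : trig f -> trig g -> trig (fun x => f x - g x).
Proof.
move=> tf tg; under eq_fun do rewrite -mulN1r; apply: trigD => //; exact: trigZ.
Qed.

Lemma trigX f n : trig f -> trig (fun x => f x ^+ n).
Proof.
move=> tf; elim: n => [|n IH]; first exact: trig_cst.
by under eq_fun do rewrite exprS; exact: trigM.
Qed.

Lemma trig_sum (J : Type) (s : seq J) (F : J -> T -> C) :
  (forall j, trig (F j)) -> trig (fun x => \sum_(j <- s) F j x).
Proof.
move=> tF; elim: s => [|j s IH].
  by under eq_fun do rewrite big_nil; exact: trig0.
by under eq_fun do rewrite big_cons; exact: trigD.
Qed.

Lemma trig_Linfty f : trig f -> Linfty f.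
Proof.
elim=> [|a m f0 _ [mf [M fM]]].
  split; first exact: cmeasurable_cst.
  by exists 0; apply: aeW => x; rewrite cmod0.
split.
  apply: cmeasurableD => //; apply: cmeasurableM; first exact: cmeasurable_cst.
  exact: cmeasurable_zpow.
exists (cmod a + M); apply: filterS fM => x h.
apply: le_trans (cmodD _ _) _; rewrite cmodM cmod_zpow mulr1.
by rewrite lerD2l.
Qed.

Lemma trig_horner (p : {poly C}) : trig (fun x => p.[zcoord x]).
Proof.
under eq_fun do rewrite horner_coef.
by apply: trig_sum => i; have := trig_zpow p`_i i.
Qed.

End circle_integral.

(** * Polynomials approximating a step on [0, 1] *)

Section powers.
Variable R : realType.

Lemma bernoulli_ineq (x : R) n : -1 <= x -> 1 + n%:R * x <= (1 + x) ^+ n.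
Proof.
move=> x1; elim: n => [|n IH]; first by rewrite mul0r addr0.
rewrite exprS -natr1; have x0 : 0 <= 1 + x by lra.
apply: le_trans (ler_wpM2l x0 IH).
have := sqr_ge0 x; have : 0 <= n%:R :> R by []; nra.
Qed.

(** On [0, 1] these polynomials tend to the indicator of v < 1/2. Here Bernoulli's inequality gives
    the lower bound 1 - 2^n v^n = 1 - (2 v)^n. *)
Lemma step_poly_lt (v : R) : 0 <= v -> v < 2^-1 ->
  (1 - v ^+ n) ^+ (2 ^ n) @[n --> \oo] --> (1 : R).
Proof.
move=> v0 v1.
have v2 : `|2 * v| < 1 by rewrite ger0_norm; lra.
have h : 1 - (2 * v) ^+ n @[n --> \oo] --> (1 : R).
  by rewrite -[X in _ --> X]subr0; apply: cvgB; [exact: cvg_cst|exact: cvg_expr].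
apply: (squeeze_cvgr _ h (@cvg_cst R 1 _ _ _)).
apply: nearW => n /=.
have vn0 : 0 <= v ^+ n by rewrite exprn_ge0.
have vn1 : v ^+ n <= 1 by rewrite exprn_ile1//; lra.
apply/andP; split; last by rewrite exprn_ile1; lra.
have := @bernoulli_ineq (- v ^+ n) (2 ^ n).
by rewrite natrX mulrN -exprMn; apply; lra.
Qed.

(** With y = v^n and N = 2^n, (1 - y)^N (1 + y)^N <= 1, while (1 + y)^N >= N y = (2 v)^n by
    Bernoulli; hence the bound (2 v)^-n. *)
Lemma step_poly_gt (v : R) : v <= 1 -> 2^-1 < v ->
  (1 - v ^+ n) ^+ (2 ^ n) @[n --> \oo] --> (0 : R).
Proof.
move=> v1 v0.
have v2 : `|(2 * v)^-1| < 1.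
  by rewrite ger0_norm ?invr_ge0; [rewrite invf_lt1; lra|lra].
have h : (2 * v)^-1 ^+ n @[n --> \oo] --> (0 : R) by exact: cvg_expr.
apply: (squeeze_cvgr _ (@cvg_cst R 0 _ _ _) h).
apply: nearW => n /=.
have vn0 : 0 <= v ^+ n by rewrite exprn_ge0//; lra.
have vn1 : v ^+ n <= 1 by rewrite exprn_ile1//; lra.
have p0 : 0 <= (1 - v ^+ n) ^+ (2 ^ n) by rewrite exprn_ge0; lra.
apply/andP; split => //.
have w0 : 0 < (2 * v) ^+ n by rewrite exprn_gt0; lra.
rewrite exprVn -[leRHS]mul1r ler_pdivlMr//.
have := @bernoulli_ineq (v ^+ n) (2 ^ n).
rewrite natrX -exprMn => /(_ _) b.
have {}b : (2 * v) ^+ n <= (1 + v ^+ n) ^+ (2 ^ n) by have := b; lra.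
apply: le_trans (ler_wpM2l p0 b) _.
by rewrite -exprMn exprn_ile1//; have := sqr_ge0 (v ^+ n); nra.
Qed.

End powers.

Lemma I_dct0 d (T : measurableType d) (R : realType) (P : probability T R)
    (f_ : nat -> T -> R) (g : T -> R) :
  (forall n, measurable_fun setT (f_ n)) ->
  {ae P, forall x, f_ n x @[n --> \oo] --> (0 : R)} ->
  P.-integrable setT (fun x => (g x)%:E) ->
  {ae P, forall x, forall n, `|f_ n x| <= g x} ->
  \int[P]_x f_ n x @[n --> \oo] --> (0 : R).
Proof.
move=> mf f0 rg fg.
have h1 : {ae P, forall x, setT x -> (f_ n x)%:E @[n --> \oo] --> (0 : \bar R)}.
  apply: filterS f0 => x fx _; apply/fine_cvgP; split; first exact: nearW.
  exact: fx.
have h2 : {ae P, forall x, forall n, setT x -> (`|(f_ n x)%:E| <= (g x)%:E)%E}.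
  by apply: filterS fg => x h n _; rewrite lee_fin.
have [_ _] := dominated_convergence measurableT (fun n => (measurable_EFinP _ _).2 (mf n))
  (@measurable_cst _ _ _ _ setT (0 : \bar R)) h1 rg h2.
by rewrite integral0 => /fine_cvgP[_].
Qed.

(** * Trigonometric approximation of indicators *)

Section trig_density.
Variable R : realType.
Local Notation T := (circle R).
Local Notation C := (R[i]).
Local Notation mu := (arc_length R).
Local Notation U := (uniform_prob (twopi_gt0 R)).
Local Notation X := (measurableTypeR R).

Lemma I_circle (F : T -> R) : measurable_fun setT F -> (forall x, 0 <= F x) ->
  \int[mu]_x F x = \int[U]_s F (expi s).
Proof.
move=> mF F0; congr fine; rewrite ge0_integral_distribution//.
exact/measurable_EFinP.
Qed.

Lemma measurable_comp_expi (u : T -> R) : measurable_fun setT u ->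
  measurable_fun setT (fun s : X => u (expi s)).
Proof. by move=> mu_; apply: (measurableT_comp mu_); exact: measurable_expi. Qed.

(** Approximation takes place on the parameter line under the uniform law, where half-open intervals
    form a pi-system generating the Borel sets; [I_circle] brings the result back to the circle. *)
Definition Udist (g : X -> R) (t : T -> C) : R :=
  \int[U]_s (cmod ((g s)%:C - t (expi s)) ^+ 2).

Definition Uapprox (g : X -> R) :=
  forall e, 0 < e -> exists2 t, trig t & Udist g t < e.

Lemma Udist_rint (g : X -> R) (t : T -> C) : measurable_fun setT g ->
  (exists M : R, forall s, `|g s| <= M) -> trig t ->
  U.-integrable setT (fun s => (cmod ((g s)%:C - t (expi s)) ^+ 2)%:E).
Proof.
move=> mg [M gM] /trig_Linfty[[t1 t2] [N tN]].
have m1 := measurable_comp_expi t1; have m2 := measurable_comp_expi t2.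
have h : {ae U, forall s, cmod (t (expi s)) <= N}.
  (* mu is the image of the uniform law by [expi], so the preimage of a mu-null set is null by
     definition. *)
  case: tN => A [mA A0 hA]; exists (@expi R @^-1` A); split => //.
    by rewrite -[X in measurable X]setTI; exact: measurable_expi.
  by move=> s /= hs; exact: hA.
apply: (@rint_bnd _ _ _ _ _ ((M + N) ^+ 2)).
  under eq_fun do rewrite sqr_cmod !cpart.
  apply: measurable_funD; apply: measurable_funX; apply: measurable_funB => //.
apply: filterS h => s hs; rewrite ger0_norm ?sqr_ge0//.
rewrite lerXn2r// ?nnegrE ?cmod_ge0//; last first.
  apply: le_trans (cmodB _ _) _; rewrite cmod_real; exact: lerD.
by rewrite addr_ge0// ?(le_trans _ hs) ?cmod_ge0// (le_trans _ (gM s)).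
Qed.

(** Bounded convergence makes g_n close to g in L^2 for some n, and an approximant of that g_n
    serves for g. *)
Lemma Uapprox_lim (g_ : nat -> X -> R) (g : X -> R) (M : R) :
  (forall n, measurable_fun setT (g_ n)) -> measurable_fun setT g ->
  (forall n s, `|g_ n s| <= M) -> (forall s, `|g s| <= M) ->
  {ae U, forall s, g_ n s @[n --> \oo] --> g s} ->
  (forall n, Uapprox (g_ n)) -> Uapprox g.
Proof.
move=> mg_ mg gM_ gM gg ag e e0.
have M0 : 0 <= M by rewrite (le_trans _ (gM 0)).
have gg2 s n : `|(g s - g_ n s) ^+ 2| <= (M + M) ^+ 2.
  rewrite ger0_norm ?sqr_ge0// -[leLHS]real_normK ?num_real//.
  rewrite lerXn2r// ?nnegrE ?addr_ge0//.
  by apply: le_trans (ler_normB _ _) _; exact: lerD.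
have mgg n : measurable_fun setT (fun s => (g s - g_ n s) ^+ 2).
  by apply: measurable_funX; exact: measurable_funB.
have : \int[U]_s ((g s - g_ n s) ^+ 2) @[n --> \oo] --> (0 : R).
  apply: (I_dct0 mgg _ (rint_cst U ((M + M) ^+ 2))); last exact: aeW.
  apply: filterS gg => s gs.
  rewrite [X in _ --> X](_ : _ = (g s - g s) ^+ 2); last by rewrite subrr expr0n.
  rewrite expr2; under eq_fun do rewrite expr2.
  by apply: cvgM; apply: cvgB => //; exact: cvg_cst.
move/cvgrPdist_lt.
have e4 : 0 < e / 4 by rewrite divr_gt0.
move=> /(_ _ e4)[n _ /(_ n (leqnn n))] /=.
rewrite sub0r normrN => h.
have [t tt ht] := ag n _ e4; exists t => //.
have r1 : U.-integrable setT (fun s => ((g s - g_ n s) ^+ 2)%:E).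
  by apply: (@rint_bnd _ _ _ _ _ ((M + M) ^+ 2)) => //; exact: aeW.
have r2 := Udist_rint (mg_ n) (ex_intro _ M (gM_ n)) tt.
have r3 := Udist_rint mg (ex_intro _ M gM) tt.
have : Udist g t <= 2 * (\int[U]_s (g s - g_ n s) ^+ 2) + 2 * Udist (g_ n) t.
  rewrite -!I_Z// -I_D; [|exact: rintZ|exact: rintZ].
  apply: I_le => //; first by apply: rintD; exact: rintZ.
  move=> s; have := cmod_sqrD ((g s - g_ n s)%:C) ((g_ n s)%:C - t (expi s)).
  rewrite cmod_real real_normK ?num_real// rmorphB /= addrA subrK//.
have : \int[U]_s (g s - g_ n s) ^+ 2 < e / 4.
  by apply: le_lt_trans h; rewrite ler_norm.
by lra.
Qed.

Lemma Uapprox_trig (g : X -> R) t : trig t ->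
  {ae U, forall s, (g s)%:C = t (expi s)} -> measurable_fun setT g ->
  (exists M : R, forall s, `|g s| <= M) -> Uapprox g.
Proof.
move=> tt gt mg gM e e0; exists t => //.
rewrite /Udist (@I_ae _ _ _ _ _ (fun=> 0)) ?I_cst//.
  exact: (rint_meas (Udist_rint mg gM tt)).
by apply: filterS gt => s ->; rewrite subrr cmod0 expr0n.
Qed.


Lemma ae_U_itv : {ae U, forall s, s \in `[0, 2 * pi]}.
Proof.
exists (~` `[0, 2 * pi]%classic); split => //.
  exact: measurableC.
rewrite /uniform_prob integral_uniform_pdf setICl.
by rewrite integral_set0.
Qed.

Lemma ae_U_neq a : {ae U, forall s, s != a}.
Proof.
exists [set a]; split => //; last first.
  by move=> s /= /negP; rewrite negbK => /eqP.
have /null_content_dominatesP := dominates_uniform_prob (twopi_gt0 R).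
by apply => //; exact: lebesgue_measure_set1.
Qed.

Lemma ltr_cos_twopi (d u : R) : 0 <= d <= pi -> d < u -> u < 2 * pi - d ->
  cos u < cos d.
Proof.
move=> /andP[d0 dp] du ud; have [up|up] := leP u pi.
  by rewrite ltr_cos// in_itv/=; lra.
rewrite -(cosN u) -(cosD2pi (- u)) -mulr_natr ltr_cos// ?in_itv/=; lra.
Qed.

Lemma ltr_cos_dist (d u : R) : d <= pi -> `|u| < d -> cos d < cos u.
Proof.
move=> dp ud; have u0 := normr_ge0 u.
rewrite -(cos_norm u) ltr_cos// in_itv/=; lra.
Qed.

Lemma cos_zpow (m s : R) :
  zpow 1 (expi (- m)) * zpow 1 (expi s) + zpow 1 (expi m) * zpow (- 1) (expi s)
  = (2 * cos (s - m))%:C.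
Proof.
rewrite -zpowJ /zpow !expr1z /zcoord cosB.
apply: eqC => /=; rewrite cosN sinN; ring.
Qed.

(** With m the midpoint and d the half-length, the interval is the set cos(s - m) > cos d. The
    function v is affine in cos(s - m), has values in [0, 1] and crosses 1/2 at the end points, so
    the step polynomials in v are trigonometric polynomials tending to the indicator. *)
Lemma Uapprox_itv a b : 0 <= a -> a < b -> b <= 2 * pi ->
  Uapprox (\1_(`]a, b]%classic) : X -> R).
Proof.
move=> a0 ab b2.
pose m := (a + b) / 2; pose d := (b - a) / 2.
have dp : 0 < d <= pi by rewrite /d; apply/andP; split; lra.
pose v (s : R) : R := 2^-1 + (cos d - cos (s - m)) / 4.
pose g_ n s := (1 - v s ^+ n) ^+ (2 ^ n).
have v01 s : 0 <= v s <= 1.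
  have := cos_geN1 d; have := cos_le1 d.
  have := cos_geN1 (s - m); have := cos_le1 (s - m).
  by rewrite /v => *; apply/andP; split; lra.
have g01 n s : 0 <= g_ n s <= 1.
  have /andP[v0 v1] := v01 s.
  have : 0 <= v s ^+ n by rewrite exprn_ge0.
  have : v s ^+ n <= 1 by rewrite exprn_ile1.
  by move=> *; apply/andP; split; [rewrite exprn_ge0|rewrite exprn_ile1]; lra.
have mv : measurable_fun setT (v : X -> R).
  apply: continuous_measurable_fun => s; apply: cvgD; first exact: cvg_cst.
  apply: cvgM; last exact: cvg_cst.
  apply: cvgB; first exact: cvg_cst.
  apply: continuous_comp; last exact: continuous_cos.
  by apply: cvgB; [exact: cvg_id|exact: cvg_cst].
have mg n : measurable_fun setT (g_ n : X -> R).
  apply: measurable_funX; apply: measurable_funB; first exact: measurable_cst.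
  exact: measurable_funX.
apply: (@Uapprox_lim g_ _ 1) => //.
- by move=> n s; have /andP[? ?] := g01 n s; rewrite ger0_norm.
- by move=> s; rewrite indicE; case: (_ \in _); rewrite ?normr1 ?normr0.
(* Discarded points: a and b, where v = 1/2, and 0 and 2 pi, which are one point of the circle and
   may both be end points. *)
- have := ae_U_itv; have := ae_U_neq a; have := ae_U_neq b.
  have := ae_U_neq 0; have := ae_U_neq (2 * pi).
  move=> h1 h2 h3 h4 h5.
  have {}h : {ae U, forall s, [/\ s \in `[0, 2 * pi], s != a, s != b, s != 0 & s != 2 * pi]}.
    have := ae_and h1 (ae_and h2 (ae_and h3 (ae_and h4 h5))).
    by apply: filterS => s [? [? [? [? ?]]]]; split.
  apply: ae_imp h => s [+ sa sb s0 s2].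
  rewrite in_itv/= => /andP[s0' s2'].
  have {}s0 : 0 < s by rewrite lt_neqAle eq_sym s0.
  have {}s2 : s < 2 * pi by rewrite lt_neqAle s2.
  have /andP[v0 v1] := v01 s; have /andP[d0 d1] := dp.
  rewrite indicE; have [sab|sab] := boolP (s \in `]a, b]%classic).
    move: sab; rewrite inE/= in_itv/= => /andP[as_ sb'].
    have {}sb : s < b by rewrite lt_neqAle sb.
    apply: step_poly_lt => //; rewrite /v.
    have : cos d < cos (s - m).
      by apply: ltr_cos_dist => //; rewrite ltr_norml /d /m; lra.
    by lra.
  move: sab; rewrite notin_setE/= in_itv/= => /negP; rewrite negb_and -leNgt -ltNge => sab.
  apply: step_poly_gt => //; rewrite /v.
  have : cos (s - m) < cos d.
    rewrite -(cos_norm (s - m)); apply: ltr_cos_twopi; first lra.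
      have : s < a \/ b < s.
        by case/orP: sab; [left; rewrite lt_neqAle sa|right].
      rewrite lter_normr /d /m => -[?|?]; apply/orP; [right|left]; lra.
    by rewrite ltr_norml /d /m; apply/andP; split; lra.
  by lra.
move=> n e e0; apply: (@Uapprox_trig _ (fun x => (1 - ((2^-1 + cos d / 4)%:C -
  (8^-1)%:C * (zpow 1 (expi (- m)) * zpow 1 x + zpow 1 (expi m) * zpow (- 1) x)) ^+ n)
    ^+ (2 ^ n))) => //.
- apply: trigX; apply: trigB; first exact: trig_cst.
  apply: trigX; apply: trigB; first exact: trig_cst.
  by apply: trigZ; apply: trigD; exact: trig_zpow.
- apply: aeW => s; rewrite cos_zpow -rmorphM -rmorphB.
  rewrite (_ : _ - _ = v s); last by rewrite /v; field.
  by rewrite /g_ rmorphXn rmorphB rmorphXn rmorph1.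
- by exists 1 => s; have /andP[? ?] := g01 n s; rewrite ger0_norm.
Qed.

Lemma Uapprox_ae (g h : X -> R) : measurable_fun setT h -> measurable_fun setT g ->
  (exists M : R, forall s, `|g s| <= M) -> (exists M : R, forall s, `|h s| <= M) ->
  {ae U, forall s, g s = h s} -> Uapprox g -> Uapprox h.
Proof.
move=> mh mg gM hM gh ag e /ag[t tt ht]; exists t => //.
rewrite /Udist (@I_ae _ _ _ _ _ (fun s => cmod ((g s)%:C - t (expi s)) ^+ 2))//.
- exact: (rint_meas (Udist_rint mh hM tt)).
- exact: (rint_meas (Udist_rint mg gM tt)).
by apply: filterS gh => s ->.
Qed.

Lemma Uapprox0 : Uapprox (fun=> 0).
Proof.
apply: (Uapprox_trig (trig_cst 0)); first exact: aeW.
  exact: measurable_cst.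
by exists 0 => s; rewrite normr0.
Qed.

Lemma UapproxD (g h : X -> R) : measurable_fun setT h -> measurable_fun setT g ->
  (exists M : R, forall s, `|g s| <= M) -> (exists M : R, forall s, `|h s| <= M) ->
  Uapprox g -> Uapprox h -> Uapprox (fun s => g s + h s).
Proof.
move=> mh mg [M gM] [N hN] ag ah e e0.
have e4 : 0 < e / 4 by rewrite divr_gt0.
have [t tt ht] := ag _ e4; have [r tr hr] := ah _ e4.
exists (fun x => t x + r x); first exact: trigD.
have r1 := Udist_rint mg (ex_intro _ M gM) tt.
have r2 := Udist_rint mh (ex_intro _ N hN) tr.
have gh s : `|g s + h s| <= M + N.
  by apply: le_trans (ler_normD _ _) _; exact: lerD.
have r3 := Udist_rint (measurable_funD mg mh) (ex_intro _ (M + N) gh) (trigD tt tr).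
have : Udist (fun s => g s + h s) (fun x => t x + r x) <=
    2 * Udist g t + 2 * Udist h r.
  rewrite -!I_Z// -I_D; [|exact: rintZ|exact: rintZ].
  apply: I_le => //; first by apply: rintD; exact: rintZ.
  move=> s; have := cmod_sqrD ((g s)%:C - t (expi s)) ((h s)%:C - r (expi s)).
  by apply: le_trans; rewrite rmorphD /= opprD addrACA.
by lra.
Qed.

(** Dynkin's pi-lambda argument: intervals are the base case, complements correspond to 1 - t, and
    disjoint unions are bounded limits of finite sums. *)
Lemma Uapprox_indic (B : set X) : measurable B -> Uapprox (\1_B).
Proof.
have i1 (A : set X) : exists M : R, forall s, `|\1_A s : R| <= M.
  by exists 1 => s; rewrite indicE; case: (_ \in _); rewrite ?normr1 ?normr0.
move=> mB; apply: (@dynkin_induction _ X (@ocitv R) (fun B => Uapprox (\1_B))) => //.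
- exact: ocitvI.
- apply: (Uapprox_trig (trig_cst 1)) => //.
  by apply: aeW => s; rewrite indicT.
- move=> _ [[x y] _ <-] /=.
  (* The uniform law lives on [0, 2 pi], so the interval may be clipped to it up to a null set. *)
  pose a := Num.max x 0; pose b := Num.min y (2 * pi).
  have a0 : 0 <= a by rewrite le_max lexx orbT.
  have b2 : b <= 2 * pi by rewrite ge_min lexx orbT.
  pose g : X -> R := if a < b then \1_(`]a, b]%classic) else fun=> 0.
  have ag : Uapprox g.
    by rewrite /g; case: ifP => ab; [exact: Uapprox_itv|exact: Uapprox0].
  apply: Uapprox_ae ag => //.
  + by rewrite /g; case: ifP => _ //; exact: measurable_cst.
  + by rewrite /g; case: ifP => _ //; exists 0 => s; rewrite normr0.
  have := ae_and ae_U_itv (ae_U_neq 0).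
  apply: ae_imp => s []; rewrite in_itv/= => /andP[s0 s2] sn0.
  have {}s0 : 0 < s by rewrite lt_neqAle eq_sym sn0.
  have e1 : (s \in `]x, y]%classic) = (a < s <= b).
    by rewrite mem_setE in_itv/= /a /b gt_max le_min s0 s2 !andbT.
  rewrite /g indicE e1; case: ifP => ab.
    by rewrite indicE mem_setE in_itv.
  case: (boolP (a < s <= b)) => // /andP[as_ sb].
  by rewrite (lt_le_trans as_ sb) in ab.
- move=> S mS aS e /aS[t tt ht]; exists (fun x => 1 - t x).
    by apply: trigB => //; exact: trig_cst.
  move: ht; congr (_ < _); apply: eq_Rintegral => s _; rewrite -cmodN.
  congr (cmod _ ^+ 2); rewrite !indicE in_setC; case: (_ \in _) => /=; ring.
move=> F mF tF aF.
pose g_ n s : R := \sum_(k < n) \1_(F k) s.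
have g_S n : g_ n.+1 = (fun s => g_ n s + \1_(F n) s).
  by apply/funext => s; rewrite /g_ big_ord_recr.
have mg n : measurable_fun setT (g_ n : X -> R).
  by apply: measurable_sum => k; exact: measurable_indic.
have gE s k0 : F k0 s -> forall n, g_ n s = (k0 < n)%:R.
  move=> Fs; elim=> [|n IH]; first by rewrite /g_ big_ord0.
  rewrite g_S IH indicE; have [->|nk] := eqVneq n k0.
    by rewrite mem_set// ltnn ltnSn add0r.
  rewrite memNset ?addr0; last first.
    move=> Fns; move/trivIsetP : tF => /(_ n k0 Logic.I Logic.I nk).
    by move=> /seteqP[+ _] => /(_ s); apply.
  by rewrite ltnS (leq_eqVlt k0 n) [k0 == n]eq_sym (negbTE nk).
have gE0 s : ~ (\bigcup_k F k) s -> forall n, g_ n s = 0.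
  move=> Fs n; apply: big1 => k _; rewrite indicE memNset// => Fks.
  by apply: Fs; exists k.
have g1 n s : `|g_ n s| <= 1.
  have [[k _ Fk]|/gE0->] := pselect ((\bigcup_k F k) s); last by rewrite normr0.
  by rewrite (gE _ _ Fk); case: (_ < _)%N; rewrite ?normr1 ?normr0.
apply: (@Uapprox_lim g_ _ 1) => //.
- by apply: measurable_indic; exact: bigcupT_measurable.
- by move=> s; rewrite indicE; case: (_ \in _); rewrite ?normr1 ?normr0.
- apply: aeW => s; rewrite indicE.
  have [[k _ Fk]|Fk] := pselect ((\bigcup_k F k) s).
    rewrite mem_set; last by exists k.
    apply: (@cvg_near_cst _ _ _ _ _ _); exists k.+1 => // n /= kn.
    by rewrite (gE _ _ Fk) kn.
  rewrite memNset//; under eq_fun do rewrite gE0//; exact: cvg_cst.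
elim=> [|n IH].
  by rewrite (_ : g_ 0%N = fun=> 0) ?funeqE; [exact: Uapprox0|move=> s; rewrite /g_ big_ord0].
rewrite g_S; apply: UapproxD => //; by exists 1 => s; exact: g1.
Qed.

Lemma trig_dense_indic (E : set T) : measurable E ->
  L2_adherent (@trig R) (cindic E).
Proof.
move=> mE; split.
  apply: Linfty_L2; split; first exact: cmeasurable_indic.
  exists 1; apply: aeW => x; rewrite /cindic cmod_real indicE.
  by case: (_ \in _); rewrite ?normr1 ?normr0.
move=> e e0.
have mB : measurable (@expi R @^-1` E).
  by rewrite -[X in measurable X]setTI; exact: measurable_expi.
have [t tt ht] := Uapprox_indic mB e0; exists t => //.
move: ht; rewrite /N2 I_circle//.
- apply: measurable_sqr_cmod; apply: cmeasurableB; first exact: cmeasurable_indic.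
  by have [] := trig_Linfty tt.
- by move=> x; exact: sqr_ge0.
Qed.

End trig_density.

(** * Uniform approximation by simple functions *)

Section step_functions.
Context d (T : measurableType d) (R : realType).
Implicit Types u : T -> R.

(** For 0 <= u <= N / (K+1) this is floor((K+1) u) / (K+1), written through superlevel sets. It lies
    below u with nonnegative coefficients, so it also yields the simple functions that enter
    [gauge_ext]. *)
Definition stepf u (N K : nat) (x : T) : R :=
  \sum_(k < N) K.+1%:R^-1 * \1_[set y | k.+1%:R <= K.+1%:R * u y] x.

Lemma measurable_superlevel u (K k : nat) : measurable_fun setT u ->
  measurable [set y | k.+1%:R <= K.+1%:R * u y].
Proof.
move=> mu_; rewrite -[X in measurable X]setTI.
rewrite (_ : [set y | _] = (fun y => K.+1%:R * u y) @^-1` `[k.+1%:R, +oo[%classic); last first.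
  by apply/seteqP; split => y /=; rewrite in_itv/= andbT.
by apply: measurable_funM => //; exact: measurable_cst.
Qed.

Lemma stepfP u (M : R) (N K : nat) x : (forall x, 0 <= u x) ->
  (forall x, u x <= M) -> K.+1%:R * M <= N%:R ->
  stepf u N K x <= u x <= stepf u N K x + K.+1%:R^-1.
Proof.
move=> u0 uM KN; set t := Num.truncn (K.+1%:R * u x).
have Ku0 : 0 <= K.+1%:R * u x by rewrite mulr_ge0.
have /andP[t1 t2] := truncn_itv Ku0; rewrite -/t in t1 t2.
have tN : (t <= N)%N.
  by rewrite -(ler_nat R); apply: le_trans t1 (le_trans _ KN); rewrite ler_wpM2l.
have -> : stepf u N K x = K.+1%:R^-1 * t%:R.
  rewrite /stepf -mulr_sumr; congr (_ * _).
  transitivity (\sum_(k < N) (k < t)%:R : R).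
    apply: eq_bigr => k _; rewrite indicE; congr (_%:R); congr nat_of_bool.
    by apply/idP/idP; rewrite inE /= -truncn_ge_nat.
  elim: N t {KN t1 t2} tN => [|N IH] t; first by rewrite big_ord0 leqn0 => /eqP->.
  rewrite big_ord_recr /= leq_eqVlt => /predU1P[->|tN]; last first.
    by rewrite IH// ltnNge -ltnS tN addr0.
  rewrite ltnSn (eq_bigr (fun=> 1)) => [|k _]; last by rewrite ltnW// ltnS.
  by rewrite sumr_const card_ord natr1.
have K0 : 0 < K.+1%:R :> R by [].
apply/andP; split; first by rewrite ler_pdivrMl.
by rewrite -{2}[_^-1]mulr1 -mulrDr ler_pdivlMl// natr1 ltW.
Qed.

Lemma exists_stepf u (M e : R) : (forall x, 0 <= u x) -> (forall x, u x <= M) ->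
  0 < e -> exists N K, forall x, stepf u N K x <= u x <= stepf u N K x + e.
Proof.
move=> u0 uM e0.
pose K := Num.truncn (e^-1); pose N := (Num.truncn (K.+1%:R * M)).+1.
have Ke : K.+1%:R^-1 <= e.
  rewrite -[leRHS]invrK lef_pV2 ?posrE ?invr_gt0// ltW// truncnS_gt//.
exists N, K => x; have /andP[h1 h2] := @stepfP u M N K x u0 uM (ltW (truncnS_gt _)).
by rewrite h1 (le_trans h2)// lerD2l.
Qed.

Lemma stepf_nnsfun u N K : measurable_fun setT u ->
  exists s : {nnsfun T >-> R}, forall x, s x = stepf u N K x.
Proof.
move=> mu_; have K0 : 0 <= K.+1%:R^-1 :> R by rewrite invr_ge0.
exists (sum_nnsfun (fun k => scale_nnsfun
  (indic_nnsfun R (measurable_superlevel K k mu_)) K0) N) => x.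
by rewrite sum_nnsfunE; apply: eq_bigr.
Qed.

End step_functions.

(** * Density of trigonometric polynomials in L^2 and L^1 *)

Section L2_density.
Variable R : realType.
Local Notation T := (circle R).
Local Notation C := (R[i]).
Local Notation mu := (arc_length R).
Implicit Types f g : T -> C.
Local Notation rint f := (mu.-integrable setT (fun x => (f x)%:E)).
Local Notation I f := (\int[mu]_x f x).
Local Notation L2 := (@sqr_integrable R).

Definition trunc (M : R) f (x : T) : C := if cmod (f x) <= M then f x else 0.

Lemma cmeasurable_trunc M f : cmeasurable f -> cmeasurable (trunc M f).
Proof.
move=> mf; have [f1 f2] := mf.
have h : measurable_fun setT (fun x => cmod (f x) <= M).
  by apply: measurable_fun_ler; [exact: measurable_cmod|exact: measurable_cst].
split; rewrite /trunc.
  rewrite (_ : (fun x => _) = (fun x => if cmod (f x) <= M then Re (f x) else 0)).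
    by apply: measurable_fun_ifT => //; exact: measurable_cst.
  by apply/funext => x; case: ifP.
rewrite (_ : (fun x => _) = (fun x => if cmod (f x) <= M then Im (f x) else 0)).
  by apply: measurable_fun_ifT => //; exact: measurable_cst.
by apply/funext => x; case: ifP.
Qed.

Lemma cmod_trunc_le M f x : cmod (trunc M f x) <= cmod (f x).
Proof. by rewrite /trunc; case: ifP => // _; rewrite cmod0 cmod_ge0. Qed.

Lemma cmod_truncM_le M f x : 0 <= M -> cmod (trunc M f x) <= M.
Proof. by rewrite /trunc; case: ifP => // _; rewrite cmod0. Qed.

Lemma trunc_Linfty M f : 0 <= M -> cmeasurable f -> Linfty (trunc M f).
Proof.
move=> M0 mf; split; first exact: cmeasurable_trunc.
by exists M; apply: aeW => x; exact: cmod_truncM_le.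
Qed.

Lemma Linfty_bounded_rep f : Linfty f -> exists g M,
  [/\ cmeasurable g, forall x, cmod (g x) <= M & {ae mu, forall x, f x = g x}].
Proof.
move=> [mf [M fM]]; exists (trunc `|M| f), `|M|; split.
- exact: cmeasurable_trunc.
- by move=> x; exact: cmod_truncM_le.
by apply: filterS fM => x h; rewrite /trunc (le_trans h)// ler_norm.
Qed.

Lemma trunc_cvg (F : T -> R) f : cmeasurable f -> rint F -> (forall x, 0 <= F x) ->
  forall e, 0 < e -> exists n : nat,
  I (fun x => if cmod (f x) <= n%:R then 0 else F x) < e.
Proof.
move=> mf rF F0 e e0; have mF := rint_meas rF.
have h : I (fun x => if cmod (f x) <= n%:R then 0 else F x) @[n --> \oo] --> (0 : R).
  apply: (I_dct0 _ _ rF).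
  - move=> n; apply: measurable_fun_ifT => //.
    by apply: measurable_fun_ler; [exact: measurable_cmod|exact: measurable_cst].
  - apply: aeW => x; apply: cvg_near_cst; exists (Num.truncn (cmod (f x))).+1 => // n /= hn.
    rewrite ifT// ltW//; apply: lt_le_trans (truncnS_gt _) _.
    by rewrite ler_nat.
  by apply: aeW => x n; case: ifP => _; rewrite ?normr0// ger0_norm.
move/cvgrPdist_lt : h => /(_ _ e0)[n _ /(_ n (leqnn n))] /=.
by rewrite sub0r normrN => h; exists n; apply: le_lt_trans h; rewrite ler_norm.
Qed.

Lemma N2_trunc f e : L2 f -> 0 < e -> exists n : nat,
  N2 (fun x => f x - trunc n%:R f x) < e.
Proof.
move=> [mf rf] e0.
have [n hn] := trunc_cvg mf rf (fun x => sqr_ge0 _) e0; exists n.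
apply: le_lt_trans hn; rewrite le_eqVlt; apply/orP; left; apply/eqP.
apply: eq_Rintegral => x _; rewrite /trunc; case: ifP => _.
  by rewrite subrr cmod0 expr0n.
by rewrite subr0.
Qed.

Lemma I_trunc f e : cintegrable f -> 0 < e -> exists n : nat,
  I (fun x => cmod (f x - trunc n%:R f x)) < e.
Proof.
move=> [mf rf] e0.
have [n hn] := trunc_cvg mf rf (fun x => cmod_ge0 _) e0; exists n.
apply: le_lt_trans hn; rewrite le_eqVlt; apply/orP; left; apply/eqP.
apply: eq_Rintegral => x _; rewrite /trunc; case: ifP => _.
  by rewrite subrr cmod0.
by rewrite subr0.
Qed.

Lemma trig_L2 : @trig R `<=` L2.
Proof. by move=> f /trig_Linfty/Linfty_L2. Qed.

Local Notation adh := (L2_adherent (@trig R)).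

Lemma trig_adhD f g : adh f -> adh g -> adh (fun x => f x + g x).
Proof. by apply: L2_adherentD; [exact: trig_L2|exact: trigD]. Qed.

Lemma trig_adhZ a f : adh f -> adh (fun x => a * f x).
Proof.
by apply: L2_adherentZ; [exact: trig_L2|move=> g; exact: trigZ].
Qed.

Lemma trig_dense_real (u : T -> R) (M : R) : measurable_fun setT u ->
  (forall x, `|u x| <= M) -> adh (fun x => (u x)%:C).
Proof.
move=> mu_ uM.
wlog u0 : u M mu_ uM / forall x, 0 <= u x.
  move=> h; rewrite (_ : (fun x => _) = fun x => (u x + M)%:C + (- M)%:C * 1).
    apply: trig_adhD; last first.
      by apply: trig_adhZ; apply: (sub_L2_adherent trig_L2); exact: trig_cst.
    apply: (h (fun x => u x + M) (M + M)).
    - by apply: measurable_funD => //; exact: measurable_cst.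
    - move=> x; apply: le_trans (ler_normD _ _) _; rewrite lerD//.
      by rewrite ger0_norm// (le_trans _ (uM x)).
    by move=> x; have := uM x; rewrite ler_norml => /andP[]; lra.
  by apply/funext => x; rewrite mulr1 -rmorphD /= addrK.
have lu : L2 (fun x => (u x)%:C).
  apply: Linfty_L2; split; first exact: cmeasurable_real.
  by exists M; apply: aeW => x; rewrite cmod_real.
split => // e e0.
(* d <= 1 and d <= e / 4 together give d^2 <= e / 4, the squared uniform error. *)
pose d := Num.min 1 (e / 4).
have d0 : 0 < d by rewrite lt_min ltr01 divr_gt0.
have d1 : d ^+ 2 <= e / 4.
  have : d <= 1 by rewrite ge_min lexx.
  have : d <= e / 4 by rewrite ge_min lexx orbT.
  nra.
have [N [K NK]] := exists_stepf u0 (fun x => le_trans (ler_norm _) (uM x)) d0.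
have as_ : adh (fun x => (stepf u N K x)%:C).
  rewrite (_ : (fun x => _) = (fun x => \sum_(k < N) K.+1%:R^-1%:C *
      cindic [set y | k.+1%:R <= K.+1%:R * u y] x)); last first.
    apply/funext => x; rewrite /stepf rmorph_sum; apply: eq_bigr => k _.
    by rewrite rmorphM.
  elim: N {NK} => [|N IH].
    under eq_fun do rewrite big_ord0.
    by apply: (sub_L2_adherent trig_L2); exact: trig_cst.
  under eq_fun do rewrite big_ord_recr /=.
  apply: trig_adhD => //; apply: trig_adhZ; apply: trig_dense_indic.
  exact: measurable_superlevel.
have [ls hs] := as_; have e4 : 0 < e / 4 by rewrite divr_gt0.
have [t tt ht] := hs _ e4; exists t => //.
apply: le_lt_trans (N2B3 lu ls (trig_L2 tt)) _.
suff : N2 (fun x => (u x)%:C - (stepf u N K x)%:C) <= e / 4 by lra.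
apply: le_trans d1; rewrite -[leRHS](I_cst mu); apply: I_le.
- by have [_] := L2B lu ls.
- exact: rint_cst.
move=> x; rewrite -rmorphB cmod_real; have /andP[h1 h2] := NK x.
by rewrite ger0_norm ?subr_ge0// lerXn2r// ?nnegrE; lra.
Qed.

Lemma trig_dense_Linfty f : Linfty f -> adh f.
Proof.
move=> lf; have [g [M [mg gM fg]]] := Linfty_bounded_rep lf.
have [mf _] := lf; apply: (L2_adherent_ae trig_L2 mf (f := g)).
  by apply: filterS fg => x ->.
have [g1 g2] := mg.
rewrite (_ : g = fun x => (Re (g x))%:C + 'i%C * (Im (g x))%:C); last first.
  by apply/funext => x; case: (g x) => a b; apply: eqC => /=; ring.
apply: trig_adhD; last apply: trig_adhZ.
  by apply: trig_dense_real => // x; apply: le_trans (normRe_le _) (gM x).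
by apply: trig_dense_real => // x; apply: le_trans (normIm_le _) (gM x).
Qed.

Lemma trig_dense_L2 f : L2 f -> adh f.
Proof.
move=> lf; split => // e e0; have e4 : 0 < e / 4 by rewrite divr_gt0.
have [n hn] := N2_trunc lf e4.
have lt : Linfty (trunc n%:R f) by apply: trunc_Linfty => //; case: lf.
have [_ /(_ _ e4)[t tt ht]] := trig_dense_Linfty lt.
exists t => //; apply: le_lt_trans (N2B3 lf (Linfty_L2 lt) (trig_L2 tt)) _; lra.
Qed.

(** f is truncated first; the truncation is approximated in L^2, which controls the mean by
    Cauchy-Schwarz. Hence the tolerance (e / 2)^2. *)
Lemma trig_dense_L1 f e : cintegrable f -> 0 < e ->
  exists2 t, trig t & I (fun x => cmod (f x - t x)) < e.
Proof.
move=> cf e0; have [mf _] := cf; have e2 : 0 < e / 2 by rewrite divr_gt0.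
have [n hn] := I_trunc cf e2.
have lt : Linfty (trunc n%:R f) by exact: trunc_Linfty.
have [_ /(_ _ (exprn_gt0 2 e2))[t tt ht]] := trig_dense_Linfty lt.
exists t => //.
have ct := Linfty_cint lt; have cq := Linfty_cint (trig_Linfty tt).
have h2 : I (fun x => cmod (trunc n%:R f x - t x)) < e / 2.
  rewrite -(ltr_pXn2r (_ : (0 < 2)%N)) ?nnegrE ?(ltW e2)//; last first.
    by apply: I_ge0 => x; exact: cmod_ge0.
  by apply: le_lt_trans (I_cmod_N2 (L2B (Linfty_L2 lt) (trig_L2 tt))) ht.
have [_ r1] := cintB cf ct; have [_ r2] := cintB ct cq; have [_ r3] := cintB cf cq.
rewrite [e]splitr; apply: le_lt_trans (ltrD hn h2).
rewrite -I_D//; apply: I_le => //; first exact: rintD.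
by move=> x; apply: le_trans (cmodD _ _); rewrite addrA subrK.
Qed.

End L2_density.

(** * Fejer means and Hardy spaces *)

Section fejer.
Variable R : realType.
Local Notation T := (circle R).
Local Notation C := (R[i]).
Local Notation mu := (arc_length R).
Implicit Types f g : T -> C.
Local Notation I f := (\int[mu]_x f x).
Local Notation L2 := (@sqr_integrable R).

(** The Fourier coefficient of index -m: moments of positive index are the negative frequencies. *)
Definition moment f (m : int) : C := cintegral (fun x => f x * zpow m x).

(** The Fejer kernel at x y^-1. The double sum counts the frequency m exactly N - |m| times, so the
    triangular weights need no absolute value. *)
Definition fejer_kernel (N : nat) (x y : T) : C :=
  N%:R^-1 * \sum_(j < N) \sum_(k < N) zpow (j%:Z - k%:Z) x * zpow (k%:Z - j%:Z) y.

Definition fejer (N : nat) f (x : T) : C :=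
  N%:R^-1 * \sum_(j < N) \sum_(k < N) zpow (j%:Z - k%:Z) x * moment f (k%:Z - j%:Z).

Lemma cintMz f m : cintegrable f -> cintegrable (fun x => f x * zpow m x).
Proof.
move=> cf; rewrite (_ : (fun x => _) = fun x => zpow m x * f x); last first.
  by apply/funext => x; rewrite mulrC.
apply: (@cintMb _ 1) => //; first exact: cmeasurable_zpow.
by apply: aeW => x; rewrite cmod_zpow.
Qed.

Lemma fejerE N f x : cintegrable f ->
  fejer N f x = cintegral (fun y => f y * fejer_kernel N x y).
Proof.
move=> cf; rewrite /fejer.
have c1 a m : cintegrable (fun y => a * (f y * zpow m y)).
  by apply: cintZ; exact: cintMz.
transitivity (cintegral (fun y => N%:R^-1 * \sum_(j < N) \sum_(k < N)
    zpow (j%:Z - k%:Z) x * (f y * zpow (k%:Z - j%:Z) y))).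
  rewrite cI_Z; last by apply: cint_sum => j; apply: cint_sum => k.
  congr (_ * _); rewrite cI_sum; last by move=> j; apply: cint_sum => k.
  apply: eq_bigr => j _; rewrite cI_sum//; apply: eq_bigr => k _.
  by rewrite cI_Z//; exact: cintMz.
congr cintegral; apply/funext => y; rewrite /fejer_kernel mulrCA; congr (_ * _).
rewrite mulr_sumr; apply: eq_bigr => j _; rewrite mulr_sumr.
by apply: eq_bigr => k _; rewrite mulrCA.
Qed.

(* The kernel is N^-1 |D|^2 with D a Dirichlet-type sum, hence nonnegative. *)
Lemma fejer_kernel_real N x y : fejer_kernel N x y =
  (N%:R^-1 * cmod (\sum_(j < N) zpow j x * zpow (- j%:Z) y) ^+ 2)%:C.
Proof.
rewrite rmorphM /= -mulJ rmorph_sum /= fmorphV rmorph_nat; congr (_ * _).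
rewrite mulr_suml; apply: eq_bigr => j _; rewrite mulr_sumr.
apply: eq_bigr => k _; rewrite rmorphM /= !zpowJ !opprK.
by rewrite !zpowD; ring.
Qed.

Lemma fejer_kernel_int N x : (0 < N)%N -> cintegral (fejer_kernel N x) = 1.
Proof.
move=> N0; transitivity (fejer N (fun=> 1) x).
  by rewrite fejerE; [|exact: cint_cst]; congr cintegral; apply/funext => y; rewrite mul1r.
rewrite /fejer; transitivity (N%:R^-1 * \sum_(j < N) (1 : C)); last first.
  by rewrite sumr_const card_ord mulVf// pnatr_eq0 -lt0n.
congr (_ * _); apply: eq_bigr => j _.
have mE m : moment (fun=> 1) m = (m == 0)%:R.
  by rewrite -cintegral_zpow; congr cintegral; apply/funext => y; rewrite mul1r.
rewrite (bigD1 j)//= mE subrr eqxx mulr1 zpow0 big1 ?addr0// => k kj.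
rewrite mE (_ : (k%:Z - j%:Z == 0) = false) ?mulr0//.
by apply/negbTE; rewrite subr_eq0 eqz_nat.
Qed.

Lemma trig_fejer N f : trig (fejer N f).
Proof.
apply: trigZ; apply: trig_sum => j; apply: trig_sum => k.
by under eq_fun do rewrite mulrC; exact: trig_zpow.
Qed.

Lemma fejer_kernel_trig N x : Linfty (fejer_kernel N x).
Proof.
apply: trig_Linfty; apply: trigZ; apply: trig_sum => j; apply: trig_sum => k.
exact: trig_zpow.
Qed.

(** The kernel is nonnegative with integral 1, so a Fejer mean is an average of the values of f. *)
Lemma cmod_fejer_le N f (M : R) x : (0 < N)%N -> cmeasurable f ->
  {ae mu, forall x, cmod (f x) <= M} -> cmod (fejer N f x) <= M.
Proof.
move=> N0 mf fM; have cf := cint_bnd mf fM.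
have cK := Linfty_cint (fejer_kernel_trig N x).
have Kr y : cmod (fejer_kernel N x y) = Re (fejer_kernel N x y).
  by rewrite fejer_kernel_real cmod_real ger0_norm// mulr_ge0 ?invr_ge0 ?sqr_ge0.
rewrite fejerE//; apply: le_trans (cmod_cI _) _.
  rewrite (_ : (fun x => _) = fun y => fejer_kernel N x y * f y); last first.
    by apply/funext => y; rewrite mulrC.
  have [mK [L KL]] := fejer_kernel_trig N x.
  exact: cintMb KL.
have <- : I (fun y => M * cmod (fejer_kernel N x y)) = M.
  have [_ rK] := cK; rewrite I_Z//.
  under eq_Rintegral do rewrite Kr.
  by rewrite -cI_Re fejer_kernel_int// mulr1.
apply: I_le_ae.
- have [mK [L KL]] := fejer_kernel_trig N x.
  have [_] := cintMb cf mK KL; under eq_fun do rewrite mulrC; exact.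
- by apply: rintZ; have [] := cK.
by apply: filterS fM => y h; rewrite cmodM ler_wpM2r// cmod_ge0.
Qed.

(** Gives the multiplicity of a frequency in the double sum. The truncated subtraction of naturals
    yields 0 when |m| >= N, as it should. *)
Lemma count_diff (N : nat) (m : int) :
  \sum_(j < N) \sum_(k < N) (k%:Z - j%:Z == m)%:R = (N - `|m|)%N%:R :> C.
Proof.
have key (n : nat) :
    \sum_(j < N) \sum_(k < N) ((k : nat) == j + n)%N%:R = (N - n)%N%:R :> C.
  transitivity (\sum_(j < N) ((j : nat) < N - n)%N%:R : C).
    apply: eq_bigr => j _; have [jN|jN] := ltnP (j + n) N.
      rewrite (bigD1 (Ordinal jN))//= eqxx big1 ?addr0 => [|k]; last first.
        by rewrite -val_eqE /= => /negbTE ->.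
      by rewrite ltn_subRL [(n + j)%N]addnC jN.
    rewrite ltn_subRL [(n + j)%N]addnC ltnNge jN big1// => k _.
    by rewrite ltn_eqF// (leq_trans (ltn_ord k)).
  have : (N - n <= N)%N by rewrite leq_subr.
  move: (N - n)%N => t; elim: N t => [|N' IH] t; first by rewrite big_ord0 leqn0 => /eqP->.
  rewrite big_ord_recr /= leq_eqVlt => /predU1P[->|tN]; last first.
    by rewrite IH// ltnNge -ltnS tN addr0.
  rewrite ltnSn (eq_bigr (fun=> 1)) => [|k _]; last by rewrite ltnW// ltnS.
  by rewrite sumr_const card_ord natr1.
case: m => n.
  rewrite -key; apply: eq_bigr => j _; apply: eq_bigr => k _.
  by rewrite subr_eq addrC -PoszD eqz_nat.
rewrite /= -key exchange_big; apply: eq_bigr => k _; apply: eq_bigr => j _.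
rewrite NegzE; congr (nat_of_bool _)%:R; apply/eqP/eqP; lia.
Qed.

Lemma moment_fejer N f m : (0 < N)%N ->
  moment (fejer N f) m = (N - `|m|)%N%:R / N%:R * moment f m.
Proof.
move=> N0; rewrite /moment.
pose a j k : C := N%:R^-1 * moment f (k%:Z - j%:Z).
have c1 j k : cintegrable (fun x => a j k * zpow (j%:Z - k%:Z + m) x).
  by apply: cintZ; exact/Linfty_cint/Linfty_zpow.
rewrite (_ : (fun x => _) = (fun x => \sum_(j < N) \sum_(k < N)
    a j k * zpow (j%:Z - k%:Z + m) x)); last first.
  apply/funext => x; rewrite /fejer -mulrA mulr_suml mulr_sumr.
  apply: eq_bigr => j _; rewrite mulr_suml mulr_sumr; apply: eq_bigr => k _.
  by rewrite [zpow (_ + m) x]zpowD /a; ring.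
rewrite cI_sum; last by move=> j; apply: cint_sum => k.
transitivity (\sum_(j < N) \sum_(k < N)
    N%:R^-1 * moment f m * (k%:Z - j%:Z == m)%:R).
  apply: eq_bigr => j _; rewrite cI_sum//; apply: eq_bigr => k _.
  rewrite cI_Z; last exact/Linfty_cint/Linfty_zpow.
  rewrite cintegral_zpow /a.
  have -> : (j%:Z - k%:Z + m == 0) = (k%:Z - j%:Z == m).
    by apply/eqP/eqP; lia.
  by case: eqP => [->|]; rewrite ?mulr0.
under eq_bigr do rewrite -mulr_sumr.
by rewrite -mulr_sumr count_diff -/(moment f m); ring.
Qed.


(** For N >= |m| the m-th moment of f minus its mean is |m| / N times that of f, by [moment_fejer];
    a trigonometric g involves finitely many moments. *)
Lemma fejer_weak_trig f g e : cintegrable f -> trig g -> 0 < e ->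
  exists N0, forall N, (N0 < N)%N ->
  cmod (cintegral (fun x => (f x - fejer N f x) * g x)) < e.
Proof.
move=> cf tg; elim: tg e => [|a m g0 tg0 IH] e e0.
  exists 0%N => N _; under eq_fun do rewrite mulr0.
  by rewrite cI_cst cmod0.
have e2 : 0 < e / 2 by rewrite divr_gt0.
have [N1 hN1] := IH _ e2.
pose c := cmod a * cmod (moment f m) * `|m|%N%:R.
have c0 : 0 <= c by rewrite !mulr_ge0// cmod_ge0.
(* N > |m| makes N - |m| a genuine difference, and the last summand gives c / N < e / 2. *)
exists (N1 + `|m| + Num.truncn (c / (e / 2)))%N => N hN.
have N0 : (0 < N)%N by lia.
have cs : cintegrable (fejer N f) by exact/Linfty_cint/trig_Linfty/trig_fejer.
have cfs := cintB cf cs.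
have [mg0 [M gM]] := trig_Linfty tg0.
have c1 : cintegrable (fun x => a * ((f x - fejer N f x) * zpow m x)).
  by apply: cintZ; exact: cintMz.
have c2 : cintegrable (fun x => (f x - fejer N f x) * g0 x).
  by have := cintMb cfs mg0 gM; under eq_fun do rewrite mulrC.
rewrite (_ : (fun x => _) = fun x => a * ((f x - fejer N f x) * zpow m x) +
    (f x - fejer N f x) * g0 x); last by apply/funext => x; ring.
rewrite cI_D//; apply: le_lt_trans (cmodD _ _) _; rewrite [e]splitr.
apply: ltrD; last by apply: hN1; lia.
rewrite cI_Z; last exact: cintMz.
rewrite (_ : (fun x => _) = fun x => f x * zpow m x - fejer N f x * zpow m x); last first.
  by apply/funext => x; rewrite mulrBl.
rewrite cI_B; [|exact: cintMz|exact: cintMz].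
rewrite -![cintegral _]/(moment _ _) moment_fejer//.
have -> : moment f m - (N - `|m|)%N%:R / N%:R * moment f m =
    (`|m|%N%:R / N%:R)%:C * moment f m.
  have Nn0 : N%:R != 0 :> C by rewrite pnatr_eq0 -lt0n.
  rewrite rmorphM fmorphV !rmorph_nat natrB; last by lia.
  by field.
rewrite !cmodM cmod_real ger0_norm// ?divr_ge0//.
rewrite [ltLHS](_ : _ = c / N%:R); last by rewrite /c; ring.
rewrite ltr_pdivrMr ?ltr0n// mulrC -ltr_pdivrMr//.
apply: lt_le_trans (truncnS_gt _) _; rewrite ler_nat.
by apply: leq_ltn_trans hN; exact: leq_addl.
Qed.

(** Weak* convergence of the means: they are uniformly bounded, so convergence against trigonometric
    polynomials extends to all g in L^1 by density. *)
Lemma fejer_weak f g (M e : R) : cmeasurable f ->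
  {ae mu, forall x, cmod (f x) <= M} -> cintegrable g -> 0 < e ->
  exists N0, forall N, (N0 < N)%N ->
  cmod (cintegral (fun x => (f x - fejer N f x) * g x)) < e.
Proof.
move=> mf fM cg e0; have cf := cint_bnd mf fM.
pose L := 2 * `|M| + 1; have L0 : 0 < L by rewrite /L; have := normr_ge0 M; lra.
have e2 : 0 < e / 2 by rewrite divr_gt0.
have [t tt ht] := trig_dense_L1 cg (divr_gt0 e2 L0).
have [N0 hN0] := fejer_weak_trig cf tt e2.
exists N0 => N hN; have Np : (0 < N)%N by lia.
have cs : cintegrable (fejer N f) by exact/Linfty_cint/trig_Linfty/trig_fejer.
have mfs := cmeasurableB mf cs.1.
have fsL : {ae mu, forall x, cmod (f x - fejer N f x) <= L}.
  apply: (filterS _ fM) => x h; apply: le_trans (cmodB _ _) _.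
  have := cmod_fejer_le x Np mf fM; have := ler_norm M; rewrite /L; lra.
have ct := Linfty_cint (trig_Linfty tt); have cgt := cintB cg ct.
have c1 := cintMb cgt mfs fsL; have c2 := cintMb ct mfs fsL.
rewrite (_ : (fun x => _) = fun x => (f x - fejer N f x) * (g x - t x) +
  (f x - fejer N f x) * t x); last by apply/funext => x; ring.
rewrite cI_D// [e]splitr; apply: le_lt_trans (cmodD _ _) _.
apply: ltrD; last exact: hN0.
apply: le_lt_trans (cmod_cI c1) _.
move: ht; rewrite ltr_pdivlMr// mulrC; apply: le_lt_trans.
have [_ r1] := c1; have [_ r2] := cgt.
rewrite -I_Z//; apply: I_le_ae => //; first exact: rintZ.
by apply: filterS fsL => x h; rewrite cmodM ler_wpM2r// cmod_ge0.
Qed.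

Lemma cI_trig_eq0 g t : cintegrable g -> (forall m, moment g m = 0) -> trig t ->
  cintegral (fun x => t x * g x) = 0.
Proof.
move=> cg g0; elim=> [|a m f tf IH].
  by under eq_fun do rewrite mul0r; rewrite cI_cst.
have [mf [M fM]] := trig_Linfty tf.
rewrite (_ : (fun x => _) = fun x => a * (g x * zpow m x) + f x * g x); last first.
  by apply/funext => x; ring.
rewrite cI_D; [|by apply: cintZ; exact: cintMz|exact: cintMb fM].
rewrite IH cI_Z; last exact: cintMz.
by rewrite -[cintegral _]/(moment _ _) g0 mulr0 addr0.
Qed.

(** Tested on the bounded function s = g^* / |g|, for which s g = |g|: the Fejer means of s are
    trigonometric, hence annihilate g, and they converge weakly* to s. *)
Lemma moment_unique g : cintegrable g -> (forall m, moment g m = 0) ->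
  {ae mu, forall x, g x = 0}.
Proof.
move=> cg g0; have [mg rg] := cg.
pose s x : C := (g x)^* * ((cmod (g x))^-1)%:C.
have ms : cmeasurable s.
  apply: cmeasurableM; first exact: cmeasurableJ.
  apply: cmeasurable_real; apply: measurable_inv_ge0; first exact: measurable_cmod.
  by move=> x; exact: cmod_ge0.
have s1 x : cmod (s x) <= 1.
  rewrite cmodM cmodJ cmod_real ger0_norm ?invr_ge0 ?cmod_ge0//.
  have [->|z0] := eqVneq (cmod (g x)) 0; first by rewrite mul0r.
  by rewrite divff.
have sg x : s x * g x = (cmod (g x))%:C.
  rewrite /s mulrAC [_^* * _]mulrC mulJ -rmorphM /= expr2.
  have [->|z0] := eqVneq (cmod (g x)) 0; first by rewrite !mul0r.
  by rewrite mulfK.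
suff h : I (fun x => cmod (g x)) <= 0.
  have := I_eq0 rg (fun x => cmod_ge0 _) h.
  by apply: filterS => x /cmod_eq0.
apply/ler_addgt0Pl => e e0; rewrite addr0.
have [N0 /(_ N0.+1 (ltnSn _))] := fejer_weak ms (aeW _ s1) cg e0.
have cs : Linfty (fejer N0.+1 s) by exact/trig_Linfty/trig_fejer.
have [mfs [M fsM]] := cs.
rewrite (_ : (fun x => _) = fun x => (cmod (g x))%:C - fejer N0.+1 s x * g x); last first.
  by apply/funext => x; rewrite mulrBl sg.
rewrite cI_B; last 2 first.
- apply: (cint_le _ _ rg); first by apply: cmeasurable_real; exact: measurable_cmod.
  by move=> x; rewrite cmod_real ger0_norm ?cmod_ge0.
- exact: cintMb fsM.
rewrite (cI_trig_eq0 cg g0 (trig_fejer _ _)) subr0 cI_real cmod_real => /ltW.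
by apply: le_trans; exact: ler_norm.
Qed.

(** Vanishing of negative frequencies is taken as the definition because it is linear and easily
    tested; [H2E] identifies it with the closure of the polynomials. *)
Definition H2 : set (T -> C) :=
  [set f | L2 f /\ forall n : nat, moment f n.+1 = 0].

Lemma cI_poly_eq0 g n (p : {poly C}) : cintegrable g ->
  (forall k : nat, moment g (n + k)%N = 0) ->
  cintegral (fun x => p.[zcoord x] * g x * zpow n x) = 0.
Proof.
move=> cg g0.
have c1 (i : nat) : cintegrable (fun x => p`_i * (g x * zpow (n + i)%N x)).
  by apply: cintZ; exact: cintMz.
rewrite (_ : (fun x => _) = fun x => \sum_(i < size p) p`_i * (g x * zpow (n + i)%N x)).
  rewrite cI_sum// big1// => i _; rewrite cI_Z; last exact: cintMz.
  by rewrite -[cintegral _]/(moment _ _) g0 mulr0.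
apply/funext => x; rewrite horner_coef !mulr_suml; apply: eq_bigr => i _.
by rewrite PoszD zpowD -zpow_nat; ring.
Qed.

Lemma poly_Linfty (p : {poly C}) : Linfty (fun x : T => p.[zcoord x]).
Proof. exact/trig_Linfty/trig_horner. Qed.

Lemma poly_L2 : @analytic_polynomials R `<=` L2.
Proof. by move=> _ [p _ <-]; exact/Linfty_L2/poly_Linfty. Qed.

Lemma moment_poly (p : {poly C}) (n : nat) :
  moment (fun x : T => p.[zcoord x]) n.+1 = 0.
Proof.
transitivity (cintegral (fun x : T => p.[zcoord x] * 1 * zpow n.+1 x)).
  by congr cintegral; apply/funext => x; rewrite mulr1.
apply: cI_poly_eq0 => [|k]; first exact: cint_cst.
transitivity (cintegral (@zpow R (n.+1 + k)%N)); last by rewrite cintegral_zpow.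
by congr cintegral; apply/funext => x; rewrite mul1r.
Qed.

(** In the double sum a negative power z^(j - k), k > j, carries the moment of positive index k - j,
    which vanishes. *)
Lemma fejer_poly N f : (forall n : nat, moment f n.+1 = 0) ->
  analytic_polynomials (fejer N f).
Proof.
move=> f0; exists (N%:R^-1 *: \sum_(j < N) \sum_(k < N)
  (if (k <= j)%N then moment f (k%:Z - j%:Z) else 0) *: 'X^(j - k)) => //.
apply/funext => x; rewrite hornerZ horner_sum; congr (_ * _).
apply: eq_bigr => j _; rewrite horner_sum; apply: eq_bigr => k _.
rewrite hornerZ hornerXn mulrC; case: leqP => kj.
  by rewrite (subzn kj) zpow_nat.
by rewrite (_ : k%:Z - j%:Z = (k - j).-1.+1%:Z) ?f0 ?mulr0//; lia.
Qed.

(** A single moment is a weak* neighbourhood with one test function, and polynomials have no moment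
    of positive index. Conversely the Fejer means of f are polynomials converging weakly* to f; the
    maximum of the N i serves all the test functions at once. *)
Lemma HinftyP f : Hinfty f <-> Linfty f /\ forall n : nat, moment f n.+1 = 0.
Proof.
split=> [[lf hf]|[lf f0]].
  split=> // n; apply: cmod_eq0; apply/eqP; rewrite eq_le cmod_ge0 andbT.
  apply/ler_addgt0Pl => e e0; rewrite addr0.
  have cz : cintegrable (@zpow R n.+1) by exact/Linfty_cint/Linfty_zpow.
  have [_ [p _ <-] /(_ ord0)/ltW] := hf 1%N (fun=> @zpow R n.+1) e (fun=> cz) e0.
  have cf := Linfty_cint lf; have cp := Linfty_cint (poly_Linfty p).
  rewrite (_ : (fun x => _) = fun x => f x * zpow n.+1 x - p.[zcoord x] * zpow n.+1 x); last first.
    by apply/funext => x; rewrite mulrBl.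
  rewrite cI_B; [|exact: cintMz|exact: cintMz].
  by rewrite -![cintegral _]/(moment _ _) moment_poly subr0.
split=> // n g e cg e0; have [mf [M fM]] := lf.
have /choice[N hN] : forall i, exists N0, forall N, (N0 < N)%N ->
    cmod (cintegral (fun x => (f x - fejer N f x) * g i x)) < e.
  by move=> i; exact: fejer_weak fM (cg i) e0.
exists (fejer (\max_(i < n) N i).+1 f); first exact: fejer_poly.
by move=> i; apply: hN; rewrite ltnS; exact: (leq_bigmax i).
Qed.

Lemma Hinfty_H2 : @Hinfty R `<=` H2.
Proof. by move=> f /HinftyP[lf f0]; split => //; exact: Linfty_L2. Qed.

Lemma poly_Hinfty : @analytic_polynomials R `<=` @Hinfty R.
Proof.
by move=> _ [p _ <-]; apply/HinftyP; split; [exact: poly_Linfty|exact: moment_poly].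
Qed.

Lemma N2_zpow m : N2 (@zpow R m) = 1.
Proof.
by rewrite /N2; under eq_Rintegral do rewrite cmod_zpow expr1n; rewrite I_cst.
Qed.

Lemma momentB f g m : cintegrable f -> cintegrable g ->
  moment (fun x => f x - g x) m = moment f m - moment g m.
Proof.
move=> cf cg; rewrite /moment; under eq_fun do rewrite mulrBl.
by rewrite cI_B//; exact: cintMz.
Qed.

Lemma H2_closed : L2_adherent H2 `<=` H2.
Proof.
move=> f [lf hf]; split => // n; apply: cmod_eq0; apply/eqP.
rewrite -sqrf_eq0 eq_le sqr_ge0 andbT.
apply/ler_addgt0Pl => e e0; rewrite addr0.
have [g [lg g0] fg] := hf _ e0.
rewrite -[moment f _]subr0 -(g0 n) -momentB; [|exact: L2_cint|exact: L2_cint].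
apply: le_trans (CS (L2B lf lg) (Linfty_L2 (Linfty_zpow _ _))) _.
by rewrite N2_zpow mulr1 ltW.
Qed.

(** Frequencies >= 0 go to p and negative ones to q; the latter are orthogonal to H^2. *)
Lemma trig_split t : trig t -> exists p q, [/\ analytic_polynomials p, L2 q,
  forall h, H2 h -> cintegral (fun x => h x * (q x)^*) = 0 &
  forall x, t x = p x + q x].
Proof.
elim=> [|a m t0 _ [p [q [[P _ <-] lq hq tq]]]].
  exists (fun x => (0 : {poly C}).[zcoord x]), (fun=> 0); split.
  - by exists 0.
  - exact: L2_cst.
  - by move=> h _; under eq_fun do rewrite conjC0 mulr0; rewrite cI_cst.
  by move=> x; rewrite horner0 addr0.
case: m => m.
  exists (fun x => (a *: 'X^m + P).[zcoord x]), q; split => //.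
    by exists (a *: 'X^m + P).
  by move=> x; rewrite tq hornerD hornerZ hornerXn addrA.
exists (fun x => P.[zcoord x]), (fun x => a * zpow (Negz m) x + q x); split => //.
- by exists P.
- by apply: L2D => //; apply: L2Z; exact/Linfty_L2/Linfty_zpow.
- move=> h [lh h0].
  rewrite (_ : (fun x => _) = fun x => a^* * (h x * zpow m.+1 x) + h x * (q x)^*); last first.
    by apply/funext => x; rewrite rmorphD rmorphM /= zpowJ NegzE opprK; ring.
  rewrite cI_D; last 2 first.
    by apply: cintZ; apply: cintMz; exact: L2_cint.
    by apply: L2M_cint => //; exact: L2J.
  rewrite cI_Z; last by apply: cintMz; exact: L2_cint.
  by rewrite -[cintegral _]/(moment _ _) h0 mulr0 add0r; exact: hq.
by move=> x; rewrite tq; ring.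
Qed.

(** If t = p + q is a trigonometric approximant of f, then q is orthogonal to f - p, which lies in
    H^2; dropping q can only bring the approximant closer to f. *)
Lemma H2E : H2 = L2_adherent (@analytic_polynomials R).
Proof.
apply/seteqP; split => [f [lf f0]|f [lf hf]]; last first.
  apply: H2_closed; split => // e /hf[g Pg fg]; exists g => //.
  by apply: Hinfty_H2; exact: poly_Hinfty.
split=> // e e0; have [_ /(_ _ e0)[t tt ht]] := trig_dense_L2 lf.
have [p [q [Pp lq hq tq]]] := trig_split tt; exists p => //.
apply: le_lt_trans ht.
have lp := poly_L2 Pp.
rewrite (_ : (fun x => f x - t x) = fun x => (f x - p x) - q x); last first.
  by apply/funext => x; rewrite tq; ring.
rewrite [leRHS]N2_sub//; last exact: L2B.
rewrite hq ?mulr0 ?subr0 ?lerDl ?N2_ge0//.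
split; first exact: L2B.
move=> n; rewrite momentB; [|exact: L2_cint|exact: L2_cint].
by have [_ ->] := Hinfty_H2 (poly_Hinfty Pp); rewrite f0 subr0.
Qed.

Lemma H2_poly (p : {poly C}) f : H2 f -> H2 (fun x => p.[zcoord x] * f x).
Proof.
move=> [lf f0]; have [mp [M pM]] := poly_Linfty p.
split; first exact: L2Mb pM lf.
by move=> n; apply: cI_poly_eq0 => [|k]; [exact: L2_cint|rewrite addSn].
Qed.

(** Polynomials p approximate b in L^2, and the moments of p f vanish; by Cauchy-Schwarz those of (b
    - p) f are small even though (b - p) f need not be small in L^2. *)
Lemma Hinfty_H2_mul b f : Hinfty b -> H2 f -> H2 (fun x => b x * f x).
Proof.
move=> hb [lf f0]; have /HinftyP[[mb [M bM]] _] := hb.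
split; first exact: L2Mb bM lf.
move=> n; apply: cmod_eq0; apply/eqP; rewrite -sqrf_eq0 eq_le sqr_ge0 andbT.
apply/ler_addgt0Pl => e e0; rewrite addr0.
have lb : L2 b by apply: Linfty_L2; split; [|exists M].
have L0 : 0 < N2 f + 1 by rewrite ltr_wpDl ?N2_ge0.
have : H2 b by exact: Hinfty_H2.
rewrite H2E => -[_ /(_ _ (divr_gt0 e0 L0))[_ [p _ <-]]].
rewrite ltr_pdivlMr// => hp.
have lp := Linfty_L2 (poly_Linfty p).
have [_ /(_ n) pf0] := H2_poly p (conj lf f0).
have lbp := L2B lb lp.
rewrite -[moment _ _]subr0 -pf0 -momentB; [|exact: L2M_cint|exact: L2M_cint].
rewrite /moment (_ : (fun x => _) =
  fun x => (b x - p.[zcoord x]) * (zpow n.+1 x * f x)); last first.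
  by apply/funext => x; ring.
have [mz [K zK]] := Linfty_zpow R n.+1.
apply: le_trans (CS lbp (L2Mb mz zK lf)) _.
rewrite N2M1; last by move=> x; exact: cmod_zpow.
apply/ltW/(le_lt_trans _ hp); rewrite ler_wpM2l ?N2_ge0// lerDl//.
Qed.

Lemma LinftyM f g : Linfty f -> Linfty g -> Linfty (fun x => f x * g x).
Proof.
move=> [mf [M fM]] [mg [K gK]]; split; first exact: cmeasurableM.
exists (M * K); have := ae_and fM gK; apply: filterS => x [h1 h2].
by rewrite cmodM ler_pM// cmod_ge0.
Qed.

Lemma HinftyM f g : Hinfty f -> Hinfty g -> Hinfty (fun x => f x * g x).
Proof.
move=> hf hg; have [_ h0] := Hinfty_H2_mul hf (Hinfty_H2 hg).
have /HinftyP[lf _] := hf; have /HinftyP[lg _] := hg.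
by apply/HinftyP; split => //; exact: LinftyM.
Qed.

End fejer.

Lemma cvg_of_bounded_variation (R : realType) (a : nat -> R) (r : R) :
  (forall n, \sum_(0 <= k < n) `|a k.+1 - a k| <= r) -> cvgn a.
Proof.
move=> ar.
have h : cvgn [normed series (telescope a)].
  apply: nondecreasing_is_cvgn.
    apply/nondecreasing_seqP => n; by rewrite /series /= [leRHS]big_nat_recr//= lerDl.
  by exists r => _ [n _ <-]; exact: ar.
have := normed_cvg h; rewrite telescopeK => /cvg_ex[l hl].
apply/cvg_ex; exists (l + a 0%N).
have : (a n - a 0%N) + a 0%N @[n --> \oo] --> l + a 0%N.
  by apply: cvgD; [exact: hl|exact: cvg_cst].
by under eq_fun do rewrite subrK.
Qed.

Lemma conj_real (R : realType) (x : R) : (x%:C)^* = x%:C.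
Proof. by apply: eqC; rewrite ?cReJ// cImJ cImC oppr0. Qed.

(** * The Beurling-Helson theorem in L^2 *)

Section L2_complete.
Variable R : realType.
Local Notation T := (circle R).
Local Notation C := (R[i]).
Local Notation mu := (arc_length R).
Implicit Types f g : T -> C.
Local Notation I f := (\int[mu]_x f x).
Local Notation L2 := (@sqr_integrable R).

(** The increments have mean at most 2^-n, so the sum of their moduli is integrable, hence finite
    a.e.; A is the set where it is finite. *)
Lemma ae_bounded_variation (u_ : nat -> T -> C) : (forall n, L2 (u_ n)) ->
  (forall n, N2 (fun x => u_ n.+1 x - u_ n x) <= (2^-1 ^+ n) ^+ 2) ->
  exists2 A : set T, measurable A & {ae mu, forall x, A x} /\
  (forall x, A x -> exists r, forall n,
     \sum_(0 <= k < n) cmod (u_ k.+1 x - u_ k x) <= r).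
Proof.
move=> lu du.
pose d n x := cmod (u_ n.+1 x - u_ n x).
have cd n : cintegrable (fun x => u_ n.+1 x - u_ n x) by exact/L2_cint/L2B.
have md n : measurable_fun setT (d n) by apply: measurable_cmod; have [] := cd n.
have Id n : I (d n) <= 2^-1 ^+ n.
  rewrite -(ler_pXn2r (_ : (0 < 2)%N)) ?nnegrE ?exprn_ge0//.
    exact: le_trans (I_cmod_N2 (L2B (lu n.+1) (lu n))) (du n).
  by apply: I_ge0 => x; exact: cmod_ge0.
pose G x : \bar R := (\sum_(0 <= n <oo) (d n x)%:E)%E.
have mG : measurable_fun setT G.
  apply: ge0_emeasurable_sum => [k x _ _|k _]; first by rewrite lee_fin cmod_ge0.
  exact/measurable_EFinP.
have G0 x : (0 <= G x)%E.
  by apply: nneseries_ge0 => n _ _; rewrite lee_fin cmod_ge0.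
have IG : (\int[mu]_x G x < +oo)%E.
  rewrite integral_nneseries//; last 2 first.
  - by move=> n; exact/measurable_EFinP.
  - by move=> n x _; rewrite lee_fin cmod_ge0.
  apply: (@le_lt_trans _ _ 2%:E); last exact: ltry.
  apply: lime_le.
    by apply: is_cvg_nneseries => n _ _; apply: integral_ge0 => x _; rewrite lee_fin cmod_ge0.
  apply: nearW => n.
  rewrite (eq_bigr (fun k => (I (d k))%:E)); last first.
    by move=> k _; rewrite I_fin//; have [] := cd k.
  rewrite sumEFin lee_fin.
  apply: (@le_trans _ _ (\sum_(0 <= k < n) 2^-1 ^+ k)).
    by apply: ler_sum => k _; exact: Id.
  have -> : \sum_(0 <= k < n) 2^-1 ^+ k = 2 - 2 * 2^-1 ^+ n :> R.
    elim: n => [|n IH]; first by rewrite big_nil expr0; ring.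
    by rewrite big_nat_recr//= IH exprS; field.
  by rewrite gerBl mulr_ge0// exprn_ge0.
have rG : mu.-integrable setT G.
  apply/integrableP; split => //.
  by under eq_integral do rewrite gee0_abs//.
exists [set x | G x \is a fin_num].
  rewrite -[X in measurable X]setTI.
  exact: emeasurable_fin_num.
split.
  by have := integrable_ae measurableT rG; apply: filterS => x; exact.
move=> x /= Gx; exists (fine (G x)) => n.
rewrite -lee_fin fineK// -sumEFin; apply: nneseries_lim_ge => k _.
by rewrite lee_fin cmod_ge0.
Qed.

Lemma L2_complete (u_ : nat -> T -> C) : (forall n, L2 (u_ n)) ->
  (forall n m, (n <= m)%N -> N2 (fun x => u_ n x - u_ m x) <= (2^-1 ^+ n) ^+ 2) ->
  exists2 g, L2 g & forall n, N2 (fun x => u_ n x - g x) <= (2^-1 ^+ n) ^+ 2.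
Proof.
move=> lu du.
have [|A mA [aeA Ar]] := ae_bounded_variation lu.
  by move=> n; rewrite N2C; exact: du.
(* Multiplying by the indicator of A makes the sequence converge at every point, so that the limit
   is measurable. *)
pose v n x := cindic A x * u_ n x.
have vu n : {ae mu, forall x, u_ n x = v n x}.
  by apply: filterS aeA => x Ax; rewrite /v /cindic indicE mem_set// mul1r.
have mv n : cmeasurable (v n).
  by apply: cmeasurableM; [exact: cmeasurable_indic|case: (lu n)].
have lv n : L2 (v n) by apply: L2_ae (vu n) (lu n).
have dv n m : (n <= m)%N -> N2 (fun x => v n x - v m x) <= (2^-1 ^+ n) ^+ 2.
  move=> nm; rewrite -(N2_ae (f := fun x => u_ n x - u_ m x)).
  - exact: du.
  - by apply: cmeasurableB; [case: (lu n)|case: (lu m)].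
  - exact: cmeasurableB.
  by have := ae_and (vu n) (vu m); apply: filterS => x [-> ->].
have cv x : cvgn (fun n => Re (v n x)) /\ cvgn (fun n => Im (v n x)).
  have [Ax|Ax] := pselect (A x); last first.
    have v0 n : v n x = 0 by rewrite /v /cindic indicE memNset// mul0r.
    by split; under eq_fun do rewrite v0; exact: is_cvg_cst.
  have [r hr] := Ar _ Ax.
  have vE n : v n x = u_ n x by rewrite /v /cindic indicE mem_set// mul1r.
  by split; under eq_fun do rewrite vE; apply: (@cvg_of_bounded_variation _ _ r) => n;
    apply: le_trans (hr n); apply: ler_sum => k _; rewrite -?cReN -?cImN -?cReD -?cImD;
    [exact: normRe_le|exact: normIm_le].
pose g x : C := limn (fun n => Re (v n x)) +i* limn (fun n => Im (v n x)).
have mg : cmeasurable g.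
  split.
    apply: (@measurable_fun_cvg _ _ _ _ (fun n x => Re (v n x))).
      by move=> n; have [] := mv n.
    by move=> x _; exact: (cv x).1.
  apply: (@measurable_fun_cvg _ _ _ _ (fun n x => Im (v n x))).
    by move=> n; have [] := mv n.
  by move=> x _; exact: (cv x).2.
(* Fatou's lemma in m, with n fixed, applied to |v_n - v_(n+m)|^2; the rate of the Cauchy sequence
   passes to the limit. *)
have key n : (\int[mu]_x (cmod (v n x - g x) ^+ 2)%:E <= ((2^-1 ^+ n) ^+ 2)%:E)%E.
  pose F m x : \bar R := (cmod (v n x - v (n + m)%N x) ^+ 2)%:E.
  have mF m : measurable_fun setT (F m).
    by apply/measurable_EFinP; apply: measurable_sqr_cmod; exact: cmeasurableB.
  have F0 m x : setT x -> (0 <= F m x)%E by rewrite lee_fin sqr_ge0.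
  have := @fatou _ _ _ mu setT measurableT F mF F0.
  have -> : (\int[mu]_x limn_einf (F^~ x) =
      \int[mu]_x (cmod (v n x - g x) ^+ 2)%:E)%E.
    apply: eq_integral => x _; apply: (cvg_limn_einf_sup _).1.
    apply/fine_cvgP; split; first exact: nearW.
    have c1 : Re (v (m + n)%N x) @[m --> \oo] --> Re (g x).
      by move: (cv x).1; rewrite -(cvg_shiftn n (fun m => Re (v m x))).
    have c2 : Im (v (m + n)%N x) @[m --> \oo] --> Im (g x).
      by move: (cv x).2; rewrite -(cvg_shiftn n (fun m => Im (v m x))).
    rewrite (_ : _ \o _ = fun m => (Re (v n x) - Re (v (m + n)%N x)) *
        (Re (v n x) - Re (v (m + n)%N x)) + (Im (v n x) - Im (v (m + n)%N x)) *
        (Im (v n x) - Im (v (m + n)%N x))); last first.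
      by apply/funext => m; rewrite /F /= sqr_cmod !cReD !cImD !cReN !cImN addnC !expr2.
    rewrite sqr_cmod cReD cImD cReN cImN !expr2.
    by apply: cvgD; apply: cvgM; apply: cvgB => //; exact: cvg_cst.
  move=> h; apply: le_trans h _.
  rewrite limn_einf_lim; apply: lime_le; first exact: is_cvg_einfs.
  apply: nearW => m; apply: (@le_trans _ _ (\int[mu]_x F m x)%E).
    by apply: ereal_inf_lbound; exists m => /=.
  have [_ r1] := L2B (lv n) (lv (n + m)%N).
  by rewrite I_fin// lee_fin dv// leq_addr.
have lg : L2 g.
  have l0 : L2 (fun x => v 0%N x - g x).
    split; first exact: cmeasurableB.
    apply/integrableP; split.
      by apply/measurable_EFinP; apply: measurable_sqr_cmod; exact: cmeasurableB.
    under eq_integral do rewrite gee0_abs ?lee_fin ?sqr_ge0//.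
    exact: le_lt_trans (key 0%N) (ltry _).
  rewrite (_ : g = fun x => v 0%N x - (v 0%N x - g x)); first exact: L2B.
  by apply/funext => x; rewrite subKr.
exists g => // n; rewrite (N2_ae (g := fun x => v n x - g x)).
- rewrite -lee_fin; apply: le_trans (key n); rewrite I_fin//.
  by have [] := L2B (lv n) lg.
- by apply: cmeasurableB => //; case: (lu n).
- exact: cmeasurableB.
by apply: filterS (vu n) => x ->.
Qed.


(** * Closed subspaces of L^2 and orthogonal projection *)

Record L2_subspace (M : set (T -> C)) : Prop := {
  L2s_sub : M `<=` L2;
  L2s0 : M (fun=> 0);
  L2sD : forall f g, M f -> M g -> M (fun x => f x + g x);
  L2sZ : forall (a : C) f, M f -> M (fun x => a * f x);
  L2s_closed : L2_adherent M `<=` M }.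

Definition ip f g : C := cintegral (fun x => f x * (g x)^*).

Lemma ipB f g h : L2 f -> L2 g -> L2 h ->
  ip (fun x => f x - g x) h = ip f h - ip g h.
Proof.
move=> lf lg lh; rewrite /ip; under eq_fun do rewrite mulrBl.
by rewrite cI_B//; apply: L2M_cint => //; exact: L2J.
Qed.

Lemma ip_norm f : ip f f = (N2 f)%:C.
Proof. by rewrite /ip; under eq_fun do rewrite mulJ; rewrite cI_real. Qed.

Lemma N2J f : N2 (fun x => (f x)^*) = N2 f.
Proof. by apply: eq_Rintegral => x _; rewrite cmodJ. Qed.

Lemma CS_ip f g : L2 f -> L2 g -> cmod (ip f g) ^+ 2 <= N2 f * N2 g.
Proof. by move=> lf lg; rewrite -[N2 g]N2J; apply: CS => //; exact: L2J. Qed.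

Lemma L2s_ae M f g : L2_subspace M -> M f -> cmeasurable g ->
  {ae mu, forall x, f x = g x} -> M g.
Proof.
move=> sM Mf mg fg; apply: (L2s_closed sM).
apply: (L2_adherent_ae (L2s_sub sM) mg fg).
exact: (sub_L2_adherent (L2s_sub sM)).
Qed.

Lemma L2sB M f g : L2_subspace M -> M f -> M g -> M (fun x => f x - g x).
Proof.
move=> sM Mf Mg; under eq_fun do rewrite -mulN1r.
by apply: (L2sD sM) => //; exact: (L2sZ sM).
Qed.

Lemma parallelogram f g : L2 f -> L2 g ->
  N2 (fun x => f x - g x) + N2 (fun x => f x + g x) = 2 * N2 f + 2 * N2 g.
Proof.
move=> lf lg; have [_ r1] := L2B lf lg; have [_ r2] := L2D lf lg.
have [_ rf] := lf; have [_ rg] := lg.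
rewrite -!I_Z// -!I_D//; last 2 first.
- exact: rintZ.
- exact: rintZ.
by apply: eq_Rintegral => x _; rewrite !sqr_cmod !cpart; ring.
Qed.

Section projection.
Variables (M : set (T -> C)) (f : T -> C).
Hypotheses (sM : L2_subspace M) (lf : L2 f).

Let D := [set N2 (fun x => f x - g x) | g in M].
Let d := inf D.

Let has_infD : has_inf D.
Proof.
split; first by exists (N2 (fun x => f x - 0)), (fun=> 0) => //; exact: L2s0 sM.
by exists 0 => _ [g _ <-]; exact: N2_ge0.
Qed.

Let d_le g : M g -> d <= N2 (fun x => f x - g x).
Proof. by move=> Mg; apply: ge_inf; [case: has_infD|exists g]. Qed.

Let near_min e : 0 < e -> exists2 g, M g & N2 (fun x => f x - g x) < d + e.
Proof.
by move=> /inf_adherent - /(_ _ has_infD)[_ [g Mg <-] hg]; exists g.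
Qed.

(** The midpoint of g and h lies in M, hence at squared distance at least d from f; the
    parallelogram identity turns this into a bound on g - h. *)
Let min_cauchy g h e1 e2 : M g -> M h -> N2 (fun x => f x - g x) < d + e1 ->
  N2 (fun x => f x - h x) < d + e2 -> N2 (fun x => g x - h x) <= 2 * e1 + 2 * e2.
Proof.
move=> Mg Mh h1 h2; have lg := L2s_sub sM Mg; have lh := L2s_sub sM Mh.
have := parallelogram (L2B lf lg) (L2B lf lh).
rewrite (_ : (fun x => f x - g x - (f x - h x)) = fun x => h x - g x); last first.
  by apply/funext => x; ring.
rewrite (_ : (fun x => f x - g x + (f x - h x)) =
   fun x => 2 * (f x - (2^-1 * (g x + h x)))); last first.
  by apply/funext => x; field.
rewrite N2Z; last first.
  by apply: L2B => //; apply: L2Z; exact: L2D.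
have := @d_le (fun x => 2^-1 * (g x + h x)) (L2sZ sM _ (L2sD sM Mg Mh)).
rewrite (_ : (2 : C) = (2 : R)%:C); last by rewrite rmorph_nat.
rewrite cmod_real ger0_norm//.
rewrite [N2 (fun x => h x - g x)]N2C.
by set a := N2 _; set b := N2 _ => ?; move: h1 h2; set p := N2 _; set q := N2 _; lra.
Qed.

(** A quantitative variational inequality: near-minimisers are nearly orthogonal to M, in a form
    that survives the passage to the limit. *)
Let min_ortho g h e : 0 <= e -> M g -> M h -> N2 (fun x => f x - g x) < d + e ->
  cmod (ip (fun x => f x - g x) h) ^+ 2 <= (N2 h + 1) * e.
Proof.
move=> e0 Mg Mh hg; have lg := L2s_sub sM Mg; have lh := L2s_sub sM Mh.
set c := ip _ h.
have B0 := N2_ge0 h; have B1 : 0 < N2 h + 1 by lra.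
(* Moving g by s c h changes the squared distance by -2 s |c|^2 + s^2 |c|^2 N2 h. Since s N2 h <= 1
   this is at most -s |c|^2; the 1 in s avoids dividing by N2 h = 0. *)
pose s := (N2 h + 1)^-1; have s0 : 0 < s by rewrite invr_gt0.
have sB : s * (N2 h + 1) = 1 by rewrite mulVf// gt_eqF.
pose k x := g x + s%:C * c * h x.
have Mk : M k by apply: (L2sD sM) => //; exact: (L2sZ sM).
have := d_le Mk.
have lfg := L2B lf lg; have lsh := L2Z (s%:C * c) lh.
rewrite (_ : (fun x => f x - k x) = fun x => (f x - g x) - s%:C * c * h x); last first.
  by apply/funext => x; rewrite /k; ring.
rewrite N2_sub// N2Z// cmodM exprMn cmod_real real_normK ?num_real//.
rewrite (_ : cintegral _ = (s * cmod c ^+ 2)%:C); last first.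
  transitivity (s%:C * c^* * c); last by rewrite rmorphM /= -mulJ; ring.
  have cE : c = cintegral (fun x => (f x - g x) * (h x)^*) by [].
  rewrite [X in _ = _ * X]cE -cI_Z; last by apply: L2M_cint => //; exact: L2J.
  congr cintegral; apply/funext => x; rewrite !rmorphM /=.
  rewrite conj_real.
  by ring.
rewrite cReC; set a := cmod c ^+ 2 => h1.
have a0 : 0 <= a by exact: sqr_ge0.
have h2 : s * a <= e.
  have : 2 * (s * a) - s ^+ 2 * a * N2 h <= e by move: h1 hg; lra.
  rewrite (_ : s ^+ 2 * a * N2 h = s * a * (s * (N2 h + 1) - s)); last by ring.
  rewrite sB; have s0' := ltW s0; have : 0 <= s * a * s by apply: mulr_ge0 => //; exact: mulr_ge0.
  by lra.
by move: h2; rewrite /s ler_pdivrMl.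
Qed.

Lemma L2_projection : exists2 m, M m & forall h, M h -> ip (fun x => f x - m x) h = 0.
Proof.
(* With excess 4^-n / 4, [min_cauchy] yields exactly the rate 4^-n required by [L2_complete]. *)
have hx n : exists g, M g /\ N2 (fun x => f x - g x) < d + (2^-1 ^+ n) ^+ 2 / 4.
  have [|g Mg hg] := @near_min ((2^-1 ^+ n) ^+ 2 / 4); last by exists g.
  by rewrite divr_gt0// !exprn_gt0.
have /choice[u hu] := hx.
have Mu n : M (u n) by have [] := hu n.
have Lu n : L2 (u n) by exact: L2s_sub sM _ (Mu n).
have [|g lg ug] := L2_complete Lu.
  move=> n m nm; have [_ h1] := hu n; have [_ h2] := hu m.
  apply: le_trans (min_cauchy (Mu n) (Mu m) h1 h2) _.
  have : (2^-1 ^+ m) ^+ 2 <= (2^-1 ^+ n) ^+ 2 :> R.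
    by rewrite lerXn2r ?nnegrE ?exprn_ge0// ler_wiXn2l//; lra.
  by lra.
have small (K e : R) : 0 < e -> exists n, K * (2^-1 ^+ n) ^+ 2 < e.
  move=> e0.
  have : K * (2^-1 ^+ n * 2^-1 ^+ n) @[n --> \oo] --> K * (0 * 0 : R).
    apply: cvgM; first exact: cvg_cst.
    by apply: cvgM; apply: cvg_expr; rewrite ger0_norm; lra.
  rewrite !mulr0 => /cvgrPdist_lt/(_ _ e0)[n _ /(_ n (leqnn n))] /=.
  rewrite sub0r normrN -expr2 => h; exists n.
  by apply: le_lt_trans h; rewrite ler_norm.
have Mg : M g.
  apply: (L2s_closed sM); split => // e e0.
  have [n hn] := small 1 e e0; exists (u n) => //.
  by rewrite N2C; apply: le_lt_trans (ug n) _; rewrite mul1r in hn.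
exists g => // h Mh; apply: cmod_eq0; apply/eqP; rewrite -sqrf_eq0 eq_le sqr_ge0 andbT.
apply/ler_addgt0Pl => e e0; rewrite addr0.
have lh := L2s_sub sM Mh.
have [n hn] := small (4 * (N2 h + 1)) e e0.
have [_ h1] := hu n.
have h2 := min_ortho (_ : 0 <= (2^-1 ^+ n) ^+ 2 / 4) (Mu n) Mh h1.
have {}h2 : cmod (ip (fun x => f x - u n x) h) ^+ 2 <= (N2 h + 1) * ((2^-1 ^+ n) ^+ 2 / 4).
  by apply: h2; rewrite divr_ge0// sqr_ge0.
have h3 := CS_ip (L2B (Lu n) lg) lh.
rewrite (_ : ip _ h = ip (fun x => f x - u n x) h + ip (fun x => u n x - g x) h); last first.
  by rewrite !ipB//; ring.
apply: le_trans (cmod_sqrD _ _) _.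
have h4 : N2 (fun x => u n x - g x) * N2 h <= (2^-1 ^+ n) ^+ 2 * N2 h.
  by rewrite ler_wpM2r ?N2_ge0.
have p0 : 0 <= (2^-1 ^+ n) ^+ 2 :> R by exact: sqr_ge0.
have := N2_ge0 h; move: h2 h3 h4 hn p0.
set P := (_ ^+ n) ^+ 2; set q := N2 h; set x1 := cmod _ ^+ 2; set x2 := cmod _ ^+ 2.
set x3 := N2 _ * q; move=> h2 h3 h4 hn p0 q0.
have : 0 <= q * P by exact: mulr_ge0.
lra.
Qed.

End projection.


(** * Invariant subspaces of L^2 *)

Definition zinvariant (M : set (T -> C)) :=
  forall f, M f -> M (fun x => zcoord x * f x).

Lemma zinv_pow M f (n : nat) : zinvariant M -> M f -> M (fun x => zpow n x * f x).
Proof.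
move=> zM Mf; elim: n => [|n IH]; first by under eq_fun do rewrite mul1r.
by under eq_fun do rewrite zpow_nat exprS -mulrA; exact: zM.
Qed.

Lemma L2s_poly M f (p : {poly C}) : L2_subspace M -> zinvariant M -> M f ->
  M (fun x => p.[zcoord x] * f x).
Proof.
move=> sM zM Mf; elim/poly_ind: p => [|p c IH].
  by under eq_fun do rewrite horner0 mul0r; exact: L2s0 sM.
rewrite (_ : (fun x => _) = fun x => zcoord x * (p.[zcoord x] * f x) + c * f x).
  by apply: (L2sD sM); [exact: zM|exact: L2sZ].
by apply/funext => x; rewrite hornerD hornerM hornerX hornerC; ring.
Qed.

(* All the moments of f r^* vanish. *)
Lemma doubly_invariant_ortho M f r : L2_subspace M ->
  (forall m f, M f -> M (fun x => zpow m x * f x)) -> M f -> L2 r ->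
  (forall h, M h -> ip r h = 0) -> {ae mu, forall x, f x * (r x)^* = 0}.
Proof.
move=> sM zM Mf lr rM; have lf := L2s_sub sM Mf.
apply: moment_unique; first by apply: L2M_cint => //; exact: L2J.
move=> m; have lzf := L2s_sub sM (zM m _ Mf).
transitivity ((ip r (fun x => zpow m x * f x))^*); last first.
  by rewrite rM ?conjC0//; exact: zM.
rewrite /ip -cI_J; last by apply: L2M_cint => //; exact: L2J.
congr cintegral; apply/funext => x.
by rewrite rmorphM /= conjCK; ring.
Qed.

(** Let p be the projection of 1. Every f in M satisfies f (1 - p)^* = 0; for f = p this forces the
    values 0 and 1, so p = chi_E, and M lives on E. Conversely, if f lives on E and m is its
    projection, the residual f - m is annihilated by both p and m, hence by f = p f, and so
    vanishes. *)
Lemma doubly_invariantP M : L2_subspace M ->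
  (forall m f, M f -> M (fun x => zpow m x * f x)) ->
  exists2 E : set T, measurable E &
    forall f, M f <-> L2 f /\ {ae mu, forall x, f x = cindic E x * f x}.
Proof.
move=> sM zM; have l1 : L2 (fun=> 1) by exact: L2_cst.
have [p Mp p1] := L2_projection sM l1.
have lp := L2s_sub sM Mp; have l1p := L2B l1 lp.
pose E := [set x | 2^-1 < Re (p x)].
have mE : measurable E.
  have [[p1' _] _] := lp; rewrite -[X in measurable X]setTI.
  rewrite (_ : E = (fun x => Re (p x)) @^-1` `]2^-1, +oo[%classic); first exact: p1'.
  by apply/seteqP; split => x /=; rewrite in_itv/= andbT.
have fp f : M f -> {ae mu, forall x, f x * (1 - p x)^* = 0}.
  by move=> Mf; exact: (doubly_invariant_ortho sM zM Mf l1p p1).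
have pE : {ae mu, forall x, p x = cindic E x}.
  apply: filterS (fp _ Mp) => x /eqP; rewrite mulf_eq0 => /orP[|] /eqP h.
    by rewrite /cindic indicE /E memNset//= h /=; apply/negP; rewrite -leNgt.
  have {}h : p x = 1.
    have : 1 - p x = 0 by rewrite -[LHS]conjCK h conjC0.
    by move/subr0_eq.
  by rewrite /cindic indicE /E mem_set//= h /=; lra.
exists E => // f; split=> [Mf|[lf fE]].
  split; first exact: L2s_sub sM _ Mf.
  have := ae_and (fp _ Mf) pE; apply: filterS => x [+ e]; rewrite e.
  rewrite /cindic; case: (\1_E x =P 1 :> R) => [->|]; first by rewrite mul1r.
  rewrite indicE; case: (_ \in _) => //= _.
  by rewrite subr0 conjC1 mulr1 mul0r.
have [m Mm mo] := L2_projection sM lf; have lm := L2s_sub sM Mm.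
have ls := L2B lf lm.
have h1 := doubly_invariant_ortho sM zM Mp ls mo.
have h2 := doubly_invariant_ortho sM zM Mm ls mo.
apply: (L2s_ae sM Mm); first by case: lf.
have := ae_and (ae_and h1 h2) (ae_and fE pE).
apply: filterS => x [[a b] [c e]].
have : (f x - m x) * (f x - m x)^* = 0.
  by rewrite mulrBl b subr0 {1}c -e mulrAC a mul0r.
by rewrite mulJ => /(congr1 (@complex.Re R))/= /eqP; rewrite sqrf_eq0 => /eqP/cmod_eq0/subr0_eq.
Qed.

(** The set is z M, described by its preimage under the isometry z; closedness passes through that
    isometry. *)
Lemma L2s_shift M : L2_subspace M ->
  L2_subspace [set f | M (fun x => zpow (- 1) x * f x)].
Proof.
move=> sM; have zz f : (fun x => zpow 1 x * (zpow (- 1) x * f x)) = f.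
  by apply/funext => x; rewrite mulrA -zpowD mul1r.
have [mz [K zK]] := Linfty_zpow R 1; have [mz' [K' zK']] := Linfty_zpow R (- 1).
split => /=.
- by move=> f /(L2s_sub sM) h; rewrite -(zz f); exact: L2Mb zK h.
- by under eq_fun do rewrite mulr0; exact: L2s0 sM.
- by move=> f g Mf Mg; under eq_fun do rewrite mulrDr; exact: L2sD.
- move=> a f Mf; under eq_fun do rewrite mulrCA; exact: L2sZ.
move=> f [lf hf]; apply: (L2s_closed sM); split; first exact: L2Mb zK' lf.
move=> e /hf[g Mg fg]; exists (fun x => zpow (- 1) x * g x) => //.
rewrite (_ : (fun x => _) = fun x => zpow (- 1) x * (f x - g x)); last first.
  by apply/funext => x; ring.
by rewrite N2M1// => x; exact: cmod_zpow.
Qed.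

(** The part phi of m0 orthogonal to z M is a wandering vector: phi is orthogonal to z^(n+1) f for
    all f in M. For f = phi this kills all nonzero moments of |phi|^2, so |phi| is constant; for
    general f it says that phi^* f is in H^2. The converse inclusion follows from phi C[z] being
    contained in M and polynomials being dense in H^2. *)
Lemma not_doubly_invariantP M m0 : L2_subspace M -> zinvariant M -> M m0 ->
  ~ M (fun x => zpow (- 1) x * m0 x) ->
  exists2 phi : T -> C, unimodular phi &
    forall f, M f <-> cmeasurable f /\ H2 (fun x => (phi x)^* * f x).
Proof.
move=> sM zM Mm0 nM; have sK := L2s_shift sM; set K := [set f | _] in sK.
have KM f : K f -> M f.
  move=> /zM; rewrite (_ : (fun x => _) = f)//.
  by apply/funext => x; rewrite mulrA -[zcoord x]/(zpow 1 x) -zpowD mul1r.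
have zK f : M f -> K (fun x => zcoord x * f x).
  move=> Mf; rewrite /K /= (_ : (fun x => _) = f)//.
  by apply/funext => x; rewrite mulrA -[zcoord x]/(zpow 1 x) -zpowD mul1r.
have [k Kk ko] := L2_projection sK (L2s_sub sM Mm0).
have lm0 := L2s_sub sM Mm0.
set phi := fun x => m0 x - k x in ko.
have Mphi : M phi by apply: L2sB => //; exact: KM.
have lphi := L2s_sub sM Mphi; have [mphi rphi] := lphi.
have ko' n f : M f -> cintegral (fun x => (phi x)^* * f x * zpow n.+1 x) = 0.
  move=> Mf; have Mz := zinv_pow n zM Mf.
  have lz := L2s_sub sK (zK _ Mz).
  transitivity ((ip phi (fun x => zcoord x * (zpow n x * f x)))^*); last first.
    by rewrite ko ?conjC0//; exact: zK.
  rewrite /ip -cI_J; last by apply: L2M_cint => //; exact: L2J.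
  congr cintegral; apply/funext => x.
  by rewrite rmorphM /= conjCK zpow_nat exprS; rewrite !zpow_nat; ring.
have phi2 x : (phi x)^* * phi x = (cmod (phi x) ^+ 2)%:C by rewrite mulrC mulJ.
pose c := N2 phi.
have aec : {ae mu, forall x, cmod (phi x) ^+ 2 = c}.
  have cc : cintegrable (fun x => (cmod (phi x) ^+ 2)%:C).
    by under eq_fun do rewrite -phi2; apply: L2M_cint => //; exact: L2J.
  have h : cintegrable (fun x => (cmod (phi x) ^+ 2)%:C - c%:C).
    by apply: cintB => //; exact: cint_cst.
  have mpos (n : nat) : moment (fun x => (cmod (phi x) ^+ 2)%:C - c%:C) n.+1 = 0.
    rewrite momentB//; last exact: cint_cst.
    rewrite [X in X - _](_ : _ = 0); last first.
      rewrite -[RHS](ko' n phi Mphi); congr cintegral; apply/funext => x.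
      by rewrite phi2.
    rewrite sub0r; apply/eqP; rewrite oppr_eq0; apply/eqP.
    rewrite /moment cI_Z ?cintegral_zpow ?mulr0//; exact/Linfty_cint/Linfty_zpow.
  have := moment_unique h; move=> /(_ _)/filterS; apply.
    move=> x /subr0_eq/(congr1 (@complex.Re R)); exact.
  case=> [[|n]|n]; [|exact: mpos|].
    rewrite /moment; under eq_fun do rewrite zpow0 mulr1.
    by rewrite cI_B// ?cI_cst ?cI_real ?subrr//; exact: cint_cst.
  rewrite -[moment _ _]conjCK -[RHS]conjC0 -(mpos n); congr (_^*).
  rewrite /moment -cI_J; last exact: cintMz.
  congr cintegral; apply/funext => x; rewrite rmorphM /= zpowJ NegzE opprK.
  by rewrite -rmorphB conj_real.
(* If phi vanished, m0 would equal k, which lies in z M, against the choice of m0. *)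
have c0 : 0 < c.
  rewrite lt_neqAle N2_ge0 andbT eq_sym; apply/eqP => c00; apply: nM.
  apply: (L2s_ae sM Kk).
    by apply: cmeasurableM; [exact: cmeasurable_zpow|case: lm0].
  have := N2_eq0 lphi; rewrite -/c c00 => /(_ (lexx _)).
  by apply: filterS => x /subr0_eq ->.
pose s : R := (Num.sqrt c)^-1.
have s0 : 0 < s by rewrite invr_gt0 sqrtr_gt0.
have s2 : s ^+ 2 * c = 1 by rewrite exprVn sqr_sqrtr ?(ltW c0)// mulVf// gt_eqF.
pose psi x := s%:C * phi x.
have Mpsi : M psi by exact: L2sZ.
have psi1 : {ae mu, forall x, cmod (psi x) = 1}.
  apply: filterS aec => x h; apply/eqP; rewrite -(@eqrXn2 _ 2)// ?cmod_ge0//.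
  by rewrite cmodM cmod_real exprMn real_normK ?num_real// h s2 expr1n.
have mpsi : cmeasurable psi.
  by apply: cmeasurableM => //; exact: cmeasurable_cst.
have psiL : {ae mu, forall x, cmod (psi x) <= 1}.
  by apply: filterS psi1 => x ->.
have psiJL : {ae mu, forall x, cmod ((psi x)^*) <= 1}.
  by apply: filterS psi1 => x; rewrite cmodJ => ->.
exists psi; first by split => //; apply: filterS psi1 => x /cmod_norm1.
move=> f; split=> [Mf|[mf hf]].
  have lf := L2s_sub sM Mf; split; first by case: lf.
  split; first by apply: L2Mb psiJL lf; exact: cmeasurableJ.
  move=> n; rewrite /moment.
  rewrite (_ : (fun x => _) = fun x => s%:C * ((phi x)^* * f x * zpow n.+1 x)); last first.
    apply/funext => x; rewrite /psi rmorphM /=.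
    rewrite conj_real.
    by ring.
  rewrite cI_Z ?ko' ?mulr0//; apply: cintMz; apply: L2M_cint => //; exact: L2J.
have fE : {ae mu, forall x, psi x * ((psi x)^* * f x) = f x}.
  by apply: filterS psi1 => x h; rewrite mulrA mulJ h expr1n mul1r.
set u := fun x => (psi x)^* * f x in hf fE.
have [lu _] := hf.
have lpu : L2 (fun x => psi x * u x) by exact: L2Mb psiL lu.
apply: (L2s_ae sM _ mf fE).
apply: (L2s_closed sM); split => // e e0.
have : H2 u by []. 
rewrite H2E => -[_ /(_ _ e0)[_ [p _ <-] hp]].
exists (fun x => p.[zcoord x] * psi x); first exact: L2s_poly.
apply: le_lt_trans hp.
have := N2Mb mpsi psiL (L2B lu (Linfty_L2 (poly_Linfty p))).
rewrite expr1n mul1r; congr (_ <= _); congr N2; apply/funext => x.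
by rewrite mulrBr; congr (_ - _); exact: mulrC.
Qed.

Theorem beurling_helson M : L2_subspace M -> zinvariant M ->
  (exists2 phi : T -> C, unimodular phi &
    forall f, M f <-> cmeasurable f /\ H2 (fun x => (phi x)^* * f x)) \/
  (exists2 E : set T, measurable E &
    forall f, M f <-> L2 f /\ {ae mu, forall x, f x = cindic E x * f x}).
Proof.
move=> sM zM.
have [h|] := pselect (forall f, M f -> M (fun x => zpow (- 1) x * f x)); last first.
  by move/existsNP => [m0 /not_implyP[Mm0 nM]]; left; exact: not_doubly_invariantP Mm0 nM.
right; apply: doubly_invariantP => // -[n|n] f Mf; first exact: zinv_pow.
elim: n => [|n IH]; first exact: h.
have := h _ IH; congr M; apply/funext => x; rewrite mulrA -zpowD; congr (zpow _ x * _).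
Qed.

End L2_complete.

Lemma expR_lip (R : realType) (L a b : R) : a <= L -> b <= L ->
  `|expR a - expR b| <= expR L * `|a - b|.
Proof.
wlog ab : a b / b <= a.
  move=> h aL bL; have [|/ltW] := leP b a; first by move=> ?; exact: h.
  by move=> ?; rewrite distrC [`|a - b|]distrC; exact: h.
move=> aL bL; rewrite !ger0_norm ?subr_ge0 ?ler_expR//.
rewrite (_ : b = a + (b - a)); last by ring.
rewrite expRD (_ : expR a - _ = expR a * (1 - expR (b - a))); last by ring.
rewrite (_ : a - (a + (b - a)) = a - b); last by ring.
apply: (@le_trans _ _ (expR a * (a - b))).
  by rewrite ler_wpM2l ?expR_ge0//; have := expR_ge1Dx (b - a); lra.
by rewrite ler_wpM2r ?subr_ge0// ler_expR.
Qed.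

(** * Szego's theorem and outer functions *)

Section szego.
Variable R : realType.
Local Notation T := (circle R).
Local Notation C := (R[i]).
Local Notation mu := (arc_length R).
Implicit Types f g : T -> C.
Local Notation rint f := (mu.-integrable setT (fun x => (f x)%:E)).
Local Notation I f := (\int[mu]_x f x).
Local Notation L2 := (@sqr_integrable R).

Lemma rint_bndT (u : T -> R) (M : R) : measurable_fun setT u ->
  (forall x, `|u x| <= M) -> rint u.
Proof. by move=> mu_ uM; apply: (@rint_bnd _ _ _ _ _ M) => //; exact: aeW. Qed.

(** Cauchy-Schwarz for the probability density k: the kernel is split into two factors Num.sqrt k,
    one of which goes with f. *)
Lemma fejer_jensen N f x : (0 < N)%N -> L2 f ->
  cmod (fejer N f x) ^+ 2 <= Re (fejer N (fun y => (cmod (f y) ^+ 2)%:C) x).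
Proof.
move=> N0 lf; have cf := L2_cint lf; have [mf rf] := lf.
have cf2 : cintegrable (fun y => (cmod (f y) ^+ 2)%:C).
  by apply/cintP; split => //=; exact: rint_cst.
pose k y := Re (fejer_kernel N x y).
have kE y : fejer_kernel N x y = (k y)%:C by rewrite /k fejer_kernel_real.
have k0 y : 0 <= k y.
  by rewrite /k fejer_kernel_real /= mulr_ge0 ?invr_ge0 ?sqr_ge0.
have [[mk _] [L KL]] := fejer_kernel_trig N x.
have kL : {ae mu, forall y, k y <= L}.
  by apply: filterS KL => y; apply: le_trans; exact: Re_le.
pose s y := (Num.sqrt (k y))%:C.
have s2 y : cmod (s y) ^+ 2 = k y.
  by rewrite cmod_real real_normK ?num_real// sqr_sqrtr.
have ms : cmeasurable s.
  apply: cmeasurable_real; apply: (measurableT_comp _ mk).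
  by apply: continuous_measurable_fun; exact: sqrt_continuous.
have rk : rint k by have [_] := Linfty_cint (fejer_kernel_trig N x);
  under eq_fun do rewrite kE cmod_real ger0_norm//.
have ls : L2 s by split => //; under eq_fun do rewrite s2.
have lsf : L2 (fun y => s y * f y).
  apply: (L2_ae_le _ _ (rintZ L rf)); first exact: cmeasurableM.
  by apply: filterS kL => y h; rewrite cmodM exprMn s2 ler_wpM2r// sqr_ge0.
rewrite !fejerE//.
rewrite (_ : (fun y => f y * _) = fun y => s y * f y * s y); last first.
  apply/funext => y; rewrite kE -(sqr_sqrtr (k0 y)) expr2 rmorphM /= -/(s y); ring.
apply: le_trans (CS lsf ls) _.
have -> : N2 s = 1.
  rewrite /N2; under eq_Rintegral do rewrite s2.
  by rewrite -cI_Re fejer_kernel_int.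
rewrite mulr1 cI_Re le_eqVlt; apply/orP; left; apply/eqP.
apply: eq_Rintegral => y _.
by rewrite cmodM exprMn s2 kE -rmorphM /= mulrC.
Qed.

Lemma fejer_contract N f : (0 < N)%N -> L2 f -> N2 (fejer N f) <= N2 f.
Proof.
move=> N0 lf; have [mf rf] := lf.
pose F y : C := (cmod (f y) ^+ 2)%:C.
have cF : cintegrable (fejer N F) by exact/Linfty_cint/trig_Linfty/trig_fejer.
have [_ r1] := Linfty_L2 (trig_Linfty (trig_fejer N f)).
have -> : N2 f = I (fun x => Re (fejer N F x)).
  rewrite -cI_Re; have := moment_fejer F 0 N0.
  rewrite absz0 subn0 divff ?pnatr_eq0 -?lt0n// mul1r /moment.
  under eq_fun do rewrite zpow0 mulr1; move=> ->.
  by under eq_fun do rewrite zpow0 mulr1; rewrite cI_real.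
apply: I_le => //; first exact: cint_Re.
by move=> x; exact: fejer_jensen.
Qed.

(** Weak convergence plus contraction: writing F for the mean, N2 (f - F) = N2 F - 2 Re <f, F> + N2
    f <= 2 Re <f - F, f>, which is small when f^* is the test function. *)
Lemma fejer_L2_cvg f e : Linfty f -> 0 < e -> exists N0, forall N, (N0 < N)%N ->
  N2 (fun x => f x - fejer N f x) < e.
Proof.
move=> lf e0; have [mf [M fM]] := lf; have l2 := Linfty_L2 lf.
have cJ : cintegrable (fun x => (f x)^*) by apply: cintJ; exact: Linfty_cint.
have e2 : 0 < e / 2 by rewrite divr_gt0.
have [N0 hN] := fejer_weak mf fM cJ e2; exists N0 => N NN.
have Np : (0 < N)%N by apply: leq_ltn_trans NN.
have ls : L2 (fejer N f) by exact/Linfty_L2/trig_Linfty/trig_fejer.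
have := le_lt_trans (Re_le _) (hN N NN).
under eq_fun do rewrite mulrBl.
rewrite cI_B; [|apply: L2M_cint => //; exact: L2J|apply: L2M_cint => //; exact: L2J].
rewrite -[cintegral (fun x => f x * _)]/(ip f f) ip_norm cReD cReN cReC.
rewrite N2C N2_sub//; have := fejer_contract Np l2.
by set a := N2 _; set b := N2 _; set c := Re _; lra.
Qed.

Lemma fejer_real N (u : T -> R) x : rint u ->
  fejer N (fun y => (u y)%:C) x = (Re (fejer N (fun y => (u y)%:C) x))%:C.
Proof.
move=> ru; have cu : cintegrable (fun y => (u y)%:C).
  by apply/cintP; split => //=; exact: rint_cst.
rewrite fejerE// (_ : (fun y => _) = fun y => (u y * Re (fejer_kernel N x y))%:C).
  by rewrite cI_real.
by apply/funext => y; rewrite rmorphM /= fejer_kernel_real.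
Qed.

Lemma cintegral_poly (p : {poly C}) : cintegral (fun x : T => p.[zcoord x]) = p.[0].
Proof.
have c1 (i : nat) : cintegrable (fun x : T => p`_i * zpow i x).
  by apply: cintZ; exact/Linfty_cint/Linfty_zpow.
rewrite (_ : (fun x => _) = fun x : T => \sum_(i < size p) p`_i * zpow i x); last first.
  by apply/funext => x; rewrite horner_coef.
rewrite cI_sum// horner_coef; apply: eq_bigr => i _.
rewrite cI_Z; last exact/Linfty_cint/Linfty_zpow.
by rewrite cintegral_zpow expr0n eqz_nat.
Qed.

(** A term a z^-m has the same real part as a^* z^m, so negative frequencies are reflected to
    positive ones without touching the constant term. *)
Lemma trig_Re_poly t : trig t ->
  exists2 p : {poly C}, p.[0] = cintegral t & forall x, Re (t x) = Re p.[zcoord x].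
Proof.
elim=> [|a m t0 tt [p p0 pt]].
  by exists 0; [rewrite horner0 cI_cst|move=> x; rewrite horner0].
have E : cintegral (fun x => a * zpow m x + t0 x) = a * (m == 0)%:R + p.[0].
  rewrite cI_D ?cI_Z ?cintegral_zpow ?p0//.
  - exact/Linfty_cint/Linfty_zpow.
  - by apply: cintZ; exact/Linfty_cint/Linfty_zpow.
  - exact/Linfty_cint/trig_Linfty.
rewrite E; case: m E => m _.
  exists (a *: 'X^m + p).
    by rewrite hornerD hornerZ hornerXn expr0n eqz_nat.
  by move=> x; rewrite cReD pt hornerD hornerZ hornerXn cReD.
exists (a^* *: 'X^(m.+1) + p).
  by rewrite hornerD hornerZ hornerXn expr0n /= !mulr0.
move=> x; rewrite cReD pt hornerD hornerZ hornerXn cReD; congr (_ + _).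
by rewrite -zpow_nat -[LHS]cReJ rmorphM /= zpowJ NegzE opprK.
Qed.

Lemma poly_N2_ge (q : {poly C}) : q.[0] = 1 -> 1 <= N2 (fun x : T => q.[zcoord x]).
Proof.
move=> q0; have := CS (Linfty_L2 (poly_Linfty q)) (@L2_cst R 1).
under eq_fun do rewrite mulr1.
rewrite cintegral_poly q0 cmod1 expr1n (_ : N2 (fun=> 1) = 1) ?mulr1//.
by rewrite /N2; under eq_Rintegral do rewrite cmod1 expr1n; rewrite I_cst.
Qed.

(* The polynomials (1 + p/n)^n approximate exp p, and p(0) = 0 keeps the value
   of q (1 + p/n)^n at 0 equal to 1. *)
Lemma szego_poly (q p : {poly C}) : q.[0] = 1 -> p.[0] = 0 ->
  1 <= I (fun x => cmod q.[zcoord x] ^+ 2 * expR (2 * Re p.[zcoord x])).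
Proof.
move=> q0 p0.
have [mq [K qK]] := poly_Linfty q; have [mp [L pL]] := poly_Linfty p.
pose w x := cmod q.[zcoord x] ^+ 2 * expR (2 * Re p.[zcoord x]).
have mw : measurable_fun setT w.
  apply: measurable_funM; first exact: measurable_sqr_cmod.
  apply: (measurableT_comp (@measurable_expR R)).
  by apply: measurable_funM; [exact: measurable_cst|exact: mp.1].
have w0 x : 0 <= w x by rewrite mulr_ge0 ?sqr_ge0 ?expR_ge0.
have rw : rint w.
  apply: (@rint_bnd _ _ _ _ _ (K ^+ 2 * expR (2 * L))) => //.
  have := ae_and qK pL; apply: filterS => x [h1 h2]; rewrite ger0_norm//.
  apply: ler_pM; rewrite ?sqr_ge0 ?expR_ge0//.
    by rewrite lerXn2r// nnegrE ?(le_trans _ h1) ?cmod_ge0.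
  by rewrite ler_expR ler_wpM2l// (le_trans (Re_le _)).
apply/ler_addgt0Pl => e e0.
pose X := I w; have X0 : 0 <= X by exact: I_ge0.
have key (n : nat) : 1 <= expR (L ^+ 2 / n.+1%:R) * X.
  have n0 : n.+1%:R != 0 :> C by rewrite pnatr_eq0.
  pose P := q * (1 + n.+1%:R^-1 *: p) ^+ n.+1.
  have P0 : P.[0] = 1.
    by rewrite /P hornerM horner_exp hornerD hornerZ p0 q0 mulr0 addr0 hornerC expr1n mulr1.
  apply: le_trans (poly_N2_ge P0) _.
  rewrite -I_Z//; apply: I_le_ae.
  - by have [] := Linfty_L2 (poly_Linfty P).
  - exact: rintZ.
  apply: filterS pL => x h.
  rewrite /P hornerM horner_exp hornerD hornerZ hornerC cmodM cmodX exprMn.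
  rewrite mulrC /w [leRHS]mulrCA [leLHS]mulrC ler_wpM2l ?sqr_ge0//.
  set z := p.[_] in h *.
  have -> : (n.+1%:R^-1 : C) = (n.+1%:R^-1)%:C by rewrite fmorphV rmorph_nat.
  rewrite exprAC -expRD.
  set m := n.+1%:R^-1 : R; have m0 : 0 < m by rewrite invr_gt0.
  (* The left side is 1 + 2 m Re z + m^2 |z|^2, and 1 + y <= exp y. The power n + 1 then leaves exp
     (2 Re z) and the error factor exp (L^2 / (n + 1)). *)
  have : cmod (1 + m%:C * z) ^+ 2 <= expR (2 * m * Re z + m ^+ 2 * L ^+ 2).
    apply: le_trans (expR_ge1Dx _).
    have : cmod z ^+ 2 <= L ^+ 2.
      by rewrite lerXn2r// nnegrE ?(le_trans _ h) ?cmod_ge0.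
    rewrite !sqr_cmod !cpart; have := sqr_ge0 m.
    move: (Re z) (Im z) => a b; nra.
  move=> h1.
  have : (cmod (1 + m%:C * z) ^+ 2) ^+ n.+1 <=
      expR (2 * m * Re z + m ^+ 2 * L ^+ 2) ^+ n.+1.
    by rewrite lerXn2r// nnegrE ?sqr_ge0 ?expR_ge0.
  move=> h2; apply: le_trans h2 _; rewrite -expRM_natl ler_expR.
  rewrite le_eqVlt; apply/orP; left; apply/eqP.
  have mn : n.+1%:R * m = 1 by rewrite divff// pnatr_eq0.
  rewrite (_ : n.+1%:R * _ = (n.+1%:R * m) * (2 * Re z + m * L ^+ 2)); last by ring.
  by rewrite mn; ring.
(* Makes L^2 / (n + 1) <= e, so that 1 - e <= exp (- L^2 / (n + 1)) <= X. *)
pose n := Num.truncn (L ^+ 2 / e).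
have {}key := key n.
have small : L ^+ 2 / n.+1%:R <= e.
  rewrite ler_pdivrMr// mulrC -ler_pdivrMr//; exact/ltW/truncnS_gt.
have : expR (- (L ^+ 2 / n.+1%:R)) <= X.
  by rewrite expRN -[leLHS]mulr1 ler_pdivrMl ?expR_gt0.
have := expR_ge1Dx (- (L ^+ 2 / n.+1%:R)).
move=> h1 h2; rewrite -lerBlDl; apply: le_trans (le_trans h1 h2).
by rewrite lerD2l lerN2.
Qed.


(** After subtraction of its mean, u is replaced by a Fejer mean, which is Re p with p(0) = 0 and
    keeps the bound L; the exponential is Lipschitz below that bound, so closeness in mean
    suffices. *)
Lemma szego_bounded (q : {poly C}) (u : T -> R) (m : R) : q.[0] = 1 ->
  measurable_fun setT u -> (forall x, `|u x| <= m) ->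
  expR (2 * I u) <= I (fun x => cmod q.[zcoord x] ^+ 2 * expR (2 * u x)).
Proof.
move=> q0 mu_ um.
have ru := rint_bndT mu_ um.
have [mq [K qK]] := poly_Linfty q.
pose c := I u; pose v x := u x - c; pose L := m + `|c|.
have vL x : `|v x| <= L by apply: le_trans (ler_normB _ _) _; rewrite lerD2r.
have mv : measurable_fun setT v.
  by apply: measurable_funB => //; exact: measurable_cst.
have rv := rint_bndT mv vL.
have Iv : I v = 0 by rewrite /v I_B// ?I_cst ?subrr//; exact: rint_cst.
have lv : Linfty (fun x => (v x)%:C).
  by split; [exact: cmeasurable_real|exists L; apply: aeW => x; rewrite cmod_real].
have wE (w : T -> R) (M : R) : measurable_fun setT w -> (forall x, w x <= M) ->
    rint (fun x => cmod q.[zcoord x] ^+ 2 * expR (2 * w x)).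
  move=> mw wM; apply: (@rint_bnd _ _ _ _ _ (K ^+ 2 * expR (2 * M))).
    apply: measurable_funM; first exact: measurable_sqr_cmod.
    apply: (measurableT_comp (@measurable_expR R)).
    by apply: measurable_funM => //; exact: measurable_cst.
  apply: filterS qK => x h1; rewrite ger0_norm; last first.
    by apply: mulr_ge0; [exact: sqr_ge0|exact: expR_ge0].
  apply: ler_pM; rewrite ?sqr_ge0 ?expR_ge0//.
    by rewrite lerXn2r// nnegrE ?(le_trans _ h1) ?cmod_ge0.
  by rewrite ler_expR ler_wpM2l.
have rw := wE _ _ mv (fun x => le_trans (ler_norm _) (vL x)).
suff h : 1 <= I (fun x => cmod q.[zcoord x] ^+ 2 * expR (2 * v x)).
  have -> : I (fun x => cmod q.[zcoord x] ^+ 2 * expR (2 * u x)) =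
      expR (2 * c) * I (fun x => cmod q.[zcoord x] ^+ 2 * expR (2 * v x)).
    rewrite -I_Z//; apply: eq_Rintegral => x _; rewrite mulrCA -expRD.
    by congr (_ * expR _); rewrite /v; ring.
  by rewrite -[leLHS]mulr1 ler_wpM2l// expR_ge0.
apply/ler_addgt0Pl => e e0.
have D0 : 0 < K ^+ 2 * (2 * expR (2 * L)) + 1.
  by rewrite ltr_wpDl// mulr_ge0 ?sqr_ge0// mulr_ge0// expR_ge0.
(* K^2 * 2 exp (2 L) bounds the change of the integral per unit of mean distance between the
   exponents; the 1 keeps the denominator positive. *)
pose d := e / (K ^+ 2 * (2 * expR (2 * L)) + 1).
have d0 : 0 < d by rewrite divr_gt0.
have [N0 /(_ N0.+1 (ltnSn _)) hN] := fejer_L2_cvg lv (exprn_gt0 2 d0).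
pose tau x := Re (fejer N0.+1 (fun y => (v y)%:C) x).
have tt := trig_fejer N0.+1 (fun y => (v y)%:C).
have lt := trig_Linfty tt.
have tauE x : fejer N0.+1 (fun y => (v y)%:C) x = (tau x)%:C by exact: fejer_real.
have tauL x : `|tau x| <= L.
  rewrite -cmod_real -tauE; apply: (cmod_fejer_le _ _ lv.1) => //.
  by apply: aeW => y; rewrite cmod_real.
have mtau : measurable_fun setT tau by case: lt => -[].
have rtau := rint_bndT mtau tauL.
have rwt := wE _ _ mtau (fun x => le_trans (ler_norm _) (tauL x)).
have vt : I (fun x => `|v x - tau x|) < d.
  have h0 : 0 <= I (fun x => `|v x - tau x|) by exact: I_ge0.
  rewrite -(ltr_pXn2r (_ : (0 < 2)%N)) ?nnegrE ?(ltW d0)//.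
  apply: le_lt_trans hN.
  apply: le_trans (I_cmod_N2 (L2B (Linfty_L2 lv) (Linfty_L2 lt))).
  rewrite le_eqVlt; apply/orP; left; apply/eqP; congr (_ ^+ 2).
  by apply: eq_Rintegral => x _; rewrite tauE -rmorphB cmod_real.
have t1 : 1 <= I (fun x => cmod q.[zcoord x] ^+ 2 * expR (2 * tau x)).
  have [p p0 pt] := trig_Re_poly tt.
  have {}p0 : p.[0] = 0.
    rewrite p0; have := moment_fejer (fun y => (v y)%:C) 0 (ltn0Sn N0).
    rewrite /moment; under eq_fun do rewrite zpow0 mulr1; move=> ->.
    under eq_fun do rewrite zpow0 mulr1.
    by rewrite cI_real Iv mulr0.
  apply: le_trans (szego_poly q0 p0) _; rewrite le_eqVlt; apply/orP; left; apply/eqP.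
  by apply: eq_Rintegral => x _; rewrite -pt.
apply: le_trans t1 _; rewrite -lerBlDr.
have rD := rintB rwt rw; rewrite -I_B//.
have dE : (K ^+ 2 * (2 * expR (2 * L))) * d <= e.
  by rewrite /d mulrCA ler_piMr ?(ltW e0)// ler_pdivrMr// mul1r lerDl.
apply: le_trans dE.
apply: (@le_trans _ _ ((K ^+ 2 * (2 * expR (2 * L))) * I (fun x => `|v x - tau x|))).
  have rd : rint (fun x => `|v x - tau x|) by apply: rint_norm; exact: rintB.
  rewrite -I_Z//; apply: I_le_ae => //; first exact: rintZ.
  apply: filterS qK => x h1; rewrite -mulrBr -mulrA.
  have h2 : cmod q.[zcoord x] ^+ 2 <= K ^+ 2.
    by rewrite lerXn2r// nnegrE ?(le_trans _ h1) ?cmod_ge0.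
  have h3 : expR (2 * tau x) - expR (2 * v x) <= 2 * expR (2 * L) * `|v x - tau x|.
    apply: le_trans (ler_norm _) _.
    have := @expR_lip R (2 * L) (2 * tau x) (2 * v x).
    rewrite !ler_pM2l// => /(_ (le_trans (ler_norm _) (tauL x)))
      /(_ (le_trans (ler_norm _) (vL x))) h; apply: le_trans h _.
    by rewrite -mulrBr normrM ger0_norm// distrC mulrCA mulrA.
  apply: (@le_trans _ _ (cmod q.[zcoord x] ^+ 2 * (2 * expR (2 * L) * `|v x - tau x|))).
    by rewrite ler_wpM2l ?sqr_ge0.
  by rewrite ler_wpM2r// mulr_ge0// mulr_ge0// expR_ge0.
by rewrite ler_wpM2l ?(ltW vt)// mulr_ge0 ?sqr_ge0// mulr_ge0// expR_ge0.
Qed.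

Lemma L2_expR (u : T -> R) f : measurable_fun setT u -> (forall x, u x <= 0) ->
  L2 f -> L2 (fun x => (expR (u x))%:C * f x).
Proof.
move=> mu_ u0; apply: (@L2Mb _ 1).
  apply: cmeasurable_real; exact: (measurableT_comp (@measurable_expR R)).
apply: aeW => x; rewrite cmod_real ger0_norm ?expR_ge0// -expR0 ler_expR//.
Qed.

(** u is cut off below at -n: this raises the left side, and costs at most Q exp (-2 n) on the right
    because exp (2 max(u, -n)) <= exp (2 u) + exp (-2 n). *)
Lemma szego (q : {poly C}) (u : T -> R) : q.[0] = 1 -> (forall x, u x <= 0) ->
  rint u -> expR (2 * I u) <= N2 (fun x => (expR (u x))%:C * q.[zcoord x]).
Proof.
move=> q0 u0 ru; have mu_ := rint_meas ru.
have lq := Linfty_L2 (poly_Linfty q); have [_ rq] := lq.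
have lkq := L2_expR mu_ u0 lq; have [_ rkq] := lkq.
apply/ler_addgt0Pl => e e0.
pose Q := N2 (fun x : T => q.[zcoord x]).
have Q0 : 0 <= Q by exact: N2_ge0.
have [n hn] : exists n : nat, Q * expR (- (2 * n%:R)) <= e.
  pose n := (Num.truncn (Q / e)).+1; exists n.
  have h : Q / e < n%:R by exact: truncnS_gt.
  rewrite ltr_pdivrMr// in h.
  rewrite expRN ler_pdivrMr ?expR_gt0//.
  have h1 := ler_wpM2l (ltW e0) (@expR_ge1Dx R (2 * n%:R)).
  have h2 : 0 <= n%:R * e by rewrite mulr_ge0// ltW.
  apply: le_trans (ltW h) (le_trans _ h1).
  by rewrite mulrDr mulr1 mulrCA [e * _]mulrC ler_wpDl ?(ltW e0)// ler_peMl// ler1n.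
pose v x := Num.max (u x) (- n%:R).
have mv : measurable_fun setT v.
  by apply: measurable_maxr => //; exact: measurable_cst.
have vn x : `|v x| <= n%:R.
  rewrite ler_norml /v le_max lexx orbT /= ge_max (le_trans (u0 x))//=.
  by rewrite (le_trans _ (ler0n _ _))// oppr_le0.
have rv := rint_bndT mv vn.
have uv : I u <= I v by apply: I_le => // x; rewrite /v le_max lexx.
apply: (@le_trans _ _ (expR (2 * I v))); first by rewrite ler_expR ler_wpM2l.
apply: le_trans (szego_bounded q0 mv vn) _.
apply: le_trans (lerD hn (lexx _)).
rewrite mulrC -I_Z// -I_D//; last exact: rintZ.
apply: I_le.
- have [mq [K qK]] := poly_Linfty q.
  apply: (@rint_bnd _ _ _ _ _ (K ^+ 2 * expR (2 * n%:R))).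
    apply: measurable_funM; first exact: measurable_sqr_cmod.
    apply: (measurableT_comp (@measurable_expR R)).
    by apply: measurable_funM => //; exact: measurable_cst.
  apply: filterS qK => x h1; rewrite ger0_norm; last first.
    by apply: mulr_ge0; [exact: sqr_ge0|exact: expR_ge0].
  apply: ler_pM; rewrite ?sqr_ge0 ?expR_ge0//.
    by rewrite lerXn2r// nnegrE ?(le_trans _ h1) ?cmod_ge0.
  by rewrite ler_expR ler_wpM2l// (le_trans (ler_norm _)).
- by apply: rintD => //; exact: rintZ.
move=> x; rewrite cmodM exprMn cmod_real real_normK ?num_real// -expRM_natl.
rewrite -mulrDl mulrC ler_wpM2r ?sqr_ge0// /v.
have e1 := expR_ge0 (- (2 * n%:R) : R); have e2 := expR_ge0 (2 * u x).
have [h|h] := leP (u x) (- n%:R); last by rewrite lerDr.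
by rewrite mulrN lerDl.
Qed.


(** Unlike in [N2D], the factor of N2 f can be brought close to 1; the sharp lower bound on the mean
    of an outer function needs this. *)
Lemma N2D_weighted f g (t : R) : 0 < t -> L2 f -> L2 g ->
  N2 (fun x => f x + g x) <= (1 + t) * N2 f + (1 + t^-1) * N2 g.
Proof.
move=> t0 lf lg; have [mf rf] := lf; have [mg rg] := lg.
rewrite -!I_Z// -I_D; [|exact: rintZ|exact: rintZ].
apply: I_le; [by have [] := L2D lf lg|by apply: rintD; exact: rintZ|].
move=> x; rewrite !sqr_cmod !cpart.
set a := Re _; set b := Re _; set c := Im _; set d := Im _.
rewrite -subr_ge0 [X in 0 <= X](_ : _ =
  t^-1 * ((t * a - b) ^+ 2 + (t * c - d) ^+ 2)).
  by rewrite mulr_ge0 ?invr_ge0 ?(ltW t0)// addr_ge0// sqr_ge0.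
by field; rewrite gt_eqF.
Qed.

Lemma H2_ae f g : cmeasurable g -> {ae mu, forall x, f x = g x} -> H2 f -> H2 g.
Proof.
move=> mg fg [lf f0]; split; first exact: L2_ae fg lf.
move=> n; rewrite -(f0 n); apply: cI_ae.
- by apply: cmeasurableM => //; exact: cmeasurable_zpow.
- by apply: cmeasurableM; [case: lf|exact: cmeasurable_zpow].
by apply: filterS fg => x ->.
Qed.

(** * Outer functions with prescribed modulus *)

Section outer.
Variable u : T -> R.
Hypotheses (u0 : forall x, u x <= 0) (ru : rint u).

Let k x : C := (expR (u x))%:C.
Let S : set (T -> C) := [set (fun x => k x * p.[zcoord x]) | p in [set: {poly C}]].
Let M := L2_adherent S.

Let mu_ : measurable_fun setT u := rint_meas ru.

Let mk : cmeasurable k.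
Proof. by apply: cmeasurable_real; exact: (measurableT_comp (@measurable_expR R)). Qed.

Let cmod_k x : cmod (k x) = expR (u x).
Proof. by rewrite cmod_real ger0_norm ?expR_ge0. Qed.

Let k1 x : cmod (k x) <= 1.
Proof. by rewrite cmod_k -expR0 ler_expR. Qed.

Let SL : S `<=` L2.
Proof.
by move=> _ [p _ <-]; apply: L2_expR => //; exact/Linfty_L2/poly_Linfty.
Qed.

Let sM : L2_subspace M.
Proof.
split.
- by move=> f [].
- by apply: (sub_L2_adherent SL); exists 0 => //; apply/funext => x; rewrite horner0 mulr0.
- move=> f g; apply: L2_adherentD => //.
  move=> _ _ [p _ <-] [q _ <-]; exists (p + q) => //.
  by apply/funext => x; rewrite hornerD mulrDr.
- move=> a f; apply: L2_adherentZ => // _ [p _ <-]; exists (a *: p) => //.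
  by apply/funext => x; rewrite hornerZ mulrCA.
apply: L2_adherent_trans => //; exact: SL.
Qed.

Let zM : zinvariant M.
Proof.
move=> f; apply: (@L2_adherentMb _ S 1) => //.
- exact: cmeasurable_zcoord.
- by apply: aeW => x; rewrite cmod_zcoord.
move=> _ [p _ <-]; exists ('X * p) => //.
by apply/funext => x; rewrite hornerM hornerX mulrCA.
Qed.

Let Mk : M k.
Proof.
apply: (sub_L2_adherent SL); exists 1 => //.
by apply/funext => x; rewrite hornerC mulr1.
Qed.

(* If k lay in the closure of z k C[z], it would violate Szego's bound. *)
Let not_shift : ~ M (fun x => zpow (- 1) x * k x).
Proof.
move=> [_ /(_ _ (expR_gt0 (2 * I u)))[_ [p _ <-]]].
have q0 : (1 - 'X * p).[0] = 1 by rewrite hornerD hornerN hornerM hornerX hornerC mul0r subr0.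
rewrite ltNge => /negP; apply; apply: le_trans (szego q0 u0 ru) _.
rewrite le_eqVlt; apply/orP; left; apply/eqP.
apply: eq_Rintegral => x _; congr (_ ^+ 2).
rewrite -[RHS]mul1r -(cmod_zcoord x) -cmodM; congr cmod.
rewrite mulrBr mulrA -[zcoord x]/(zpow 1 x) -zpowD mul1r.
by rewrite hornerD hornerN hornerM hornerX hornerC /zpow expr1z; ring.
Qed.

(** The form chi_E L^2 is stable under division by z, which [not_shift] forbids; so the closure M of
    k C[z] is phi H^2, and h is phi^* k rotated by a constant. The last clause is cyclicity, the
    form in which outerness is used; the third is the sharp mean value bound. *)
Lemma outer_exists : exists h : T -> C, [/\ Hinfty h,
  {ae mu, forall x, cmod (h x) = expR (u x)},
  expR (I u) <= Re (cintegral h) &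
  forall e, 0 < e -> exists p : {poly C}, N2 (fun x => h x * p.[zcoord x] - 1) < e].
Proof.
have [[phi [mphi phi1] Mphi]|[E mE ME]] := beurling_helson sM zM; last first.
  exfalso; apply: not_shift; have [lk kE] := (ME k).1 Mk.
  apply/ME; split.
    have [mz [K zK]] := Linfty_zpow R (- 1); exact: L2Mb zK lk.
  by apply: filterS kE => x {1}->; rewrite mulrCA.
have phi1' : {ae mu, forall x, cmod (phi x) = 1}.
  by apply: filterS phi1 => x /cmod_norm1.
have phiL : {ae mu, forall x, cmod (phi x) <= 1} by apply: filterS phi1' => x ->.
have phiJL : {ae mu, forall x, cmod ((phi x)^*) <= 1}.
  by apply: filterS phiL => x; rewrite cmodJ.
have phiK : {ae mu, forall x, (phi x)^* * phi x = 1}.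
  by apply: filterS phi1' => x; exact: cmod1_invJ.
have mphiJ := cmeasurableJ mphi.
pose h0 x := (phi x)^* * k x.
have mh0 : cmeasurable h0 by exact: cmeasurableM.
have h0k : {ae mu, forall x, cmod (h0 x) = expR (u x)}.
  by apply: filterS phi1' => x; rewrite cmodM cmodJ => ->; rewrite mul1r.
have h0L : Linfty h0.
  split => //; exists 1; apply: filterS h0k => x ->.
  by rewrite -expR0 ler_expR.
have [_ Hh0] := (Mphi k).1 Mk; have [lh0 h00] := Hh0.
pose a := cintegral h0.
have am : moment h0 0 = a by rewrite /moment; under eq_fun do rewrite zpow0 mulr1.
have la := @L2_cst R a.
have lha := L2B lh0 la.
have [mz [K zK]] := Linfty_zpow R (- 1).
(* Removing the mean makes h0 divisible by z within H^2; then z phi g = k - phi a, and phi g can be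
   approximated by k p. *)
pose g x := zpow (- 1) x * (h0 x - a).
have lg : L2 g by exact: L2Mb zK lha.
have Hg : H2 g.
  split => // n; have -> : moment g n.+1 = moment (fun x => h0 x - a) n.
    congr cintegral; apply/funext => x; rewrite /g mulrAC mulrC -zpowD.
    by congr (_ * zpow _ x); lia.
  rewrite momentB; [|exact: L2_cint|exact: cint_cst].
  have ma m : moment (fun=> a) m = a * (m == 0)%:R.
    by rewrite /moment cI_Z ?cintegral_zpow//; exact/Linfty_cint/Linfty_zpow.
  by case: n => [|n]; rewrite ma ?am ?mulr1 ?subrr// h00 mulr0 subr0.
have Mf : M (fun x => phi x * g x).
  apply/Mphi; split; first by apply: cmeasurableM => //; case: lg.
  apply: (H2_ae _ _ Hg).
    by apply: cmeasurableM => //; apply: cmeasurableM => //; case: lg.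
  by apply: filterS phiK => x; rewrite mulrA => ->; rewrite mul1r.
have lphi : L2 phi by apply: Linfty_L2; split => //; exists 1.
have N2phi (c : C) : N2 (fun x => phi x * c) = cmod c ^+ 2.
  rewrite /N2 -[RHS](I_cst mu); apply: I_ae.
  - apply: measurable_sqr_cmod; apply: cmeasurableM => //; exact: cmeasurable_cst.
  - exact: measurable_cst.
  by apply: filterS phi1' => x; rewrite cmodM => ->; rewrite mul1r.
(* k (1 - z p) = phi a + r, where r = z (phi g - k p) is small. Szego bounds the left side below,
   and the weight t is chosen so that the two error terms are at most e / 2 each. *)
have aB : expR (2 * I u) <= cmod a ^+ 2.
  apply/ler_addgt0Pl => e e0.
  pose t := e / (2 * (cmod a ^+ 2 + 1)).
  have a1 : 0 < cmod a ^+ 2 + 1 by rewrite ltr_wpDl ?sqr_ge0.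
  have t0 : 0 < t by rewrite divr_gt0// mulr_gt0.
  have ta : t * cmod a ^+ 2 <= e / 2.
    rewrite /t mulrAC ler_pdivrMr ?mulr_gt0//.
    rewrite (_ : e / 2 * _ = e * (cmod a ^+ 2 + 1)); last by field.
    by rewrite ler_wpM2l ?(ltW e0)// lerDl.
  have t1 : 0 < 1 + t^-1 by rewrite ltr_wpDr// invr_ge0 ltW.
  have e2 : 0 < e / 2 by rewrite divr_gt0.
  have [_ /(_ _ (divr_gt0 e2 t1))[_ [p _ <-]]] := Mf.
  rewrite ltr_pdivlMr// mulrC => hp.
  have q0 : (1 - 'X * p).[0] = 1 by rewrite hornerD hornerN hornerM hornerX hornerC mul0r subr0.
  pose r x := zcoord x * (phi x * g x - k x * p.[zcoord x]).
  have lr : L2 r.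
    apply: (@L2Mb _ 1); [exact: cmeasurable_zcoord|by apply: aeW => x; rewrite cmod_zcoord|].
    by apply: L2B; [case: Mf|apply: SL; exists p].
  have lpa : L2 (fun x => phi x * a).
    apply: (L2Mb mphi phiL); exact: L2_cst.
  apply: le_trans (szego q0 u0 ru) _.
  rewrite (N2_ae (g := fun x => phi x * a + r x)).
  - apply: le_trans (N2D_weighted t0 lpa lr) _.
    rewrite N2phi N2M1; last by move=> x; exact: cmod_zcoord.
    have := lerD ta (ltW hp); rewrite -splitr => h.
    by rewrite mulrDl mul1r -addrA addrC lerD2r.
  - by apply: cmeasurableM => //; case: (poly_Linfty (1 - 'X * p)).
  - by apply: cmeasurableD; [case: lpa|case: lr].
  apply: filterS phiK => x h; rewrite /r /g /h0.
  rewrite hornerD hornerN hornerM hornerX hornerC.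
  have zy : zcoord x * zpow (- 1) x = 1.
    by rewrite -{1}[zcoord x]/(zpow 1 x) -zpowD.
  transitivity (phi x * a + (zcoord x * zpow (- 1) x) *
      ((phi x)^* * phi x * k x - phi x * a) - zcoord x * (k x * p.[zcoord x])).
    by rewrite zy h /k; ring.
  by ring.
have a0 : 0 < cmod a.
  rewrite lt_neqAle cmod_ge0 andbT eq_sym; apply/eqP => a00.
  by move: aB; rewrite a00 expr0n leNgt expR_gt0.
(* The rotation that makes the mean of h real and positive. *)
have [c c1 ca] : exists2 c : C, cmod c = 1 & c * a = (cmod a)%:C.
  exists (a^* * ((cmod a)^-1)%:C).
    rewrite cmodM cmodJ cmod_real ger0_norm ?invr_ge0 ?cmod_ge0// divff//.
    by rewrite gt_eqF.
  by rewrite mulrAC [a^* * a]mulrC mulJ -rmorphM /= expr2 mulfK// gt_eqF.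
have cc : c^* * c = 1 by exact: cmod1_invJ.
exists (fun x => c * h0 x); split.
- apply/HinftyP; split.
    split; first by apply: cmeasurableM => //; exact: cmeasurable_cst.
    by have [_ [L hL]] := h0L; exists L; apply: filterS hL => x; rewrite (cmodM c) c1 mul1r.
  move=> n; rewrite /moment; under eq_fun do rewrite -mulrA.
  by rewrite cI_Z; [rewrite -/(moment h0 _) h00 mulr0|apply: cintMz; exact: L2_cint].
- by apply: filterS h0k => x; rewrite (cmodM c) c1 mul1r.
- rewrite cI_Z; last exact: L2_cint.
  rewrite -/a ca.
  rewrite cReC -(ler_pXn2r (_ : (0 < 2)%N)) ?nnegrE ?expR_ge0 ?cmod_ge0//.
  by rewrite -expRM_natl.
move=> e e0.
(* phi corresponds to the constant 1 of H^2; approximating it by k p and multiplying by the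
   conjugate of phi gives cyclicity. *)
have Mp : M phi.
  apply/Mphi; split => //; apply: (@H2_ae (fun=> 1)).
  - exact: cmeasurableM.
  - by apply: filterS phiK => x ->.
  apply: Hinfty_H2; apply: poly_Hinfty; exists 1 => //.
  by apply/funext => x; rewrite hornerC.
have [_ /(_ _ e0)[_ [p _ <-] hp]] := Mp; exists (c^* *: p).
apply: le_lt_trans hp.
have lpk : L2 (fun x => phi x - k x * p.[zcoord x]).
  by apply: L2B => //; apply: SL; exists p.
have := N2Mb mphiJ phiJL lpk; rewrite expr1n mul1r; apply: le_trans.
rewrite -N2N le_eqVlt; apply/orP; left; apply/eqP; apply: N2_ae.
- apply: cmeasurableN; apply: cmeasurableB; last exact: cmeasurable_cst.
  apply: cmeasurableM; last by case: (poly_Linfty (c^* *: p)).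
  by apply: cmeasurableM => //; exact: cmeasurable_cst.
- by apply: cmeasurableM => //; case: lpk.
apply: filterS phiK => x h; rewrite mulrBr h hornerZ.
rewrite (_ : c * h0 x * (c^* * _) = c^* * c * (h0 x * p.[zcoord x])); last by ring.
by rewrite cc /h0; ring.
Qed.

(** The squared distance is N2 h - 2 Re int h + 1 <= 2 - 2 exp (I u) <= -2 I u, by |h| <= 1, the
    mean value bound and exp y >= 1 + y. *)
Lemma outer_near1 : exists h : T -> C, [/\ Hinfty h,
  {ae mu, forall x, cmod (h x) = expR (u x)} &
  N2 (fun x => h x - 1) <= - (2 * I u)].
Proof.
have [h [Hh hk hI _]] := outer_exists; exists h; split => //.
have lh : L2 h by have [] := Hinfty_H2 Hh.
rewrite N2_sub//; last exact: L2_cst.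
under eq_fun do rewrite conjC1 mulr1.
have -> : N2 (fun _ : T => 1) = 1.
  by rewrite /N2; under eq_Rintegral do rewrite cmod1 expr1n; rewrite I_cst.
have h1 : N2 h <= 1.
  rewrite -[leRHS](I_cst mu); apply: I_le_ae; [by case: lh|exact: rint_cst|].
  apply: filterS hk => x ->; rewrite -expRM_natl -expR0 ler_expR.
  by rewrite mulr_ge0_le0.
have h2 := le_trans (@expR_ge1Dx R (I u)) hI.
move: h1 h2; set a := N2 h; set b := Re _; move: a b (I u) => a b c; lra.
Qed.

End outer.

End szego.

(** * Gauge norms *)

Section Linfty_algebra.
Variable R : realType.
Local Notation T := (circle R).
Local Notation C := (R[i]).
Local Notation mu := (arc_length R).
Implicit Types f g b : T -> C.

Lemma LinftyD f g : Linfty f -> Linfty g -> Linfty (fun x => f x + g x).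
Proof.
move=> [mf [M fM]] [mg [N gN]]; split; first exact: cmeasurableD.
exists (M + N); apply: ae_imp (ae_and fM gN) => x [h1 h2].
by rewrite (le_trans (cmodD _ _))// lerD.
Qed.

Lemma Linfty_bnd f (M : R) : cmeasurable f -> (forall x, cmod (f x) <= M) -> Linfty f.
Proof. by move=> mf fM; split => //; exists M; apply: aeW. Qed.

Lemma Linfty_cst (a : C) : Linfty (fun _ : T => a).
Proof. by apply: (@Linfty_bnd _ (cmod a)) => //; exact: cmeasurable_cst. Qed.

Lemma LinftyZ (a : C) f : Linfty f -> Linfty (fun x => a * f x).
Proof. exact/LinftyM/Linfty_cst. Qed.

Lemma LinftyN f : Linfty f -> Linfty (fun x => - f x).
Proof.
move=> lf; rewrite (_ : (fun x => - f x) = fun x => -1 * f x); first exact: LinftyZ.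
by apply/funext => x; rewrite mulN1r.
Qed.

Lemma LinftyB f g : Linfty f -> Linfty g -> Linfty (fun x => f x - g x).
Proof. by move=> lf lg; apply: LinftyD => //; exact: LinftyN. Qed.

Lemma Linfty_norm f : Linfty f -> Linfty (fun x => (cmod (f x))%:C).
Proof.
move=> [mf [M fM]]; split.
  by apply: cmeasurable_real; exact: measurable_cmod.
by exists M; apply: ae_imp fM => x h; rewrite cmod_real ger0_norm ?cmod_ge0.
Qed.

Lemma cmod_indic_le (E : set T) x : cmod (cindic E x) <= 1.
Proof.
by rewrite cmod_real indicE ger0_norm ?ler0n// lern1 leq_b1.
Qed.

Lemma Linfty_indic (E : set T) : measurable E -> Linfty (cindic E).
Proof. by move=> mE; apply: Linfty_bnd (cmod_indic_le E); exact: cmeasurable_indic. Qed.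

Lemma nnsfun_Linfty (s : {nnsfun T >-> R}) : Linfty (fun x => (s x)%:C).
Proof.
have [M [_ hM]] := simple_bounded s.
apply: (@Linfty_bnd _ (M + 1)); first exact: cmeasurable_real.
by move=> x; rewrite cmod_real; apply: hM => //; rewrite ltrDl.
Qed.

End Linfty_algebra.

Section gauge_extension.
Variable R : realType.
Local Notation T := (circle R).
Local Notation C := (R[i]).
Local Notation mu := (arc_length R).
Variable alpha : (T -> C) -> R.
Hypothesis alpha_gauge : normalized_gauge_norm alpha.
Implicit Types f g b : T -> C.
Local Notation G := (gauge_ext alpha).

Lemma alpha_modulus f : Linfty f -> alpha (fun x => (cmod (f x))%:C) = alpha f.
Proof.
move=> lf; rewrite -(gauge_norm alpha_gauge lf); congr alpha.
Qed.

Lemma alpha_unit (v : T -> C) f : cmeasurable v -> (forall x, cmod (v x) = 1) ->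
  Linfty f -> alpha (fun x => v x * f x) = alpha f.
Proof.
move=> mv v1 lf; rewrite -alpha_modulus; last first.
  by apply: LinftyM => //; apply: (@Linfty_bnd _ _ 1) => // x; rewrite v1.
rewrite -[RHS]alpha_modulus//; congr alpha; apply/funext => x.
by rewrite cmodM v1 mul1r.
Qed.

(* A real number of [0, 1] is the average of two conjugate unimodular ones, so
   multiplication by a function with values in [0, 1] contracts the gauge. *)
Lemma alpha_contract (u : T -> R) f : measurable_fun setT u ->
  (forall x, 0 <= u x <= 1) -> Linfty f -> alpha (fun x => (u x)%:C * f x) <= alpha f.
Proof.
move=> mu_ u01 lf.
pose v x : C := u x +i* Num.sqrt (1 - u x ^+ 2).
have u1 x : 0 <= 1 - u x ^+ 2.
  by have /andP[a b] := u01 x; rewrite subr_ge0 expr_le1.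
have v1 x : cmod (v x) = 1.
  by rewrite cmodE /= sqr_sqrtr// addrC subrK sqrtr1.
have m1 : measurable_fun setT (fun x => 1 - u x ^+ 2).
  by apply: measurable_funB => //; exact: measurable_funX.
have mv : cmeasurable v.
  split => //=; apply: (measurableT_comp _ m1).
  by apply: continuous_measurable_fun; exact: sqrt_continuous.
have mvJ := cmeasurableJ mv.
have lv : Linfty v by apply: (@Linfty_bnd _ _ 1) => // x; rewrite v1.
have lvJ : Linfty (fun x => (v x)^*).
  by apply: (@Linfty_bnd _ _ 1) => // x; rewrite cmodJ v1.
have -> : (fun x => (u x)%:C * f x) =
    fun x => (2^-1 : R)%:C * (v x * f x + (v x)^* * f x).
  apply/funext => x; rewrite -mulrDl mulrA; congr (_ * f x).
  apply: eqC; rewrite !cpart ?subrr ?mulr0 ?mul0r ?subr0 ?addr0//.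
  have half (a : R) : a = 2^-1 * (a + a) - 0 by field.
  exact: (half (u x)).
rewrite gaugeZ//; last by apply: LinftyD; exact: LinftyM.
have h : alpha (fun x => v x * f x + (v x)^* * f x) <= alpha f + alpha f.
  apply: le_trans (gaugeD alpha_gauge _ _) _; try exact: LinftyM.
  by rewrite !alpha_unit// => x; rewrite cmodJ v1.
rewrite cmod_real ger0_norm ?invr_ge0// ler_pdivrMl//; lra.
Qed.

(** A gauge norm sees only moduli, and |f| = u |g| a.e. with u = min(1, |f| / |g|) in [0, 1]; the
    minimum takes care of the exceptional null set. *)
Lemma alpha_mono f g : Linfty f -> Linfty g ->
  {ae mu, forall x, cmod (f x) <= cmod (g x)} -> alpha f <= alpha g.
Proof.
move=> lf lg fg; have [mf _] := lf; have [mg _] := lg.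
have mcf := measurable_cmod mf; have mcg := measurable_cmod mg.
pose u x := Num.min 1 (cmod (f x) * (cmod (g x))^-1).
have mu_ : measurable_fun setT u.
  apply: measurable_minr => //; apply: measurable_funM => //.
  by apply: measurable_inv_ge0 => // x; exact: cmod_ge0.
have u01 x : 0 <= u x <= 1.
  by rewrite /u le_min ler01 mulr_ge0 ?invr_ge0 ?cmod_ge0//= ge_min lexx.
rewrite -(alpha_modulus lf) -(alpha_modulus lg).
apply: le_trans (alpha_contract mu_ u01 (Linfty_norm lg)).
rewrite le_eqVlt; apply/orP; left; apply/eqP; apply: gauge_ae_eq => //.
- exact: Linfty_norm.
- apply: LinftyM; last exact: Linfty_norm.
  apply: (@Linfty_bnd _ _ 1); first exact: cmeasurable_real.
  by move=> x; have /andP[a b] := u01 x; rewrite cmod_real ger0_norm.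
- apply: ae_imp fg => x h; rewrite -rmorphM /=; congr (_%:C).
  have [g0|g0] := eqVneq (cmod (g x)) 0.
    by rewrite g0 mulr0; apply/eqP; rewrite eq_le cmod_ge0 -g0 h.
  rewrite /u min_r ?mulfVK// ler_pdivrMr ?mul1r//.
  by rewrite lt0r g0 cmod_ge0.
Qed.

Lemma alpha_cst (e : R) : 0 <= e -> alpha (fun _ => e%:C) = e.
Proof.
move=> e0; rewrite (_ : (fun _ => e%:C) = fun _ : T => e%:C * 1).
  rewrite gaugeZ//; last exact: Linfty_cst.
  by rewrite (gauge1 alpha_gauge) mulr1 cmod_real ger0_norm.
by apply/funext => x; rewrite mulr1.
Qed.

(** Frees the extension from simple functions: |b| is within e of a simple function lying below it,
    and the constant e has gauge e. With [G_le], the extension is a supremum over bounded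
    minorants. *)
Lemma G_ge b f : cmeasurable f -> Linfty b -> {ae mu, forall x, cmod (b x) <= cmod (f x)} ->
  ((alpha b)%:E <= G f)%E.
Proof.
move=> mf lb bf; have [g [M [mg gM bg]]] := Linfty_bounded_rep lb.
have lg := Linfty_bnd mg gM.
rewrite (gauge_ae_eq alpha_gauge lb lg bg).
apply/lee_addgt0Pr => e e0.
have [N [K hs]] := exists_stepf (fun x => cmod_ge0 (g x)) gM e0.
have [s sE] := stepf_nnsfun N K (measurable_cmod mg).
apply: (@le_trans _ _ ((alpha (fun x => (s x)%:C))%:E + e%:E)%E).
  rewrite -EFinD lee_fin -[X in _ + X](alpha_cst (ltW e0)).
  apply: le_trans (gaugeD alpha_gauge (nnsfun_Linfty s) (Linfty_cst _)).
  apply: alpha_mono => //; first by apply: LinftyD; [exact: nnsfun_Linfty|exact: Linfty_cst].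
  apply: aeW => x; have /andP[h1 h2] := hs x.
  rewrite -rmorphD /= cmod_real sE (le_trans h2)// ler_norm//.
rewrite leeD2r//; apply: ereal_sup_ubound; exists s => //=.
apply: ae_imp (ae_and bf bg) => x [h1 h2]; rewrite sE.
by have /andP[h3 _] := hs x; rewrite (le_trans h3)// -h2.
Qed.

Lemma G_le f (M : \bar R) : (forall b, Linfty b ->
    {ae mu, forall x, cmod (b x) <= cmod (f x)} -> ((alpha b)%:E <= M)%E) ->
  (G f <= M)%E.
Proof.
move=> h; apply: ge_ereal_sup => _ [s /= sf <-]; apply: h; first exact: nnsfun_Linfty.
by apply: ae_imp sf => x; rewrite cmod_real ger0_norm.
Qed.

Lemma G_mono f g : cmeasurable g -> {ae mu, forall x, cmod (f x) <= cmod (g x)} ->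
  (G f <= G g)%E.
Proof.
move=> mg fg; apply: G_le => b lb bf; apply: G_ge => //.
by apply: ae_imp (ae_and bf fg) => x [h1 h2]; exact: le_trans h2.
Qed.

Lemma G_Linfty f : Linfty f -> G f = (alpha f)%:E.
Proof.
move=> lf; have [mf _] := lf; apply/eqP; rewrite eq_le.
have -> : ((alpha f)%:E <= G f)%E by apply: G_ge => //; apply: aeW.
by rewrite andbT; apply: G_le => b lb bf; rewrite lee_fin alpha_mono.
Qed.

(** A bounded minorant b of h is split as b |f| / (|f| + |g|) + b |g| / (|f| + |g|), with parts
    dominated by |f| and |g|. Where both vanish, so does b, and the inverse of 0 is 0. *)
Lemma G_sumle f g h : cmeasurable f -> cmeasurable g -> cmeasurable h ->
  {ae mu, forall x, cmod (h x) <= cmod (f x) + cmod (g x)} -> (G h <= G f + G g)%E.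
Proof.
move=> mf mg mh hfg; apply: G_le => b lb bh; have [mb _] := lb.
have mcf := measurable_cmod mf; have mcg := measurable_cmod mg.
pose v x := (cmod (f x) + cmod (g x))^-1.
have mv : measurable_fun setT v.
  apply: measurable_inv_ge0; first exact: measurable_funD.
  by move=> x; rewrite addr_ge0 ?cmod_ge0.
have part k : cmeasurable k -> (forall x, cmod (k x) <= cmod (f x) + cmod (g x)) ->
    Linfty (fun x => (cmod (k x) * v x)%:C * b x) /\
    {ae mu, forall x, cmod ((cmod (k x) * v x)%:C * b x) <= cmod (k x)}.
  move=> mk kfg; have mck := measurable_cmod mk.
  have v0 x : 0 <= v x by rewrite invr_ge0 addr_ge0 ?cmod_ge0.
  have kv0 x : 0 <= cmod (k x) * v x by rewrite mulr_ge0 ?cmod_ge0.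
  split.
    apply: LinftyM => //; apply: (@Linfty_bnd _ _ 1).
      by apply: cmeasurable_real; exact: measurable_funM.
    move=> x; rewrite cmod_real ger0_norm// /v.
    have [s0|s0] := eqVneq (cmod (f x) + cmod (g x)) 0.
      by rewrite s0 invr0 mulr0.
    by rewrite ler_pdivrMr ?mul1r ?kfg// lt0r s0 addr_ge0 ?cmod_ge0.
  apply: ae_imp (ae_and bh hfg) => x [h1 h2].
  have h3 := le_trans h1 h2.
  rewrite cmodM cmod_real ger0_norm// -mulrA ler_piMr ?cmod_ge0// /v.
  have [s0|s0] := eqVneq (cmod (f x) + cmod (g x)) 0.
    by rewrite s0 invr0 mul0r.
  by rewrite mulrC ler_pdivrMr ?mul1r// lt0r s0 addr_ge0 ?cmod_ge0.
have [l1 b1] := part f mf (fun x => ler_wpDr (cmod_ge0 (g x)) (lexx _)).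
have [l2 b2] := part g mg (fun x => ler_wpDl (cmod_ge0 (f x)) (lexx _)).
apply: (@le_trans _ _ ((alpha (fun x => (cmod (f x) * v x)%:C * b x))%:E +
  (alpha (fun x => (cmod (g x) * v x)%:C * b x))%:E)%E); last first.
  by apply: leeD; exact: G_ge.
rewrite -EFinD lee_fin; apply: le_trans (gaugeD alpha_gauge l1 l2).
rewrite le_eqVlt; apply/orP; left; apply/eqP; apply: gauge_ae_eq => //; first exact: LinftyD.
apply: ae_imp (ae_and bh hfg) => x [h1 h2].
rewrite -mulrDl -rmorphD /= -mulrDl /v.
have [s0|s0] := eqVneq (cmod (f x) + cmod (g x)) 0; last by rewrite divff// mul1r.
rewrite s0 mul0r mul0r; apply: cmod_eq0; apply/eqP; rewrite eq_le cmod_ge0.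
by rewrite (le_trans h1)// (le_trans h2)// s0.
Qed.

Lemma G_D f g : cmeasurable f -> cmeasurable g -> (G (fun x => f x + g x)%R <= G f + G g)%E.
Proof.
move=> mf mg; apply: G_sumle => //; first exact: cmeasurableD.
by apply: aeW => x; exact: cmodD.
Qed.

Lemma G_tri f g h : cmeasurable f -> cmeasurable g -> cmeasurable h ->
  (G (fun x => f x - h x)%R <= G (fun x => f x - g x)%R + G (fun x => g x - h x)%R)%E.
Proof.
move=> mf mg mh; apply: G_sumle; try exact: cmeasurableB.
by apply: aeW => x; rewrite (le_trans _ (cmodD _ _))// addrA subrK.
Qed.

Lemma G_C f g : cmeasurable f -> cmeasurable g ->
  G (fun x => f x - g x) = G (fun x => g x - f x).
Proof.
move=> mf mg; apply/eqP; rewrite eq_le !G_mono//; try exact: cmeasurableB;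
  by apply: aeW => x; rewrite -cmodN opprB.
Qed.

Lemma G_Mb (M : R) b f : 0 < M -> cmeasurable f -> cmeasurable b ->
  {ae mu, forall x, cmod (b x) <= M} -> (G (fun x => b x * f x)%R <= M%:E * G f)%E.
Proof.
move=> M0 mf mb bM; apply: G_le => g lg gbf.
have lg' : Linfty (fun x => (M^-1)%:C * g x) by exact: LinftyZ.
have -> : alpha g = M * alpha (fun x => (M^-1)%:C * g x).
  by rewrite gaugeZ// cmod_real ger0_norm ?invr_ge0 ?ltW// mulrA divff ?gt_eqF// mul1r.
rewrite EFinM lee_pmul2l// ?lte_fin//; apply: G_ge => //.
apply: ae_imp (ae_and bM gbf) => x [h1 h2].
have Mi : 0 <= M^-1 by rewrite invr_ge0 ltW.
rewrite cmodM cmod_real ger0_norm// ler_pdivrMl// (le_trans h2)//.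
by rewrite cmodM ler_wpM2r ?cmod_ge0.
Qed.

Lemma G_eq0 f : cmeasurable f -> (G f <= 0)%E -> {ae mu, forall x, f x = 0}.
Proof.
move=> mf G0.
have h n : {ae mu, forall x, trunc n%:R f x = 0}.
  have lt : Linfty (trunc n%:R f) by apply: trunc_Linfty.
  apply: (gauge_eq0 alpha_gauge lt); apply/eqP; rewrite eq_le gauge_ge0// andbT.
  rewrite -lee_fin (le_trans _ G0)//; apply: G_ge => //.
  by apply: aeW => x; exact: cmod_trunc_le.
have : {ae mu, forall x, forall n, trunc n%:R f x = 0} by exact: ae_foralln.
apply: filterS => x /(_ (Num.truncn (cmod (f x))).+1).
by rewrite /trunc ltW ?truncnS_gt.
Qed.

End gauge_extension.

(** * The space L^alpha and continuity of the gauge *)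

Section Lalpha_space.
Variable R : realType.
Local Notation T := (circle R).
Local Notation C := (R[i]).
Local Notation mu := (arc_length R).
Local Notation I f := (\int[mu]_x f x).
Local Notation rint f := (mu.-integrable setT (fun x => (f x)%:E)).
Variable alpha : (T -> C) -> R.
Hypothesis alpha_gauge : normalized_gauge_norm alpha.
Implicit Types f g b : T -> C.
Local Notation G := (gauge_ext alpha).

Lemma G_refl f : G (fun x => f x - f x) = 0%E.
Proof.
rewrite (_ : (fun x => _) = fun _ : T => (0 : C)); last by apply/funext => x; rewrite subrr.
rewrite G_Linfty//; last exact: Linfty_cst.
by rewrite (alpha_cst alpha_gauge (lexx 0)).
Qed.

Lemma alpha_adherent_sub (S : set (T -> C)) : S `<=` alpha_adherent alpha S.
Proof. by move=> f Sf e e0; exists f => //; rewrite G_refl lte_fin. Qed.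

Lemma Linfty_Lalpha : @Linfty R `<=` Lalpha alpha.
Proof.
move=> f lf; split; last exact: alpha_adherent_sub.
by split; [case: lf|rewrite G_Linfty// ltry].
Qed.

Lemma Lalpha_meas f : Lalpha alpha f -> cmeasurable f.
Proof. by case=> -[]. Qed.

Lemma alpha_adherent_trans (S S' : set (T -> C)) f : cmeasurable f ->
  (forall g, S' g -> cmeasurable g) -> (forall g, S g -> cmeasurable g) ->
  S' `<=` alpha_adherent alpha S -> alpha_adherent alpha S' f -> alpha_adherent alpha S f.
Proof.
move=> mf mS' mS SS' af e e0; have e2 : 0 < e / 2 by rewrite divr_gt0.
have [g Sg fg] := af _ e2; have [h Sh gh] := SS' g Sg _ e2.
exists h => //; have mg := mS' _ Sg; have mh := mS _ Sh.
by rewrite (le_lt_trans (G_tri alpha_gauge mf mg mh))// (splitr e) EFinD lteD.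
Qed.

Lemma Lalpha_closed f : cmeasurable f -> alpha_adherent alpha (Lalpha alpha) f ->
  Lalpha alpha f.
Proof.
move=> mf af; split; first split => //.
  have [g [[mg Gg] _] fg] := af 1 ltr01.
  have h := G_D alpha_gauge (cmeasurableB mf mg) mg.
  rewrite (_ : (fun x => _) = f) in h; last by apply/funext => x; rewrite subrK.
  by rewrite (le_lt_trans h)// lte_add_pinfty// (lt_trans fg)// ltry.
apply: alpha_adherent_trans (af) => //; [by move=> g [[]]|by move=> g []|by move=> g []].
Qed.

Lemma alpha_adherentMb (S S' : set (T -> C)) b f : Linfty b -> cmeasurable f ->
  (forall g, S g -> cmeasurable g) -> (forall g, S g -> S' (fun x => b x * g x)) ->
  alpha_adherent alpha S f -> alpha_adherent alpha S' (fun x => b x * f x).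
Proof.
move=> [mb [M bM]] mf mS SS' af e e0; pose K := `|M| + 1.
have K0 : 0 < K by rewrite ltr_wpDl.
have bK : {ae mu, forall x, cmod (b x) <= K}.
  by apply: ae_imp bM => x h; rewrite (le_trans h)// (le_trans (ler_norm _))// lerDl.
have [g Sg fg] := af (e / K) (divr_gt0 e0 K0).
exists (fun x => b x * g x); first exact: SS'.
have := G_Mb alpha_gauge K0 (cmeasurableB mf (mS _ Sg)) mb bK.
rewrite (_ : (fun x => _) = fun x => b x * f x - b x * g x); last first.
  by apply/funext => x; rewrite mulrBr.
move=> /le_lt_trans; apply.
by rewrite (_ : e = K * (e / K)) ?EFinM ?lte_pmul2l// mulrC divfK ?gt_eqF.
Qed.

Lemma Lalpha_Mb b f : Linfty b -> Lalpha alpha f -> Lalpha alpha (fun x => b x * f x).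
Proof.
move=> lb [[mf Gf] af]; have [mb [M bM]] := lb.
apply: Lalpha_closed; first exact: cmeasurableM.
apply: alpha_adherentMb (af) => //; first by move=> g [].
by move=> g lg; apply: Linfty_Lalpha; exact: LinftyM.
Qed.

Section continuity.
Hypothesis alpha_cont : continuous_gauge alpha.

(** Uniform form of sequential continuity: otherwise there are sets of measure below 1 / (n + 1)
    whose indicators keep gauge at least e. *)
Lemma alpha_indic_small e : 0 < e -> exists2 d, 0 < d & forall E, measurable E ->
  (mu E < d%:E)%E -> alpha (cindic E) < e.
Proof.
move=> e0; apply: contrapT => h.
have h' n : exists E : set T, [/\ measurable E, (mu E < (n.+1%:R^-1)%:E)%E &
    e <= alpha (cindic E)].
  apply: contrapT => h1; apply: h; exists (n.+1%:R^-1) => // E mE muE.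
  by rewrite ltNge; apply/negP => eE; apply: h1; exists E.
have [E hE] := choice h'.
have mE n : measurable (E n) by have [] := hE n.
have mu0 : mu (E n) @[n --> \oo] --> 0%E.
  apply: (@squeeze_cvge _ _ _ _ (fun=> 0%E) _ (fun n => (n.+1%:R^-1)%:E)).
  - by apply: nearW => n; rewrite measure_ge0/= ltW//; have [] := hE n.
  - exact: cvg_cst.
  - by apply: cvg_EFin; [exact: nearW|exact: cvg_harmonic].
have /cvgrPdist_lt /(_ _ e0)[N _ /(_ _ (leqnn N))] := alpha_cont mE mu0.
rewrite sub0r normrN ltNge => /negP; apply.
by have [_ _ h1] := hE N; rewrite (le_trans h1)// ler_norm.
Qed.

(** f is split as (f - g) + g with g bounded by K. The first part is controlled by M and the gauge
    of f - g; for the second, |b g| <= K t + K M chi_E with E the set |b| >= t, whose measure is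
    small by Markov's inequality. *)
Lemma G_mul_small f (M e : R) : Lalpha alpha f -> 0 < M -> 0 < e ->
  exists2 d, 0 < d & forall b, cmeasurable b -> {ae mu, forall x, cmod (b x) <= M} ->
    I (fun x => cmod (b x)) < d -> (G (fun x => b x * f x)%R < e%:E)%E.
Proof.
move=> [[mf _] af] M0 e0; have e4 : 0 < e / 4 by rewrite divr_gt0.
have [g [mg [K' gK']] fg] := af _ (divr_gt0 e4 M0).
pose K := `|K'| + 1; have K0 : 0 < K by rewrite ltr_wpDl.
have gK : {ae mu, forall x, cmod (g x) <= K}.
  by apply: ae_imp gK' => x h; rewrite (le_trans h)// (le_trans (ler_norm _))// lerDl.
have KM0 : 0 < K * M by rewrite mulr_gt0.
have [d d0 hd] := alpha_indic_small (divr_gt0 e4 KM0).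
(* Chosen so that the constant K t has gauge e / 4. *)
pose t := e / 4 / K; have t0 : 0 < t by rewrite divr_gt0.
exists (t * d); first by rewrite mulr_gt0.
move=> b mb bM Ib.
have lb : Linfty b by split => //; exists M.
have rb : rint (fun x => cmod (b x)) by have [] := Linfty_cint lb.
have Kt0 : 0 <= K * t by rewrite mulr_ge0// ltW.
pose E := [set x | t <= cmod (b x)].
have mcb := measurable_cmod mb.
have mE : measurable E.
  rewrite -[X in measurable X]setTI.
  rewrite (_ : E = (fun x => cmod (b x)) @^-1` `[t, +oo[%classic); last first.
    by apply/seteqP; split => x /=; rewrite in_itv/= andbT.
  exact: mcb.
have muE : (mu E < d%:E)%E.
  apply: le_lt_trans (markov_I rb (fun x => cmod_ge0 _) t0) _.
  by rewrite lte_fin ltr_pdivrMr// mulrC.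
have aE := hd E mE muE.
have lE := Linfty_indic mE; have lt := @Linfty_cst R (K * t)%:C.
pose v x := (K * t)%:C + (K * M)%:C * cindic E x.
have lv : Linfty v by apply: LinftyD => //; exact: LinftyZ.
have Gbg : (G (fun x => b x * g x)%R < (e / 2)%:E)%E.
  apply: (@le_lt_trans _ _ (G v)).
    apply: G_mono => //; first by case: lv.
    apply: ae_imp (ae_and bM gK) => x [h1 h2].
    rewrite cmodM /v /cindic -!(rmorphM, rmorphD) /= cmod_real.
    have KMi : 0 <= K * M * (\1_E x : R) by rewrite mulr_ge0 ?(ltW KM0)// indicE ler0n.
    rewrite (ger0_norm (addr_ge0 Kt0 KMi)) mulrC indicE; have [xE|xE] := boolP (x \in E).
      by rewrite mulr1 ler_wpDl// ler_pM ?cmod_ge0.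
    rewrite mulr0 addr0 ler_pM ?cmod_ge0// ltW// ltNge; apply/negP => h3.
    by move/negP: xE; apply; rewrite inE.
  rewrite G_Linfty// lte_fin; apply: le_lt_trans (gaugeD alpha_gauge lt _) _.
    exact: LinftyZ.
  rewrite alpha_cst// gaugeZ// cmod_real (gtr0_norm KM0).
  have -> : K * t = e / 4 by rewrite /t mulrC divfK ?gt_eqF.
  have : K * M * alpha (cindic E) < e / 4 by rewrite mulrC -ltr_pdivlMr.
  by move: (K * M * _) => z hz; lra.
have Gfg : (G (fun x => b x * (f x - g x))%R < (e / 4)%:E)%E.
  apply: le_lt_trans (G_Mb alpha_gauge M0 (cmeasurableB mf mg) mb bM) _.
  rewrite (_ : (e / 4)%:E = (M%:E * (e / 4 / M)%:E)%E) ?lte_pmul2l//.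
  by rewrite -EFinM [M * _]mulrC divfK// gt_eqF.
have := G_D alpha_gauge (cmeasurableM mb (cmeasurableB mf mg)) (cmeasurableM mb mg).
rewrite (_ : (fun x => _) = fun x => b x * f x); last by apply/funext => x; ring.
move=> /le_lt_trans; apply; apply: lt_le_trans (lteD Gfg Gbg) _.
by rewrite -EFinD lee_fin; lra.
Qed.

End continuity.

End Lalpha_space.

(** w is the Radon-Nikodym density, replaced by 1 where it is not positive. This happens only on a
    null set, since the extended logarithm of 0 is -oo while an integrable function is a.e.
    finite. *)
Lemma density_exists (R : realType) (alpha : (circle R -> R[i]) -> R) (c : R)
    (lambda : probability (circle R) R) (mu := arc_length R) :
  normalized_gauge_norm alpha -> lambda `<< mu -> dominating c lambda alpha ->
  mu.-integrable setT (fun x =>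
    lne `|Radon_Nikodym (charge_of_finite_measure lambda) mu x|%E) ->
  exists w : circle R -> R, [/\ measurable_fun setT w, forall x, 0 < w x,
    mu.-integrable setT (fun x => (ln (w x))%:E) &
    forall f, Linfty f -> mu.-integrable setT (fun x => (cmod (f x) * w x)%:E) /\
      c * (\int[mu]_x (cmod (f x) * w x)) <= alpha f].
Proof.
move=> alpha_gauge lm dom li.
pose D := Radon_Nikodym (charge_of_finite_measure lambda) mu.
have rD : mu.-integrable setT D by exact: Radon_Nikodym_integrable.
have mD : measurable_fun setT D := measurable_int _ rD.
have finD x : D x = (fine (D x))%:E by rewrite fineK// Radon_Nikodym_fin_num.
have mfD : measurable_fun setT (fun x => fine (D x)).
  by apply/measurable_EFinP; apply: eq_measurable_fun mD => x _; exact: finD.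
pose w x : R := if 0 < fine (D x) then fine (D x) else 1.
have w0 x : 0 < w x by rewrite /w; case: ifPn.
have mw : measurable_fun setT w.
  apply: measurable_fun_ifT => //.
  by apply: measurable_fun_ltr.
have D0 : {ae mu, forall x, (0 <= D x)%E}.
  have := @ae_eq_Radon_Nikodym_SigmaFinite _ _ R lambda mu lm setT measurableT.
  by apply: filterS => x /(_ I); rewrite -/D => <-; exact: Radon_Nikodym_SigmaFinite.f_ge0.
have Dw : {ae mu, forall x, D x = (w x)%:E}.
  have := integrable_ae measurableT li.
  move=> h; apply: ae_imp (ae_and D0 h) => x [].
  rewrite -/(D x) finD lee_fin => d0 /(_ I) /=.
  by rewrite ger0_norm//; have [//|d1] := leP (fine (D x)) 0; rewrite /w d1.
have rw : mu.-integrable setT (fun x => (w x)%:E).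
  apply: (@rint_ae _ _ _ mu (fun x => fine (D x))) => //.
    by apply: filterS Dw => x ->.
  by apply: eq_integrable rD => // x _; rewrite -finD.
exists w; split => //.
- have mlw : measurable_fun setT (fun x => ln (w x)).
    exact: measurableT_comp (@measurable_ln R) mw.
  apply/integrableP; split; first exact/measurable_EFinP.
  have /integrableP[ml] := li; apply: le_lt_trans.
  apply: ae_ge0_le_integral => //.
  + exact/measurableT_comp/measurable_EFinP.
  + exact: measurableT_comp.
  apply: filterS Dw => x h _; rewrite -[Radon_Nikodym _ _ x]/(D x) h.
  rewrite -[(`|(w x)%:E|)%E]/((`|w x|)%:E).
  by rewrite gtr0_norm// lne_EFin.
- move=> f lf; have [g [M [mg gM fg]]] := Linfty_bounded_rep lf.
  have [mf _] := lf; have lg := Linfty_bnd mg gM.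
  have mfw : measurable_fun setT (fun x => cmod (f x) * w x).
    by apply: measurable_funM => //; exact: measurable_cmod.
  have rfw : mu.-integrable setT (fun x => (cmod (f x) * w x)%:E).
    apply: (rint_ae_le mfw _ (rintZ M rw)).
    apply: ae_imp fg => x ->; rewrite normrM !ger0_norm ?cmod_ge0 ?(ltW (w0 x))//.
    by rewrite ler_wpM2r// ltW.
  split => //; rewrite (gauge_ae_eq alpha_gauge lf lg fg) -lee_fin.
  apply: le_trans (dom g lg); rewrite EFinM -I_fin//.
  rewrite -(@Radon_Nikodym_change_of_variables _ _ R lambda mu lm)//; last first.
    apply: (rint_bnd (M := M) (measurable_cmod mg)); apply: aeW => x.
    by rewrite ger0_norm ?cmod_ge0.
  rewrite le_eqVlt; apply/orP; left; apply/eqP; congr (_ * _)%E.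
  apply: ae_eq_integral => //.
  + exact/measurable_EFinP.
  + by apply: emeasurable_funM => //; apply/measurable_EFinP; exact: measurable_cmod.
  by apply: ae_imp (ae_and fg Dw) => x [-> h] _; rewrite -[Radon_Nikodym _ _ x]/(D x) h EFinM.
Qed.

(** * The weighted L^1 bound on L^alpha *)

Section weighted_bound.
Variable R : realType.
Local Notation T := (circle R).
Local Notation C := (R[i]).
Local Notation mu := (arc_length R).
Local Notation I f := (\int[mu]_x f x).
Local Notation rint f := (mu.-integrable setT (fun x => (f x)%:E)).
Variables (alpha : (T -> C) -> R) (c : R) (w : T -> R).
Hypothesis alpha_gauge : normalized_gauge_norm alpha.
Hypotheses (c0 : 0 < c) (mw : measurable_fun setT w) (w0 : forall x, 0 < w x).
Hypothesis rlw : rint (fun x => ln (w x)).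
Hypothesis domw : forall f, Linfty f -> rint (fun x => cmod (f x) * w x) /\
  c * I (fun x => cmod (f x) * w x) <= alpha f.
Implicit Types f g b : T -> C.
Local Notation G := (gauge_ext alpha).

(** Domination is known for the bounded truncations of f; monotone convergence does the rest. *)
Lemma G_dom f : cmeasurable f ->
  (c%:E * \int[mu]_x (cmod (f x) * w x)%:E <= G f)%E.
Proof.
move=> mf; pose g_ n x := (cmod (trunc n%:R f x) * w x)%:E.
have mfw h : cmeasurable h -> measurable_fun setT (fun x => (cmod (h x) * w x)%:E).
  by move=> mh; apply/measurable_EFinP; apply: measurable_funM => //; exact: measurable_cmod.
have h := @cvg_monotone_convergence _ _ R mu setT measurableT g_.
have lim x : limn (g_ ^~ x) = (cmod (f x) * w x)%:E.
  apply/cvg_lim => //; apply: cvg_near_cst.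
  near=> n; rewrite /g_ /trunc ifT//.
  rewrite (le_trans (ltW (truncnS_gt _)))// ler_nat.
  by near: n; exact: nbhs_infty_ge.
have gn n : (c%:E * \int[mu]_x g_ n x <= G f)%E.
  have lt : Linfty (trunc n%:R f) by exact: trunc_Linfty.
  have [h1 h2] := domw lt.
  rewrite I_fin// -EFinM; apply: le_trans (G_ge alpha_gauge mf lt _); first by rewrite lee_fin.
  by apply: aeW => x; exact: cmod_trunc_le.
rewrite -lee_pdivlMl//.
have -> : (\int[mu]_x (cmod (f x) * w x)%:E = \int[mu]_x limn (g_ ^~ x))%E.
  by apply: eq_integral => x _; rewrite lim.
apply: (cvge_le _ (h _ _ _)).
- by apply: nearW => n; rewrite lee_pdivlMl.
- by move=> n; apply: mfw; exact: cmeasurable_trunc.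
- by move=> n x _; rewrite lee_fin mulr_ge0 ?cmod_ge0 ?ltW.
- move=> x _ m n mn; rewrite lee_fin; apply: ler_wpM2r; first exact/ltW.
  rewrite /trunc.
  case: ifPn => [h1|_]; last by rewrite cmod0 cmod_ge0.
  by rewrite ifT// (le_trans h1)// ler_nat.
Unshelve. all: by end_near. Qed.

Lemma measurable_cmodw f : cmeasurable f -> measurable_fun setT (fun x => cmod (f x) * w x).
Proof. by move=> mf; apply: measurable_funM => //; exact: measurable_cmod. Qed.

Lemma rint_cmodw f : cmeasurable f -> (G f < +oo)%E -> rint (fun x => cmod (f x) * w x).
Proof.
move=> mf Gf; apply/integrableP; split; first by apply/measurable_EFinP; exact: measurable_cmodw.
under eq_integral => x _.
  rewrite [(`|_|)%E](_ : _ = (cmod (f x) * w x)%:E); last first.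
    by rewrite /= ger0_norm// mulr_ge0 ?cmod_ge0 ?ltW.
  over.
rewrite ltey; apply/eqP => h; have := G_dom mf; rewrite h gt0_muley ?lte_fin//.
by move/(lt_le_trans Gf); rewrite ltxx.
Qed.

Lemma I_cmodw_lt f e : cmeasurable f -> (G f < (c * e)%:E)%E ->
  I (fun x => cmod (f x) * w x) < e.
Proof.
move=> mf Gf; have rf := rint_cmodw mf (lt_trans Gf (ltry _)).
have := le_lt_trans (G_dom mf) Gf.
by rewrite I_fin// -EFinM lte_fin ltr_pM2l.
Qed.

(** Where |f| > 1, log |f| = log (|f| w) - log w <= |f| w + |log w|. *)
Lemma rint_logp f : Lalpha alpha f -> rint (fun x => ln (Num.max 1 (cmod (f x)))).
Proof.
move=> [[mf Gf] _]; have rf := rint_cmodw mf Gf.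
apply: (rint_le _ _ (rintD rf (rint_norm rlw))).
  apply: measurableT_comp (@measurable_ln R) _.
  by apply: measurable_maxr => //; exact: measurable_cmod.
move=> x; rewrite ger0_norm; last by rewrite ln_ge0// le_max lexx.
have p0 : 0 <= cmod (f x) * w x by rewrite mulr_ge0 ?cmod_ge0 ?ltW.
rewrite /Num.max; case: ifPn => h; last by rewrite ln1 addr_ge0.
have f0 : 0 < cmod (f x) by rewrite (lt_trans ltr01).
have := ln_sublinear (mulr_gt0 f0 (w0 x)); rewrite lnM ?posrE//.
have := ler_norm (- ln (w x)); rewrite normrN.
by move: (cmod (f x) * w x) (ln _) (ln _) `|_| => a b c' d h1 h2; lra.
Qed.

End weighted_bound.

(** * Cutting down moduli by outer functions *)

Section outer_cutoff.
Variable R : realType.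
Local Notation T := (circle R).
Local Notation C := (R[i]).
Local Notation mu := (arc_length R).
Local Notation I f := (\int[mu]_x f x).
Local Notation rint f := (mu.-integrable setT (fun x => (f x)%:E)).
Implicit Types f g : T -> C.

Lemma outer_inv (k : T -> R) : (forall x, 1 <= k x) -> rint (fun x => ln (k x)) ->
  exists h, [/\ Hinfty h, {ae mu, forall x, cmod (h x) = (k x)^-1} &
    I (fun x => cmod (h x - 1)) ^+ 2 <= 2 * I (fun x => ln (k x))].
Proof.
move=> k1 rk.
have u0 x : - ln (k x) <= 0 by rewrite oppr_le0 ln_ge0.
have [h [Hh hk hN]] := outer_near1 u0 (rintN rk); exists h; split => //.
  apply: ae_imp hk => x ->; rewrite expRN lnK// posrE.
  by rewrite (lt_le_trans ltr01).
have lh : sqr_integrable h by have [] := Hinfty_H2 Hh.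
apply: le_trans (I_cmod_N2 (L2B lh (L2_cst _))) _.
by apply: le_trans hN _; rewrite I_N// mulrN opprK.
Qed.

(** |h| = 1 / max(1, |g|), and log max(1, |g|) <= |g|: when g is small in mean, h is close to 1
    while h g is bounded by 1. *)
Lemma outer_cutoff_L2 g : sqr_integrable g -> exists h, [/\ Hinfty h,
  {ae mu, forall x, cmod (h x) <= 1}, {ae mu, forall x, cmod (h x * g x) <= 1} &
  I (fun x => cmod (h x - 1)) ^+ 2 <= 2 * I (fun x => cmod (g x))].
Proof.
move=> lg; have [mg _] := lg; have [_ rg] := L2_cint lg.
pose k x := Num.max 1 (cmod (g x)).
have k1 x : 1 <= k x by rewrite le_max lexx.
have k0 x : 0 < k x by rewrite (lt_le_trans ltr01).
have lk x : 0 <= ln (k x) <= cmod (g x).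
  rewrite ln_ge0//= /k /Num.max; case: ifPn => h; last by rewrite ln1 cmod_ge0.
  by rewrite ltW// ln_sublinear// (lt_trans ltr01).
have mk : measurable_fun setT (fun x => ln (k x)).
  apply: measurableT_comp (@measurable_ln R) _.
  by apply: measurable_maxr => //; exact: measurable_cmod.
have rk : rint (fun x => ln (k x)).
  apply: rint_le mk _ rg => x; have /andP[h1 h2] := lk x.
  by rewrite ger0_norm.
have [h [Hh hk hN]] := outer_inv k1 rk; exists h; split => //.
- by apply: ae_imp hk => x ->; rewrite invf_le1.
- apply: ae_imp hk => x e; rewrite cmodM e ler_pdivrMl// mulr1.
  by rewrite le_max lexx orbT.
- apply: le_trans hN _; rewrite ler_pM2l//; apply: I_le => // x.
  by have /andP[] := lk x.
Qed.

(** |h| = 1 / max(1, |f| / (n + 1)), so |h f| <= n + 1. The logarithms tend to 0 pointwise under the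
    integrable bound log max(1, |f|), which brings h near 1 for large n. *)
Lemma outer_cutoff f e : cmeasurable f -> rint (fun x => ln (Num.max 1 (cmod (f x)))) ->
  0 < e -> exists h, [/\ Hinfty h, {ae mu, forall x, cmod (h x) <= 1},
    Linfty (fun x => h x * f x) & I (fun x => cmod (h x - 1)) < e].
Proof.
move=> mf rf e0.
pose k n x := Num.max 1 (cmod (f x) / n.+1%:R).
have k1 n x : 1 <= k n x by rewrite le_max lexx.
have k0 n x : 0 < k n x by rewrite (lt_le_trans ltr01).
have mk n : measurable_fun setT (fun x => ln (k n x)).
  apply: measurableT_comp (@measurable_ln R) _.
  apply: measurable_maxr => //; apply: measurable_funM => //.
  exact: measurable_cmod.
have kle n x : `|ln (k n x)| <= ln (Num.max 1 (cmod (f x))).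
  rewrite ger0_norm ?ln_ge0// ler_ln ?posrE//; last by rewrite (lt_le_trans ltr01)// le_max lexx.
  rewrite ge_max; apply/andP; split; first by rewrite le_max lexx.
  rewrite le_max; apply/orP; right.
  by rewrite ler_pdivrMr// ler_peMr ?cmod_ge0// ler1n.
have rk n : rint (fun x => ln (k n x)) by exact: rint_le (mk n) (kle n) rf.
have lim : I (fun x => ln (k n x)) @[n --> \oo] --> (0 : R).
  apply: I_dct0 mk _ rf _; last by apply: aeW => x n.
  apply: aeW => x; apply: cvg_near_cst; near=> n.
  rewrite /k max_l ?ln1// ler_pdivrMr// mul1r.
  rewrite (le_trans (ltW (truncnS_gt _)))// ler_nat ltnS.
  by near: n; exact: nbhs_infty_ge.
have e2 : 0 < e ^+ 2 / 2 by rewrite divr_gt0 ?exprn_gt0.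
have /cvgrPdist_lt /(_ _ e2)[N _ /(_ _ (leqnn N))] := lim.
rewrite sub0r normrN => hN'.
have hN : I (fun x => ln (k N x)) < e ^+ 2 / 2 by rewrite (le_lt_trans (ler_norm _)).
have [h [Hh hk hI]] := outer_inv (k1 N) (rk N); have [[mh _] _] := Hh.
exists h; split => //.
- by apply: ae_imp hk => x ->; rewrite invf_le1.
- split; first exact: cmeasurableM.
  exists N.+1%:R; apply: ae_imp hk => x hx; rewrite cmodM hx ler_pdivrMl//.
  by rewrite -ler_pdivrMr// le_max lexx orbT.
- have I0 : 0 <= I (fun x => cmod (h x - 1)) by apply: I_ge0 => x; exact: cmod_ge0.
  rewrite -(@ltr_pXn2r _ 2)// ?nnegrE ?(ltW e0)//.
  have half (a b d : R) : a <= 2 * b -> b < d / 2 -> a < d by clear; lra.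
  exact: half hI hN.
Unshelve. all: by end_near. Qed.

End outer_cutoff.

(** * Invariant subspaces of L^alpha *)

Section invariant_subspaces.
Variable R : realType.
Local Notation T := (circle R).
Local Notation C := (R[i]).
Local Notation mu := (arc_length R).
Local Notation I f := (\int[mu]_x f x).
Local Notation rint f := (mu.-integrable setT (fun x => (f x)%:E)).
Variables (alpha : (T -> C) -> R) (c : R) (w : T -> R).
Hypothesis alpha_gauge : normalized_gauge_norm alpha.
Hypothesis alpha_cont : continuous_gauge alpha.
Hypotheses (c0 : 0 < c) (mw : measurable_fun setT w) (w0 : forall x, 0 < w x).
Hypothesis rlw : rint (fun x => ln (w x)).
Hypothesis domw : forall f, Linfty f -> rint (fun x => cmod (f x) * w x) /\
  c * I (fun x => cmod (f x) * w x) <= alpha f.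
Implicit Types f g b : T -> C.
Local Notation G := (gauge_ext alpha).
Local Notation La := (Lalpha alpha).
Local Notation Ha := (Halpha alpha).

Lemma Hinfty_Linfty : @Hinfty R `<=` @Linfty R.
Proof. by move=> f []. Qed.

Lemma Linfty_meas f : Linfty f -> cmeasurable f.
Proof. by case. Qed.

Lemma zcoord_Hinfty : Hinfty (@zcoord R).
Proof.
apply: poly_Hinfty; exists 'X => //.
by apply/funext => x; rewrite hornerX.
Qed.

Lemma cst_Hinfty (a : C) : Hinfty (fun _ : T => a).
Proof.
apply: poly_Hinfty; exists a%:P => //.
by apply/funext => x; rewrite hornerC.
Qed.

Lemma unimodular_Linfty (phi : T -> C) : unimodular phi -> Linfty phi.
Proof.
move=> [mphi phi1]; split => //; exists 1.
by apply: ae_imp phi1 => x /cmod_norm1 ->.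
Qed.

Lemma LinftyJ f : Linfty f -> Linfty (fun x => (f x)^*).
Proof.
move=> [mf [M fM]]; split; first exact: cmeasurableJ.
by exists M; apply: ae_imp fM => x; rewrite cmodJ.
Qed.

Section one_subspace.
Variable W : set (T -> C).
Hypothesis cW : closed_subspace alpha W.
Hypothesis zW : mul_set (@zcoord R) W `<=` W.
Local Notation Wb := (W `&` @Linfty R).

Lemma subspace_meas f : W f -> cmeasurable f.
Proof. by move/(subspace_sub cW)/Lalpha_meas. Qed.

Lemma subspace_poly f (p : {poly C}) : W f -> W (fun x => p.[zcoord x] * f x).
Proof.
move=> Wf; elim/poly_ind: p => [|p a IH].
  by under eq_fun do rewrite horner0 mul0r; exact: subspace0 cW.
rewrite (_ : (fun x => _) = fun x => zcoord x * (p.[zcoord x] * f x) + a * f x).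
  apply: (subspaceD cW); last exact: (subspaceZ cW).
  apply: zW; split; last by exists (fun x => p.[zcoord x] * f x) => //; exact: aeW.
  by apply: cmeasurableM (@cmeasurable_zcoord R) (subspace_meas IH).
by apply/funext => x; rewrite hornerD hornerM hornerX hornerC; ring.
Qed.

(* The Fejer means of h are polynomials which are uniformly bounded and converge
   to h in mean. *)
Lemma subspace_Hinfty h f : Hinfty h -> W f -> W (fun x => h x * f x).
Proof.
move=> Hh Wf; have Lf := subspace_sub cW Wf.
have /HinftyP[lh h0] := Hh; have [mh [M hM]] := lh.
apply: (subspace_closed cW); split; first exact: Lalpha_Mb.
move=> e e0; pose K := 2 * `|M| + 1; have K0 : 0 < K by rewrite ltr_wpDl ?mulr_ge0.
have [d d0 hd] := G_mul_small alpha_gauge alpha_cont Lf K0 e0.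
have [N hN] := fejer_L2_cvg lh (exprn_gt0 2 d0).
pose F := fejer N.+1 h; have [p _ Fp] : analytic_polynomials F by exact: fejer_poly.
have lF : Linfty F by exact/trig_Linfty/trig_fejer.
exists (fun x => p.[zcoord x] * f x); first exact: subspace_poly.
have lhF := LinftyB lh lF.
rewrite (_ : (fun x => _) = fun x => (h x - F x) * f x); last first.
  by apply/funext => x; rewrite -Fp mulrBl.
have F1 x : cmod (F x) <= M by exact: cmod_fejer_le.
apply: hd; first by case: lhF.
  apply: ae_imp hM => x hx; rewrite (le_trans (cmodB _ _))//.
  have sum (a a' m m' : R) : a <= m -> a' <= m -> m <= m' -> a + a' <= 2 * m' + 1 by lra.
  exact: sum hx (F1 x) (ler_norm M).
have I0 : 0 <= I (fun x => cmod (h x - F x)) by apply: I_ge0 => x; exact: cmod_ge0.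
rewrite -(@ltr_pXn2r _ 2)// ?nnegrE ?(ltW d0)//.
by apply: le_lt_trans (I_cmod_N2 (Linfty_L2 lhF)) (hN _ (ltnSn N)).
Qed.

Lemma subspace_dense : W `<=` alpha_adherent alpha Wb.
Proof.
move=> f Wf e e0; have Lf := subspace_sub cW Wf; have mf := Lalpha_meas Lf.
(* The constant 2 bounds |h - 1| when |h| <= 1. *)
have [d d0 hd] := G_mul_small alpha_gauge alpha_cont Lf (ltr0n R 2) e0.
have rf := rint_logp alpha_gauge c0 mw w0 rlw domw Lf.
have [h [Hh h1 lhf hI]] := outer_cutoff mf rf d0.
have lh := Hinfty_Linfty Hh; have [mh _] := lh; have [mhf _] := lhf.
exists (fun x => h x * f x); first by split => //; exact: subspace_Hinfty.
rewrite G_C//; rewrite (_ : (fun x => _) = fun x => (h x - 1) * f x); last first.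
  by apply/funext => x; rewrite mulrBl mul1r.
apply: hd hI; first by apply: cmeasurableB => //; exact: cmeasurable_cst.
apply: ae_imp h1 => x hx; rewrite (le_trans (cmodB _ _))// cmod1.
by move: hx; move: (cmod _) => a; lra.
Qed.

Lemma L2_closure_subspace : L2_subspace (L2_adherent Wb).
Proof.
have bL2 : Wb `<=` @sqr_integrable R by move=> f [_ lf]; exact: Linfty_L2.
split.
- by move=> f [].
- by apply: sub_L2_adherent => //; split; [exact: subspace0 cW|exact: Linfty_cst].
- move=> f g; apply: L2_adherentD => // f' g' [w1 l1] [w2 l2].
  by split; [exact: (subspaceD cW)|exact: LinftyD].
- move=> a f; apply: L2_adherentZ => // g [Wg lg].
  by split; [exact: (subspaceZ cW)|exact: LinftyZ].
- by apply: L2_adherent_trans.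
Qed.

Lemma L2_closure_zinvariant : zinvariant (L2_adherent Wb).
Proof.
have bL2 : Wb `<=` @sqr_integrable R by move=> f [_ lf]; exact: Linfty_L2.
have lz := Hinfty_Linfty zcoord_Hinfty; have [mz [M zM]] := lz.
move=> f; apply: L2_adherentMb mz zM _ => // g [Wg lg].
by split; [exact: subspace_Hinfty zcoord_Hinfty Wg|exact: LinftyM].
Qed.

(* If g in W is close to f in L^2 and h is an outer function with modulus
   1 / max 1 |f - g|, then h g lies in W, stays at bounded distance from f and is
   close to f in mean. *)
Lemma L2_closure_Linfty f : L2_adherent Wb f -> Linfty f -> W f.
Proof.
move=> [l2f af] lf; have [mf [M fM]] := lf.
apply: (subspace_closed cW); split; first exact: Linfty_Lalpha.
move=> e e0; pose K := 1 + 2 * `|M|; have K0 : 0 < K by rewrite ltr_wpDr ?mulr_ge0.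
(* Taking the factor 1 in [G_mul_small]: uniformly bounded functions that are small in mean have
   small gauge. *)
have L1 := Linfty_Lalpha alpha_gauge (@Linfty_cst R 1).
have [d d0 hd] := G_mul_small alpha_gauge alpha_cont L1 K0 e0.
pose t := d / (2 * (`|M| + 1)).
have M1 : 0 < `|M| + 1 by rewrite ltr_wpDl.
have t0 : 0 < t by rewrite divr_gt0// mulr_gt0.
(* s <= t^2 / 2 makes the mean of |h - 1| less than t, as its square is at most twice that of |g -
   f|; s <= d / 2 and |M| t + t = d / 2 then leave a total below d. *)
pose s := Num.min (d / 2) (t ^+ 2 / 2).
have s0 : 0 < s by rewrite lt_min !divr_gt0 ?exprn_gt0.
have [g [Wg lg] fg] := af _ (exprn_gt0 2 s0).
have l2g := Linfty_L2 lg; have [mg _] := lg.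
have [h [Hh h1 hg1 hI]] := outer_cutoff_L2 (L2B l2g l2f).
have lh := Hinfty_Linfty Hh; have [mh _] := lh.
exists (fun x => h x * g x); first exact: subspace_Hinfty.
have lb : Linfty (fun x => f x - h x * g x) by apply: LinftyB => //; exact: LinftyM.
have [mb _] := lb.
(* Only h (g - f), bounded by 1 through the choice of h, and (h - 1) f occur; g itself has no useful
   bound. *)
have bE x : f x - h x * g x = - (h x * (g x - f x)) - (h x - 1) * f x by ring.
rewrite (_ : (fun x => _) = fun x => (f x - h x * g x) * 1); last first.
  by apply/funext => x; rewrite mulr1.
have Ifg0 : 0 <= I (fun x => cmod (g x - f x)) by apply: I_ge0 => x; exact: cmod_ge0.
have Ih0 : 0 <= I (fun x => cmod (h x - 1)) by apply: I_ge0 => x; exact: cmod_ge0.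
have Ifg : I (fun x => cmod (g x - f x)) < s.
  rewrite -(@ltr_pXn2r _ 2)// ?nnegrE ?(ltW s0)//.
  by apply: le_lt_trans (I_cmod_N2 (L2B l2g l2f)) _; rewrite N2C.
have /andP[s1 s2] : (s <= d / 2) && (s <= t ^+ 2 / 2) by rewrite -le_min.
have Ih : I (fun x => cmod (h x - 1)) < t.
  rewrite -(@ltr_pXn2r _ 2)// ?nnegrE ?(ltW t0)//.
  apply: le_lt_trans hI _.
  have half (a b b' : R) : a < b -> b <= b' / 2 -> 2 * a < b' by lra.
  exact: half Ifg s2.
apply: hd => //.
  apply: ae_imp (ae_and (ae_and h1 hg1) fM) => x [[h2 h3] h4].
  rewrite bE; apply: le_trans (cmodB _ _) _; rewrite cmodN /K lerD// cmodM.
  apply: ler_pM; rewrite ?cmod_ge0//; last by rewrite (le_trans h4)// ler_norm.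
  by rewrite (le_trans (cmodB _ _))// cmod1; move: h2; move: (cmod _) => a; lra.
have lgf := LinftyB lg lf; have lh1 := LinftyB lh (@Linfty_cst R 1).
have [_ rgf] := Linfty_cint lgf; have [_ rh1] := Linfty_cint lh1.
have [_ rb] := Linfty_cint lb.
have rh1M := rintZ `|M| rh1.
apply: (@le_lt_trans _ _ (I (fun x => cmod (g x - f x) + `|M| * cmod (h x - 1)))).
  apply: I_le_ae rb (rintD rgf rh1M) _.
  apply: ae_imp (ae_and h1 fM) => x [h2 h3]; rewrite bE.
  apply: le_trans (cmodB _ _) _; rewrite cmodN lerD// cmodM.
    by rewrite ler_piMl ?cmod_ge0.
  by rewrite mulrC ler_wpM2r ?cmod_ge0// (le_trans h3)// ler_norm.
rewrite (I_D rgf rh1M) I_Z//.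
have tM : `|M| * t + t = d / 2 by rewrite /t; field; rewrite lt0r_neq0.
have hM : `|M| * I (fun x => cmod (h x - 1)) <= `|M| * t by rewrite ler_wpM2l// ltW.
have sum (a b m t' s' d' : R) : a < s' -> s' <= d' / 2 -> m + t' = d' / 2 -> 0 < t' ->
  b <= m -> a + b < d' by lra.
exact: sum Ifg s1 tM t0 hM.
Qed.

Lemma bounded_part : Wb = L2_adherent Wb `&` @Linfty R.
Proof.
have bL2 : Wb `<=` @sqr_integrable R by move=> f [_ lf]; exact: Linfty_L2.
apply/seteqP; split => [f [Wf lf]|f [Mf lf]]; split => //.
  by apply: sub_L2_adherent.
exact: L2_closure_Linfty.
Qed.

(** Both W and the candidate space are alpha-closed with alpha-dense bounded elements, and
    [bounded_part] matches those; multiplication by phi, its conjugate or chi_E carries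
    approximations across. *)
Lemma invariant_subspaceP :
  (exists2 phi, unimodular phi & W = mul_set phi Ha) \/
  (exists2 E : set T, measurable E & W = mul_set (cindic E) La).
Proof.
have mWb f : Wb f -> cmeasurable f by case=> _ [].
have [[phi uphi Mphi]|[E mE ME]] :=
    beurling_helson L2_closure_subspace L2_closure_zinvariant; [left|right].
  exists phi => //; have lphi := unimodular_Linfty uphi.
  have [mphi phi1] := uphi; have lphiJ := LinftyJ lphi.
  have phiK : {ae mu, forall x, (phi x)^* * phi x = 1}.
    by apply: ae_imp phi1 => x /cmod_norm1; exact: cmod1_invJ.
  apply/seteqP; split => f.
    move=> Wf; have Lf := subspace_sub cW Wf; have mf := Lalpha_meas Lf.
    split => //; exists (fun x => (phi x)^* * f x); last first.
      by apply: ae_imp phiK => x e; rewrite mulrCA mulrA e mul1r.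
    split; first exact: Lalpha_Mb.
    apply: alpha_adherentMb (subspace_dense Wf) => // g Wbg; have [_ lg] := Wbg.
    have [/Mphi[_ [_ h0]] _] : (L2_adherent Wb `&` @Linfty R) g by rewrite -bounded_part.
    by apply/HinftyP; split => //; exact: LinftyM.
  move=> [mf [k [Lk ak] fk]]; have mk := Lalpha_meas Lk.
  apply: (subspace_ae cW (f := fun x => phi x * k x)) => //; last first.
    by apply: ae_imp fk => x ->.
  apply: (subspace_closed cW); split; first exact: Lalpha_Mb.
  apply: alpha_adherentMb (ak) => //; first by move=> g /Hinfty_Linfty/Linfty_meas.
  move=> g Hg; have lg := Hinfty_Linfty Hg; have [mg _] := lg.
  apply: L2_closure_Linfty; last exact: LinftyM.
  apply/Mphi; split; first exact: cmeasurableM.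
  apply: (H2_ae _ _ (Hinfty_H2 Hg)).
    by apply: cmeasurableM (cmeasurableJ mphi) (cmeasurableM mphi mg).
  by apply: ae_imp phiK => x e; rewrite mulrA e mul1r.
exists E => //; have lE := Linfty_indic mE; have [mcE _] := lE.
apply/seteqP; split => f.
  move=> Wf; have Lf := subspace_sub cW Wf; have mf := Lalpha_meas Lf.
  split => //; exists f => //.
  (* A bounded g in W vanishes off E, so |f - chi_E f| <= |f - g|; letting g tend to f shows that f
     lives on E. *)
  pose b x := f x - cindic E x * f x.
  have mb : cmeasurable b by apply: cmeasurableB => //; exact: cmeasurableM.
  have : {ae mu, forall x, b x = 0}.
    apply: (G_eq0 alpha_gauge mb); apply/lee_addgt0Pr => e e0; rewrite add0e.
    have [g Wbg fg] := subspace_dense Wf e0.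
    have [_ lg] := Wbg; have [mg _] := lg.
    have [/ME[_ gE] _] : (L2_adherent Wb `&` @Linfty R) g by rewrite -bounded_part.
    apply/ltW; apply: le_lt_trans fg; apply: G_mono => //; first exact: cmeasurableB.
    apply: ae_imp gE => x; rewrite /b /cindic indicE; case: (x \in E) => /= h.
      by rewrite mul1r subrr cmod0 cmod_ge0.
    by rewrite h !mul0r !subr0.
  by apply: ae_imp => x /eqP; rewrite subr_eq0 => /eqP.
move=> [mf [k Lk fk]]; have mk := Lalpha_meas Lk.
apply: (subspace_ae cW (f := fun x => cindic E x * k x)) => //; last first.
  by apply: ae_imp fk => x ->.
apply: (subspace_closed cW); split; first exact: Lalpha_Mb.
have [_ ak] := Lk.
apply: alpha_adherentMb ak => //; first by move=> g [].
move=> g lg; apply: L2_closure_Linfty; last exact: LinftyM.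
apply/ME; split; first exact/Linfty_L2/LinftyM.
apply: aeW => x; rewrite mulrA; congr (_ * _).
by rewrite /cindic indicE; case: (x \in E); rewrite ?mul1r ?mul0r.
Qed.

End one_subspace.

Lemma mul_set_zinvariant (phi : T -> C) (S : set (T -> C)) :
  (forall f, S f -> S (fun x => zcoord x * f x)) ->
  mul_set (@zcoord R) (mul_set phi S) `<=` mul_set phi S.
Proof.
move=> zS f [mf [g [mg [k Sk gk]] fg]]; split => //.
exists (fun x => zcoord x * k x); first exact: zS.
by apply: ae_imp (ae_and fg gk) => x [-> ->]; rewrite mulrCA.
Qed.

Lemma Lalpha_zinvariant f : La f -> La (fun x => zcoord x * f x).
Proof. exact/Lalpha_Mb/(Hinfty_Linfty zcoord_Hinfty). Qed.

Lemma Halpha_zinvariant f : Ha f -> Ha (fun x => zcoord x * f x).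
Proof.
have lz := Hinfty_Linfty zcoord_Hinfty.
move=> [Lf af]; split; first exact: Lalpha_zinvariant.
apply: alpha_adherentMb (af) => //; first exact: Lalpha_meas Lf.
- by move=> g /Hinfty_Linfty/Linfty_meas.
- by move=> g; exact/HinftyM/zcoord_Hinfty.
Qed.

(* Multiplying by the outer function h with modulus min 1 w turns the weighted
   bound of the gauge into an L^1 bound, so that h f has no negative frequency;
   as h is cyclic, so has f none. *)
Lemma Halpha_Linfty f : Ha f -> Linfty f -> Hinfty f.
Proof.
move=> [Lf af] lf; have [mf _] := lf.
pose u x := Num.min 0 (ln (w x)).
have u0 x : u x <= 0 by rewrite ge_min lexx.
have mlw : measurable_fun setT (fun x => ln (w x)) by exact: measurableT_comp (@measurable_ln R) mw.
have ru : rint u.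
  apply: (rint_le _ _ (rint_norm rlw)); first exact: measurable_minr.
  move=> x; rewrite /u /Num.min; case: ifPn => h //.
  by rewrite normr0.
have [h [Hh hk _ hcyc]] := outer_exists u0 ru.
have lh := Hinfty_Linfty Hh; have [mh _] := lh.
have hw : {ae mu, forall x, cmod (h x) <= w x}.
  apply: ae_imp hk => x ->; rewrite -[leRHS]lnK ?posrE// ler_expR /u.
  by rewrite ge_min lexx orbT.
have Hhf : Hinfty (fun x => h x * f x).
  apply/HinftyP; split; first exact: LinftyM.
  move=> n; apply: cmod_eq0; apply/eqP; rewrite eq_le cmod_ge0 andbT.
  apply/ler_addgt0Pl => e e0; rewrite addr0.
  have [g Hg fg] := af _ (mulr_gt0 c0 e0).
  have lg := Hinfty_Linfty Hg; have [mg _] := lg.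
  have /HinftyP[lhg /(_ n) hg0] := HinftyM Hh Hg.
  have lhf := LinftyM lh lf.
  rewrite -[moment _ _]subr0 -hg0 -momentB; [|exact: Linfty_cint|exact: Linfty_cint].
  have lb := LinftyB lhf lhg.
  have lbz := LinftyM lb (Linfty_zpow R n.+1).
  apply: le_trans (cmod_cI (Linfty_cint lbz)) _.
  apply/ltW; apply: le_lt_trans (I_cmodw_lt alpha_gauge c0 mw w0 domw (cmeasurableB mf mg) fg).
  have [_ rbz] := Linfty_cint lbz.
  apply: I_le_ae rbz _ _.
    apply: (rint_cmodw alpha_gauge c0 mw w0 domw (cmeasurableB mf mg)).
    exact: lt_trans fg (ltry _).
  apply: ae_imp hw => x hx; rewrite cmodM cmod_zpow mulr1 -mulrBr cmodM mulrC.
  by rewrite ler_wpM2l// cmod_ge0.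
apply/HinftyP; split => // n; apply: cmod_eq0; apply/eqP.
rewrite -sqrf_eq0 eq_le sqr_ge0 andbT.
apply/ler_addgt0Pl => e e0; rewrite addr0.
have N0 : 0 < N2 f + 1 by rewrite ltr_wpDl ?N2_ge0.
(* f = p h f - (h p - 1) f: the first term is in H^infty by the step above, and Cauchy-Schwarz
   bounds the moments of the second by N2 (h p - 1) and N2 f. *)
have [p hp] := hcyc _ (divr_gt0 e0 N0).
have Hp : Hinfty (fun x : T => p.[zcoord x]) by apply: poly_Hinfty; exists p.
have lp := Hinfty_Linfty Hp.
have /HinftyP[lphf /(_ n) phf0] := HinftyM Hp Hhf.
rewrite -[moment _ _]subr0 -phf0 -momentB; [|exact: Linfty_cint|exact: Linfty_cint].
have lq : Linfty (fun x => h x * p.[zcoord x] - 1).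
  by apply: LinftyB; [exact: LinftyM|exact: Linfty_cst].
have lfz := LinftyM lf (Linfty_zpow R n.+1).
rewrite /moment (_ : (fun x => _) = fun x =>
    - ((h x * p.[zcoord x] - 1) * (f x * zpow n.+1 x))); last first.
  by apply/funext => x; ring.
rewrite cI_N ?cmodN; last exact/Linfty_cint/LinftyM.
apply: le_trans (CS (Linfty_L2 lq) (Linfty_L2 lfz)) _.
have -> : N2 (fun x => f x * zpow n.+1 x) = N2 f.
  by rewrite -[RHS](N2M1 f (cmod_zpow n.+1)); congr N2; apply/funext => x; rewrite mulrC.
move: hp; rewrite ltr_pdivlMr// => hp; apply/ltW/(le_lt_trans _ hp).
by rewrite ler_wpM2l ?N2_ge0// lerDl.
Qed.

(** If W = phi H^alpha, it contains phi, a bounded element of H^alpha, hence of H^infty. If W =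
    chi_E L^alpha, it contains chi_E z^m for every integer m; all of these being analytic, chi_E has
    no moments and W is zero. *)
Lemma invariant_subspace_Halpha W : closed_subspace alpha W ->
  mul_set (@zcoord R) W `<=` W -> W <> @zero_subspace R -> W `<=` Ha ->
  exists2 phi, inner phi & W = mul_set phi Ha.
Proof.
move=> cW zW Wn0 WHa.
have [[phi uphi WE]|[E mE WE]] := invariant_subspaceP cW zW.
  exists phi => //; split => //; have lphi := unimodular_Linfty uphi.
  apply: Halpha_Linfty => //; apply: WHa; rewrite WE; split; first by case: uphi.
  exists (fun=> 1); last by apply: aeW => x; rewrite mulr1.
  split; first exact/Linfty_Lalpha/Linfty_cst.
  exact/alpha_adherent_sub/cst_Hinfty.
exfalso; apply: Wn0; have lE := Linfty_indic mE; have [mcE _] := lE.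
have HE m : Hinfty (fun x => cindic E x * zpow m x).
  have lz := Linfty_zpow R m; have lEz := LinftyM lE lz; have [mEz _] := lEz.
  apply: Halpha_Linfty => //; apply: WHa; rewrite WE; split => //.
  exists (zpow m); [exact: Linfty_Lalpha|exact: aeW].
have E0 : {ae mu, forall x, cindic E x = 0}.
  apply: moment_unique (Linfty_cint lE) _ => m.
  (* The m-th moment of chi_E is the first moment of chi_E z^(m - 1). *)
  have /HinftyP[_ /(_ 0%N) <-] := HE (m - 1).
  congr cintegral; apply/funext => x.
  by rewrite -mulrA -zpowD subrK.
apply/seteqP; split => f.
  rewrite WE => -[mf [k _ fk]]; split => //.
  by apply: ae_imp (ae_and fk E0) => x [-> ->]; rewrite mul0r.
move=> [mf f0]; apply: (subspace_ae cW (subspace0 cW)) => //.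
by apply: ae_imp f0 => x ->.
Qed.

End invariant_subspaces.

Theorem theorem3p12 (R : realType) (alpha : (circle R -> R[i]) -> R) (c : R)
    (lambda : probability (circle R) R)
    (alpha_gauge : normalized_gauge_norm alpha)
    (alpha_cont : continuous_gauge alpha)
    (c_gt0 : 0 < c)
    (lambda_mu : lambda `<< arc_length R)
    (mu_lambda : arc_length R `<< lambda)
    (alpha_dom : dominating c lambda alpha)
    (log_int : (arc_length R).-integrable setT (fun x =>
       lne `|Radon_Nikodym (charge_of_finite_measure lambda) (arc_length R) x|%E)) :
  (forall W, closed_subspace alpha W ->
     (mul_set (@zcoord R) W `<=` W <->
      (exists2 phi, unimodular phi & W = mul_set phi (Halpha alpha)) \/
      (exists2 E : set (circle R), measurable E &
         W = mul_set (cindic E) (Lalpha alpha)))) /\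
  (forall W, closed_subspace alpha W ->
     mul_set (@zcoord R) W `<=` W ->
     W <> @zero_subspace R -> W `<=` Halpha alpha ->
     exists2 phi, inner phi & W = mul_set phi (Halpha alpha)).
Proof.
have [w [mw w0 rlw domw]] := density_exists alpha_gauge lambda_mu alpha_dom log_int.
split => W cW; last exact: invariant_subspace_Halpha domw W cW.
split; first exact: invariant_subspaceP domw W cW.
(* Multiplication by z commutes with multiplication by phi or chi_E, so invariance reduces to that
   of H^alpha and L^alpha. *)
move=> [[phi _ ->]|[E _ ->]]; apply: mul_set_zinvariant => f.
- exact: Halpha_zinvariant.
- exact: Lalpha_zinvariant.
Qed.
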